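(* Suppose that $(g_j)$ is an orthonormal sequence in $L^2(\mathbb{S}^2)$ for which $\langle g_j,\tilde{g}_k\rangle=0$ for all $j\neq k$, where $\tilde{g}(\omega):=\overline{g(-\omega)}$. Let $K^*=\bigcup_j\operatorname{supp}(g_j)^\diamond$. Then for every signed weight function $w$ on $\mathbb{R}^3$, $$\sum_j\left(\int_{\mathbb{R}^3}|\widehat{g_j\mathrm{d}\sigma}(x)|^2w(x)\,\mathrm{d}x\right)^2\leq \int_{K^*}\int_{\langle\omega\rangle^\perp}|Xw(\omega,v)|^2\,\mathrm{d}v\,\mathrm{d}\sigma(\omega).$$
   Context: $\mathrm{d}\sigma$ is surface measure on the unit sphere $\mathbb{S}^{2}\subset\mathbb{R}^3$; $L^2(\mathbb{S}^{2})$ is the space of complex-valued square-integrable functions with respect to $\mathrm{d}\sigma$, with inner product $\langle\cdot,\cdot\rangle$; $\operatorname{supp}(g)$ is the (closed, essential) support. The extension operator is $$\widehat{g\mathrm{d}\sigma}(x)=\int_{\mathbb{S}^{2}}g(\xi)e^{-2\pi i x\cdot\xi}\,\mathrm{d}\sigma(\xi),\qquad x\in\mathbb{R}^3.$$ The X-ray transform of $w$ is $Xw(\omega,v)=\int_{-\infty}^\infty w(v+t\omega)\,\mathrm{d}t$ for $\omega\in\mathbb{S}^{2}$ and $v\in\langle\omega\rangle^\perp$ (the plane through the origin orthogonal to $\omega$, with Lebesgue measure $\mathrm{d}v$). For $\omega,\omega'\in\mathbb{S}^{2}$ put $R_\omega\omega'=2(\omega\cdot\omega')\omega-\omega'$.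 A point $\omega$ is a great-circular (geodesic) midpoint of $\omega',\omega''$ if $\omega''=R_\omega\omega'$. For $E\subseteq\mathbb{S}^{2}$, $E^\diamond$ is the set of all midpoints of pairs of points of $E$: $E^\diamond=\{\omega\in\mathbb{S}^{2}: R_\omega\omega'\in E\text{ for some }\omega'\in E\}$. A signed weight function is a real-valued test function $w$ on $\mathbb{R}^3$, taken here in the Schwartz class. *)

(* Defs.v *)
From HB Require Import structures.
From mathcomp Require Import all_boot all_order all_algebra.
From mathcomp Require Import all_classical all_reals all_analysis.
From mathcomp Require Import ring.
From mathcomp Require Import measurable_realfun.
From mathcomp Require Import complex.

Set Implicit Arguments.
Unset Strict Implicit.
Unset Printing Implicit Defensive.

Import Order.TTheory GRing.Theory Num.Theory.
Import numFieldNormedType.Exports.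

Local Open Scope classical_set_scope.
Local Open Scope ring_scope.

(* R * R * R carries the usual topology, Borel sigma-algebra and derivatives of
   R^3, but its library norm is the maximum norm: the Euclidean structure is
   given by [dot3] and [norm3] below. *)
Notation R3 R := (R * R * R)%type (only parsing).

(* The same carriers, with the presentation of the Borel sigma-algebra over
   which the library's [lebesgue_measure] is declared. *)
Notation mR2 R := (measurableTypeR R * measurableTypeR R)%type (only parsing).
Notation mR3 R := (mR2 R * measurableTypeR R)%type (only parsing).

Section euclidean.
Context {R : realType}.
Implicit Types x y v omega : R3 R.

Definition dot3 x y : R := x.1.1 * y.1.1 + x.1.2 * y.1.2 + x.2 * y.2.

Definition norm3 x : R := Num.sqrt (dot3 x x).

Definition sphere2 : set (R3 R) := [set x | norm3 x = 1].

Definition perp omega : set (R3 R) := [set v | dot3 v omega = 0].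

Definition reflect3 omega x : R3 R := (2 * dot3 omega x) *: omega - x.

Definition diamond (E : set (R3 R)) : set (R3 R) :=
  [set omega | sphere2 omega /\ exists2 x, E x & E (reflect3 omega x)].

Lemma dot3_ge0 x : 0 <= dot3 x x.
Proof. by rewrite /dot3 -!expr2 !addr_ge0 ?sqr_ge0. Qed.

Lemma norm3_ge0 x : 0 <= norm3 x.
Proof. exact: sqrtr_ge0. Qed.

Lemma sphere2P x : sphere2 x <-> dot3 x x = 1.
Proof.
rewrite /sphere2/= /norm3; split => [h|->]; last exact: sqrtr1.
by rewrite -(sqr_sqrtr (dot3_ge0 x)) h expr1n.
Qed.

End euclidean.

Section lebesgue.
Context {R : realType}.

Definition leb2 : {measure set (mR2 R) -> \bar R} :=
  (@lebesgue_measure R \x @lebesgue_measure R)%E.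

Definition leb3 : {measure set (mR3 R) -> \bar R} :=
  ((@lebesgue_measure R \x @lebesgue_measure R) \x @lebesgue_measure R)%E.

End lebesgue.

Section surface_measure.
Context {R : realType}.

Definition normalize3 (x : R3 R) : R3 R := (norm3 x)^-1 *: x.

Definition pball3 : set (R3 R) := [set x | 0 < norm3 x <= 1].

(* Surface measure on the sphere, as the measure on R^3 carried by the sphere
   and given there by polar coordinates: sigma(A) is 3 times the volume of the
   cone {r a | 0 < r <= 1, a in A}; the total mass is 4 pi. *)
Definition surface_measure (A : set (mR3 R)) : \bar R :=
  (3%:E * leb3 ([set x : R3 R | A (normalize3 x)] `&` pball3))%E.

Let m11 : measurable_fun [set: mR3 R] (fun x : mR3 R => x.1.1 : R).
Proof. exact: (measurableT_comp measurable_fst measurable_fst). Qed.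

Let m12 : measurable_fun [set: mR3 R] (fun x : mR3 R => x.1.2 : R).
Proof. exact: (measurableT_comp measurable_snd measurable_fst). Qed.

Let m2 : measurable_fun [set: mR3 R] (fun x : mR3 R => x.2 : R).
Proof. exact: measurable_snd. Qed.

Lemma measurable_norm3 : measurable_fun [set: mR3 R] (@norm3 R : mR3 R -> R).
Proof.
have -> : (@norm3 R : mR3 R -> R) = (fun x => dot3 x x `^ 2^-1).
  by apply/funext => x; rewrite powR12_sqrt// dot3_ge0.
apply: (measurableT_comp (measurable_powR _)).
rewrite /dot3.
by repeat (apply: measurable_funD || apply: measurable_funM).
Qed.

Lemma measurable_normalize3 :
  measurable_fun [set: mR3 R] (@normalize3 : mR3 R -> mR3 R).
Proof.
have mi : measurable_fun [set: mR3 R] (fun x : mR3 R => (norm3 x)^-1 : R).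
  have -> : (fun x : mR3 R => (norm3 x)^-1 : R) = (fun x => norm3 x `^ (-1)).
    by apply/funext => x; rewrite powR_inv1// norm3_ge0.
  exact: (measurableT_comp (measurable_powR _) measurable_norm3).
apply: measurable_fun_pair; [apply: measurable_fun_pair|].
- exact: (measurable_funM mi m11).
- exact: (measurable_funM mi m12).
- exact: (measurable_funM mi m2).
Qed.

Lemma measurable_pball3 : measurable (pball3 : set (mR3 R)).
Proof.
have -> : pball3 = [set: mR3 R] `&` (@norm3 R : mR3 R -> R) @^-1` `]0, 1].
  by rewrite setTI; apply/seteqP; split => x; rewrite /pball3/= in_itv.
exact: measurable_norm3.
Qed.

Let sigma0 : surface_measure set0 = 0%E.
Proof. by rewrite /surface_measure set0I measure0 mule0. Qed.

Let sigma_ge0 A : (0 <= surface_measure A)%E.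
Proof. by rewrite /surface_measure mule_ge0. Qed.

Let sigma_additive : semi_sigma_additive surface_measure.
Proof.
pose p := measure_function_pushforward__canonical__measure_function_Measure
  (mrestr leb3 measurable_pball3) measurable_normalize3.
exact: (@measure_semi_sigma_additive _ _ _ (mscale 3%:nng p)).
Qed.

HB.instance Definition _ := isMeasure.Build _ _ _ surface_measure
  sigma0 sigma_ge0 sigma_additive.

End surface_measure.

Section plane_measure.
Context {R : realType}.
Implicit Types (x u v omega : R3 R) (e : R3 R * R3 R).

Definition plane_frame omega e : Prop :=
  [/\ dot3 e.1 e.1 = 1, dot3 e.2 e.2 = 1, dot3 e.1 e.2 = 0,
      perp omega e.1 & perp omega e.2].

Lemma plane_frame_ex omega : sphere2 omega -> exists e, plane_frame omega e.
Proof.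
move: omega => [[a b] c] /sphere2P; rewrite /dot3/= => h.
have [ab0|ab0] := eqVneq (a ^+ 2 + b ^+ 2) 0.
  move/eqP : ab0; rewrite paddr_eq0 ?sqr_ge0// !sqrf_eq0 => /andP[/eqP a0 /eqP b0].
  exists ((1, 0, 0), (0, 1, 0)).
  by split; rewrite /perp /dot3/= ?a0 ?b0; ring.
set r := Num.sqrt (a ^+ 2 + b ^+ 2).
have r2 : r ^+ 2 = a ^+ 2 + b ^+ 2 by rewrite sqr_sqrtr// addr_ge0 ?sqr_ge0.
have r0 : r != 0 by apply: contra_neq ab0 => r0; rewrite -r2 r0 expr0n.
have hc : c ^+ 2 = 1 - r ^+ 2 by rewrite r2 -h; ring.
exists ((- b / r, a / r, 0), (- (c * a) / r, - (c * b) / r, r)).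
split; rewrite /perp /dot3/=.
- transitivity ((a ^+ 2 + b ^+ 2) / r ^+ 2); first by field.
  by rewrite r2 divff.
- transitivity (c ^+ 2 * (a ^+ 2 + b ^+ 2) / r ^+ 2 + r ^+ 2); first by field.
  by rewrite -r2 mulfK ?expf_neq0// hc; ring.
- by field.
- by field.
- transitivity (c * (r ^+ 2 - (a ^+ 2 + b ^+ 2)) / r); first by field.
  by rewrite r2 subrr mulr0 mul0r.
Qed.

(* Some orthonormal basis of the plane orthogonal to omega; which one is
   irrelevant, as planar Lebesgue measure is invariant under isometries. *)
Definition frame3 omega : R3 R * R3 R := xget (0, 0) (plane_frame omega).

Lemma frame3P omega : sphere2 omega -> plane_frame omega (frame3 omega).
Proof. by move=> /plane_frame_ex; exact: xgetPex. Qed.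

Definition plane_map omega (p : R * R) : R3 R :=
  p.1 *: (frame3 omega).1 + p.2 *: (frame3 omega).2.

Lemma measurable_plane_map omega :
  measurable_fun [set: mR2 R] (plane_map omega : mR2 R -> mR3 R).
Proof.
have m1 : measurable_fun [set: mR2 R] (fun p : mR2 R => p.1 : R).
  exact: measurable_fst.
have m2 : measurable_fun [set: mR2 R] (fun p : mR2 R => p.2 : R).
  exact: measurable_snd.
have mc (a b : R) :
    measurable_fun [set: mR2 R] (fun p : mR2 R => (p.1 * a + p.2 * b : R)).
  by apply: measurable_funD; apply: measurable_funM.
apply: measurable_fun_pair; [apply: measurable_fun_pair|].
- exact: (mc (frame3 omega).1.1.1 (frame3 omega).2.1.1).
- exact: (mc (frame3 omega).1.1.2 (frame3 omega).2.1.2).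
- exact: (mc (frame3 omega).1.2 (frame3 omega).2.2).
Qed.

(* Lebesgue measure on the plane orthogonal to omega, i.e. the image of
   Lebesgue measure on R^2 under a linear isometry onto that plane. *)
Definition plane_measure omega (A : set (mR3 R)) : \bar R :=
  leb2 [set p : R * R | A (plane_map omega p)].

Section measure.
Variable omega : R3 R.

Let plane0 : plane_measure omega set0 = 0%E.
Proof. exact: measure0. Qed.

Let plane_ge0 A : (0 <= plane_measure omega A)%E.
Proof. exact: measure_ge0. Qed.

Let plane_additive : semi_sigma_additive (plane_measure omega).
Proof.
exact: (@measure_semi_sigma_additive _ _ _
  (measure_function_pushforward__canonical__measure_function_Measure
     leb2 (measurable_plane_map omega))).
Qed.

HB.instance Definition _ := isMeasure.Build _ _ _ (plane_measure omega)
  plane0 plane_ge0 plane_additive.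

End measure.
End plane_measure.

Section weights.
Context {R : realType}.
Implicit Types (w : R3 R -> R) (x v omega : R3 R).

Definition basis3 (i : 'I_3) : R3 R :=
  (((i == 0 :> nat)%:R, (i == 1 :> nat)%:R), (i == 2 :> nat)%:R).

Definition partials (s : seq 'I_3) w : R3 R -> R :=
  foldr (fun i f x => 'D_(basis3 i) f x) w s.

Definition schwartz w : Prop :=
  forall s : seq 'I_3,
    (forall x, differentiable (partials s w) x) /\
    (forall k : nat, exists C : R,
       forall x, norm3 x ^+ k * `|partials s w x| <= C).

Definition xray w omega v : R :=
  \int[@lebesgue_measure R]_t w (v + (t : R) *: omega).

End weights.

Section sphere_functions.
Context {R : realType}.
Implicit Types g h : R3 R -> R[i].

Definition cintegral (mu : {measure set (mR3 R) -> \bar R}) (D : set (R3 R))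
    (f : R3 R -> R[i]) : R[i] :=
  ((\int[mu]_(x in D) complex.Re (f x)) +i*
   (\int[mu]_(x in D) complex.Im (f x)))%C.

(* Only the values on the sphere of a function R^3 -> C matter here. *)
Definition L2_sphere g : Prop :=
  [/\ measurable_fun sphere2 (fun x => complex.Re (g x)),
      measurable_fun sphere2 (fun x => complex.Im (g x)) &
      (\int[surface_measure]_(x in sphere2) (Normc.normc (g x) ^+ 2)%:E < +oo)%E].

Definition inner_sphere g h : R[i] :=
  cintegral surface_measure sphere2 (fun x => g x * (h x)^*%C).

Definition antipodal_conj g : R3 R -> R[i] := fun x => ((g (- x))^*)%C.

Definition ess_support g : set (R3 R) :=
  sphere2 `\` \bigcup_(U in [set U : set (R3 R) | open U /\
    {ae surface_measure, forall x, sphere2 x -> U x -> g x = 0}]) U.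

Definition extension g (x : R3 R) : R[i] :=
  cintegral surface_measure sphere2
    (fun xi => let t := 2 * pi * dot3 x xi in
               g xi * (cos t -i* sin t)%C).

End sphere_functions.

(* Main.v *)
Require Import Defs.
From HB Require Import structures.
From mathcomp Require Import all_boot all_order all_algebra.
From mathcomp Require Import all_classical all_reals all_analysis.
From mathcomp Require Import ring lra measurable_realfun.
From mathcomp Require Import complex.

Set Implicit Arguments.
Unset Strict Implicit.
Unset Printing Implicit Defensive.

Import Order.TTheory GRing.Theory Num.Theory.
Import numFieldNormedType.Exports.

Local Open Scope classical_set_scope.
Local Open Scope ring_scope.

(* With a_j(xi, eta) = g_j(xi) conj(g_j(eta)), the j-th energy is the pairing of
   a_j with the kernel w^(xi - eta) on S^2 x S^2. The kernel is invariant under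
   (xi, eta) -> (- eta, - xi), so a_j may be averaged over this involution; by
   the two orthogonality hypotheses the averages are orthogonal and of norm at
   most 1. Let T be the set of pairs charged by some average. Bessel's inequality
   for the kernel truncated to T bounds the sum by the integral of
   |w^(xi - eta)|^2 over T.

   Substitute eta = R_omega xi: the midpoint omega, which lies in K*, covers the
   sphere twice with Jacobian 4 |omega . xi|, and xi - eta is twice the projection
   of xi to the plane orthogonal to omega. Integrating first in xi leaves, for
   each omega, the integral of |w^|^2 over the disc of radius 2 of that plane. By
   the Fourier slice theorem w^ is there the Fourier transform of Xw(omega, .),
   and Plancherel's inequality concludes. *)

(** * Lebesgue measure on R^2 and R^3 *)

(** The constant 1 is the outcome of factors that cancel. A Jacobian 4 |omega . xi| over two sheets
    leaves the weight 2 |omega . xi|. The chord map is two-to-one from the sphere onto the disc of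
    radius 2, and this weight is exactly what it needs to produce planar Lebesgue measure with
    coefficient 1.

    Measurability shapes the final comparison. K* is a projection of a measurable set of pairs, and
    the frames of the planes are arbitrary choices, so neither K* nor the inner integral as a
    function of omega is known to be measurable. Tonelli's theorem is therefore applied to an
    auxiliary measurable function of omega, which is compared with the target point by point. An
    integral of nonnegative functions is a supremum over simple functions, hence monotone without
    measurability.

    Plancherel is needed only as an upper bound on a disc. Damping by an exponential gives a bound
    uniform in the damping parameter, because the Poisson kernel has mass 1, so no Fourier inversion
    enters.

    The averages have norm at most 1, not 1, because the antipodal hypothesis is silent about j =
    k. *)

Section generic.
Context d1 d2 (T1 : measurableType d1) (T2 : measurableType d2) (R : realType).

Lemma measurable_integral_fst (m2 : {sigma_finite_measure set T2 -> \bar R})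
    (f : T1 * T2 -> \bar R) : measurable_fun [set: T1 * T2] f ->
  measurable_fun [set: T1] (fun x => \int[m2]_y f (x, y))%E.
Proof.
move=> mf.
rewrite (_ : (fun x => _) =
  ((fun x => \int[m2]_y f^\+ (x, y)) \- (fun x => \int[m2]_y f^\- (x, y)))%E).
  apply: emeasurable_funB; apply: measurable_fun_fubini_tonelli_F => //.
    exact: measurable_funepos.
  exact: measurable_funeneg.
apply/funext => x; rewrite integralE.
under eq_integral do rewrite funepos_comp/=.
by under [X in (_ - X = _)%E]eq_integral do rewrite funeneg_comp/=.
Qed.

Lemma measurable_Rintegral_fst (m2 : {sigma_finite_measure set T2 -> \bar R})
    (f : T1 * T2 -> R) : measurable_fun [set: T1 * T2] f ->
  measurable_fun [set: T1] (fun x => \int[m2]_y f (x, y)).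
Proof.
move=> mf; apply: (measurableT_comp (@fine_measurable R setT measurableT)).
apply: (@measurable_integral_fst m2 (EFin \o f)); exact/measurable_EFinP.
Qed.

Lemma ge0_integral_swap (m1 : {sigma_finite_measure set T1 -> \bar R})
    (m2 : {sigma_finite_measure set T2 -> \bar R}) (g : T1 -> T2 -> \bar R) :
  measurable_fun [set: T1 * T2] (fun z => g z.1 z.2) ->
  (forall x y, 0 <= g x y)%E ->
  (\int[m1]_x \int[m2]_y g x y = \int[m2]_y \int[m1]_x g x y)%E.
Proof.
move=> mg g0.
exact: (@sfinite_Fubini _ _ _ _ R m1 m2 (fun z => g z.1 z.2)).
Qed.

(** Both integrals are suprema over simple functions lying below, so measurability of [f], [g] and
    [D] does not enter. This is how K* is handled. *)
Lemma le_ge0_integral d (T : measurableType d)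
    (mu : {measure set T -> \bar R}) (f g : T -> \bar R) (D : set T) :
  (forall x, D x -> 0 <= f x)%E -> (forall x, D x -> f x <= g x)%E ->
  (\int[mu]_(x in D) f x <= \int[mu]_(x in D) g x)%E.
Proof.
move=> f0 fg; rewrite !ge0_integralE//.
apply: le_ereal_sup => _ [h hf <-]; exists h => // x.
apply: le_trans (hf x) _; rewrite /patch; case: ifPn => // /set_mem; exact: fg.
by move=> x Dx; exact: le_trans (f0 _ Dx) (fg _ Dx).
Qed.

End generic.

Section lebesgue1.
Context {R : realType}.
Local Notation lam := (@lebesgue_measure R).
Local Notation mR := (measurableTypeR R).

(** Translation, like dilation below, pushes Lebesgue measure to a measure whose values on half-open
    intervals are known, and these determine it. *)
Lemma lebesgue_integral_translate (a : R) (f : mR -> \bar R) :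
  measurable_fun [set: mR] f -> (forall x, 0 <= f x)%E ->
  (\int[lam]_x f (x + a)%R = \int[lam]_x f x)%E.
Proof.
move=> mf f0.
have mt : measurable_fun [set: mR] (fun x : mR => (x + a)%R : mR).
  by apply: measurable_funD.
rewrite -[LHS](@ge0_integral_pushforward _ _ _ _ _ _ mt lam setT f)//.
apply: eq_measure_integral => A mA _; apply/esym.
pose p := measure_function_pushforward__canonical__measure_function_Measure lam mt.
apply: (@lebesgue_measure_unique R p) => // _ [[x y]] _ <-.
rewrite /= /pushforward.
rewrite (_ : _ @^-1` _ = [set` `](x - a), (y - a)]]); last first.
  by apply/seteqP; split => t/=; rewrite !in_itv/= ltrBlDr lerBrDr.
by rewrite !lebesgue_measure_itv/= !lte_fin ltrD2r -!EFinB; case: ifP => // _;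
  congr EFin; ring.
Qed.

Lemma lebesgue_integral_scale (c : R) (f : mR -> \bar R) : 0 < c ->
  measurable_fun [set: mR] f -> (forall x, 0 <= f x)%E ->
  (\int[lam]_x f x = c%:E * \int[lam]_x f (c * x)%R)%E.
Proof.
move=> c0 mf f0.
have mt : measurable_fun [set: mR] (fun x : mR => (c * x)%R : mR).
  by apply: measurable_funM.
have c0' : 0 <= c by exact: ltW.
rewrite -(@ge0_integral_pushforward _ _ _ _ _ _ mt lam setT f)//.
rewrite -[c]/(NngNum c0')%:num -ge0_integral_mscale//.
apply: eq_measure_integral => A mA _.
pose p := measure_function_pushforward__canonical__measure_function_Measure lam mt.
apply: (@lebesgue_measure_unique R (mscale (NngNum c0') p)) => // _ [[x y]] _ <-.
rewrite /= /mscale/= /pushforward.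
rewrite (_ : _ @^-1` _ = [set` `](x / c), (y / c)]]); last first.
  by apply/seteqP; split => t/=; rewrite !in_itv/= ltr_pdivrMr// ler_pdivlMr// mulrC.
rewrite !lebesgue_measure_itv/= !lte_fin ltr_pM2r ?invr_gt0//.
case: ifP => // _; last by rewrite mule0.
by rewrite -!EFinB -EFinM; congr EFin; field; rewrite gt_eqF.
Qed.

Lemma lebesgue_integral_opp (f : mR -> \bar R) :
  measurable_fun [set: mR] f -> (forall x, 0 <= f x)%E ->
  (\int[lam]_x f (- x)%R = \int[lam]_x f x)%E.
Proof.
move=> mf f0.
have mt : measurable_fun [set: mR] (fun x : mR => (- x)%R : mR).
  by apply: measurable_funN.
rewrite -[LHS](@ge0_integral_pushforward _ _ _ _ _ _ mt lam setT f)//.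
by apply: eq_measure_integral => A mA _; exact: lebesgue_measureN.
Qed.

End lebesgue1.

(** * Measurability of the vector operations *)

Section R3_measurability.
Context d (T : measurableType d) (R : realType).
Implicit Types (f g : T -> mR3 R) (c : T -> R).

Lemma measurable_R3D f g : measurable_fun [set: T] f ->
  measurable_fun [set: T] g ->
  measurable_fun [set: T] (fun x => (f x : R3 R) + (g x : R3 R) : mR3 R).
Proof.
move=> mf mg.
have -> : (fun x => (f x : R3 R) + (g x : R3 R) : mR3 R) = (fun x =>
    ((f x).1.1 + (g x).1.1, (f x).1.2 + (g x).1.2, (f x).2 + (g x).2)).
  by apply/funext => x; case: (f x) => [[? ?] ?]; case: (g x) => [[? ?] ?].
by apply: measurable_fun_pair; [apply: measurable_fun_pair|];
  apply: measurable_funD; do ?[exact: (measurableT_comp measurable_fst)|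
   exact: (measurableT_comp measurable_snd)|
   apply: (measurableT_comp measurable_fst)|
   apply: (measurableT_comp measurable_snd)].
Qed.

Lemma measurable_R3Z c f : measurable_fun [set: T] c ->
  measurable_fun [set: T] f ->
  measurable_fun [set: T] (fun x => c x *: (f x : R3 R) : mR3 R).
Proof.
move=> mc mf.
have -> : (fun x => c x *: (f x : R3 R) : mR3 R) = (fun x =>
    (c x * (f x).1.1, c x * (f x).1.2, c x * (f x).2)).
  by apply/funext => x; case: (f x) => [[? ?] ?].
by apply: measurable_fun_pair; [apply: measurable_fun_pair|];
  apply: measurable_funM => //; do ?[exact: (measurableT_comp measurable_fst)|
   exact: (measurableT_comp measurable_snd)|
   apply: (measurableT_comp measurable_fst)|
   apply: (measurableT_comp measurable_snd)].
Qed.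

Lemma measurable_R3N f : measurable_fun [set: T] f ->
  measurable_fun [set: T] (fun x => - (f x : R3 R) : mR3 R).
Proof.
move=> mf.
have -> : (fun x => - (f x : R3 R) : mR3 R) = (fun x => -1 *: (f x : R3 R) : mR3 R).
  by apply/funext => x; rewrite scaleN1r.
exact: measurable_R3Z.
Qed.

Lemma measurable_dot3 f g : measurable_fun [set: T] f ->
  measurable_fun [set: T] g ->
  measurable_fun [set: T] (fun x => dot3 (f x : R3 R) (g x : R3 R) : R).
Proof.
move=> mf mg; rewrite /dot3.
by do ?[apply: measurable_funD]; apply: measurable_funM;
  do ?[exact: (measurableT_comp measurable_fst)|
   exact: (measurableT_comp measurable_snd)|
   apply: (measurableT_comp measurable_fst)|
   apply: (measurableT_comp measurable_snd)].
Qed.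

Lemma measurable_norm3_comp f : measurable_fun [set: T] f ->
  measurable_fun [set: T] (fun x => norm3 (f x : R3 R) : R).
Proof. by move=> mf; apply: (measurableT_comp measurable_norm3). Qed.

Lemma measurable_normalize3_comp f : measurable_fun [set: T] f ->
  measurable_fun [set: T] (fun x => normalize3 (f x : R3 R) : mR3 R).
Proof. by move=> mf; apply: (measurableT_comp measurable_normalize3). Qed.

(** [powR_inv1] is about nonnegative reals, hence the detour through c * (c ^ 2)^-1, which equals
    c^-1 also at 0, where both vanish. *)
Lemma measurable_inv c : measurable_fun [set: T] c ->
  measurable_fun [set: T] (fun x => (c x)^-1 : R).
Proof.
move=> mc; have -> : (fun x => (c x)^-1 : R) = (fun x => c x * (c x ^+ 2) `^ (-1)).
  apply/funext => x; rewrite powR_inv1 ?sqr_ge0//.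
  have [->|c0] := eqVneq (c x) 0; first by rewrite mul0r invr0.
  by rewrite expr2 invfM mulrA mulfV// mul1r.
apply: measurable_funM => //; apply: (measurableT_comp (measurable_powR _)).
exact: measurable_funX.
Qed.

Lemma measurable_sqrt c : measurable_fun [set: T] c ->
  measurable_fun [set: T] (fun x => Num.sqrt (c x) : R).
Proof.
move=> mc; have mf : measurable_fun [set: R] (@Num.sqrt R).
  by apply: continuous_measurable_fun; exact: sqrt_continuous.
exact: (measurableT_comp mf mc).
Qed.

Lemma measurable_cos c : measurable_fun [set: T] c ->
  measurable_fun [set: T] (fun x => cos (c x) : R).
Proof.
move=> mc; have mf : measurable_fun [set: R] (@cos R).
  by apply: continuous_measurable_fun; exact: continuous_cos.
exact: (measurableT_comp mf mc).
Qed.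

Lemma measurable_sin c : measurable_fun [set: T] c ->
  measurable_fun [set: T] (fun x => sin (c x) : R).
Proof.
move=> mc; have mf : measurable_fun [set: R] (@sin R).
  by apply: continuous_measurable_fun; exact: continuous_sin.
exact: (measurableT_comp mf mc).
Qed.

Lemma measurable_exp c : measurable_fun [set: T] c ->
  measurable_fun [set: T] (fun x => expR (c x) : R).
Proof. by move=> mc; apply: measurableT_comp mc; exact: measurable_expR. Qed.

Lemma measurable_bool_indic (b : T -> bool) : measurable_fun [set: T] b ->
  measurable_fun [set: T] (fun x => (b x)%:R : R).
Proof.
move=> mb; have -> : (fun x => (b x)%:R : R) = (fun x => if b x then 1 else 0).
  by apply/funext => x; case: (b x).
exact: measurable_fun_ifT.
Qed.

End R3_measurability.

(** Syntax-directed proof of measurability. The patterns without a binder catch eta-reduced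
    functions, sums are tried as scalars and then as vectors, hypotheses serve for function heads,
    and whatever matches nothing else must be constant. *)
Ltac mfun1 := lazymatch goal with
  | H : measurable_fun _ ?f |- measurable_fun _ ?f => exact: H
  | |- measurable_fun _ (fun x => (@?a x, @?b x)) => apply: measurable_fun_pair
  | |- measurable_fun _ (pair _) => apply: measurable_fun_pair
  | |- measurable_fun _ fst => exact: measurable_fst
  | |- measurable_fun _ snd => exact: measurable_snd
  | |- measurable_fun _ (fun x => (@?a x + @?b x)%R) =>
      first [apply: measurable_funD | apply: measurable_R3D]
  | |- measurable_fun _ (fun x => (- @?a x)%R) =>
      first [apply: measurable_funN | apply: measurable_R3N]
  | |- measurable_fun _ (fun x => (@?a x *: @?b x)%R) => apply: measurable_R3Z
  | |- measurable_fun _ (fun x => dot3 (@?a x) (@?b x)) => apply: measurable_dot3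
  | |- measurable_fun _ (fun x => norm3 (@?a x)) => apply: measurable_norm3_comp
  | |- measurable_fun _ (fun x => normalize3 (@?a x)) =>
      apply: measurable_normalize3_comp
  | |- measurable_fun _ (Order.lt _) => apply: measurable_fun_ltr
  | |- measurable_fun _ (Order.le _) => apply: measurable_fun_ler
  | |- measurable_fun _ normalize3 => exact: measurable_normalize3
  | |- measurable_fun _ norm3 => exact: measurable_norm3
  | |- measurable_fun _ (dot3 _) => apply: measurable_dot3
  | |- measurable_fun _ (GRing.scale _) => apply: measurable_R3Z
  | |- measurable_fun _ Num.norm => exact: (@normr_measurable _ setT)
  | |- measurable_fun _ expR => exact: measurable_expR
  | |- measurable_fun _ GRing.inv => apply: (measurable_inv (c := fun x => x))
  | |- measurable_fun _ cos => apply: (measurable_cos (c := fun x => x))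
  | |- measurable_fun _ sin => apply: (measurable_sin (c := fun x => x))
  | |- measurable_fun _ (GRing.mul _) => apply: measurable_funM
  | |- measurable_fun _ (GRing.add _) =>
      first [apply: measurable_funD | apply: measurable_R3D]
  | |- measurable_fun _ GRing.opp =>
      first [apply: measurable_funN | apply: measurable_R3N]
  | |- measurable_fun _ (fun x => (@?a x)^-1%R) => apply: measurable_inv
  | |- measurable_fun _ (fun x => Num.sqrt (@?a x)) => apply: measurable_sqrt
  | |- measurable_fun _ (fun x => cos (@?a x)) => apply: measurable_cos
  | |- measurable_fun _ (fun x => sin (@?a x)) => apply: measurable_sin
  | |- measurable_fun _ (fun x => expR (@?a x)) => apply: measurable_exp
  | |- measurable_fun _ (fun x => (nat_of_bool (@?a x))%:R%R) =>
      apply: measurable_bool_indic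
  | |- measurable_fun _ (fun x => (@?a x <= @?b x)%R) => apply: measurable_fun_ler
  | |- measurable_fun _ (fun x => (@?a x < @?b x)%R) => apply: measurable_fun_ltr
  | |- measurable_fun _ (fun x => @?a x && @?b x) => apply: measurable_and
  | |- measurable_fun _ (fun x => `|@?a x|%R) =>
      apply: (measurableT_comp (@normr_measurable _ setT))
  | |- measurable_fun _ (fun x => (@?a x * @?b x)%R) => apply: measurable_funM
  | |- measurable_fun _ (fun x => (@?a x ^+ _)%R) => apply: measurable_funX
  | |- measurable_fun _ (fun x => (@?a x)%:E) => apply/measurable_EFinP
  | |- measurable_fun _ (fun x => (@?a x * @?b x)%E) => apply: emeasurable_funM
  | |- measurable_fun _ (fun x => fst (@?g x)) =>
      apply: (measurableT_comp measurable_fst)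
  | |- measurable_fun _ (fun x => snd (@?g x)) =>
      apply: (measurableT_comp measurable_snd)
  | |- measurable_fun _ (fun x => x) => exact: measurable_id
  | H : measurable_fun _ ?f |- measurable_fun _ (fun x => ?f (@?g x)) =>
      apply: (measurableT_comp H)
  | |- measurable_fun _ _ => exact: measurable_cst
  end.
Ltac mfun := repeat mfun1.

(** * Sigma-finite products; Lebesgue measure in dimensions two and three *)

Section prod_sigma_finite.
Context d1 d2 (T1 : measurableType d1) (T2 : measurableType d2) (R : realType).
Variable m1 : {sigma_finite_measure set T1 -> \bar R}.
Variable m2 : {sigma_finite_measure set T2 -> \bar R}.
Local Open Scope ereal_scope.

(** A name of its own for the product, so that it can carry a sigma-finite structure and the
    construction can be iterated. *)
Definition prodm : set (T1 * T2) -> \bar R := m1 \x m2.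

HB.instance Definition _ := Measure.copy prodm (m1 \x m2).

Let prodm_sigma_finite : sigma_finite setT prodm.
Proof.
have /sigma_finiteP[F [FT Fnd Ffin]] := sigma_finiteT m1.
have /sigma_finiteP[G [GT Gnd Gfin]] := sigma_finiteT m2.
exists (fun n => F n `*` G n).
  apply/seteqP; split => // -[x y] _.
  have [n _ Fx] : (\bigcup_n F n) x by rewrite -FT.
  have [k _ Gy] : (\bigcup_n G n) y by rewrite -GT.
  exists (n + k)%N => //; split => /=.
    by move/subsetPset : (Fnd n (n + k)%N (leq_addr _ _)) => /(_ _ Fx).
  by move/subsetPset : (Gnd k (n + k)%N (leq_addl _ _)) => /(_ _ Gy).
move=> n; have [? ?] := Ffin n; have [? ?] := Gfin n.
split; first exact: measurableX.
have -> : prodm (F n `*` G n) = m1 (F n) * m2 (G n).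
  exact: product_measure1E.
by rewrite lte_mul_pinfty// ge0_fin_numE.
Qed.

HB.instance Definition _ :=
  Measure_isSigmaFinite.Build _ _ _ prodm prodm_sigma_finite.

End prod_sigma_finite.

Section lebesgue23.
Context {R : realType}.
Local Notation lam := (@lebesgue_measure R).
Local Notation mR := (measurableTypeR R).
Local Open Scope ereal_scope.

(* [leb2] and [leb3] up to conversion, but registered as sigma-finite. *)
Definition leb2s : {sigma_finite_measure set (mR2 R) -> \bar R} :=
  prodm lam lam.
Definition leb3s : {sigma_finite_measure set (mR3 R) -> \bar R} :=
  prodm leb2s lam.

Lemma leb2_tonelli (f : mR2 R -> \bar R) :
  measurable_fun [set: mR2 R] f -> (forall x, 0 <= f x) ->
  \int[leb2]_x f x = \int[lam]_x \int[lam]_y f (x, y).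
Proof.
move=> mf f0.
exact: (@fubini_tonelli1 _ _ _ _ R lam lam f mf f0).
Qed.
Lemma leb3_tonelli (f : mR3 R -> \bar R) :
  measurable_fun [set: mR3 R] f -> (forall x, 0 <= f x) ->
  \int[leb3]_x f x = \int[leb2]_p \int[lam]_t f (p, t).
Proof.
move=> mf f0.
exact: (@fubini_tonelli1 _ _ _ _ R leb2s lam f mf f0).
Qed.
Lemma leb2_integral_scale (c : R) (f : mR2 R -> \bar R) : (0 < c)%R ->
  measurable_fun [set: mR2 R] f -> (forall x, 0 <= f x) ->
  \int[leb2]_x f x = (c ^+ 2)%:E * \int[leb2]_x f (c * x.1, c * x.2)%R.
Proof.
move=> c0 mf f0.
have mfc : measurable_fun [set: mR2 R] (fun x => f (c * x.1, c * x.2)%R).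
  by mfun.
rewrite [LHS]leb2_tonelli// leb2_tonelli// (lebesgue_integral_scale c0); last 2 first.
- exact: (measurable_integral_fst lam mf).
- by move=> x; exact: integral_ge0.
rewrite expr2 EFinM -muleA; congr (_ * _).
rewrite -ge0_integralZl_EFin//.
- apply: eq_integral => x _; rewrite (lebesgue_integral_scale c0)//; mfun.
- by move=> x _; exact: integral_ge0.
- exact: (measurable_integral_fst lam mfc).
- exact: ltW.
Qed.

Lemma leb3_integral_translate (a : R3 R) (f : mR3 R -> \bar R) :
  measurable_fun [set: mR3 R] f -> (forall x, 0 <= f x) ->
  \int[leb3]_x f ((x : R3 R) + a)%R = \int[leb3]_x f x.
Proof.
move=> mf f0; case: a => [[a b] c].
rewrite (_ : (fun x : mR3 R => f ((x : R3 R) + (a, b, c))%R) =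
  (fun x => f (x.1.1 + a, x.1.2 + b, x.2 + c)%R)); last first.
  by apply/funext => -[[]].
have mfc : measurable_fun [set: mR3 R]
  (fun x => f (x.1.1 + a, x.1.2 + b, x.2 + c)%R) by mfun.
rewrite [LHS](leb3_tonelli mfc (fun=> f0 _)) [RHS](leb3_tonelli mf f0).
have mg : measurable_fun [set: mR2 R] (fun p : mR2 R => \int[lam]_t f (p, t)).
  exact: measurable_integral_fst.
have g0 p : 0 <= \int[lam]_t f (p, t) by exact: integral_ge0.
transitivity (\int[leb2]_x \int[lam]_y f (x.1 + a, x.2 + b, y)%R).
  apply: eq_integral => x _.
  by rewrite -[RHS](lebesgue_integral_translate c)//; mfun.
rewrite [RHS]leb2_tonelli//.
rewrite [LHS](leb2_tonelli
  (f := fun x => \int[lam]_y f ((x.1 + a)%R, (x.2 + b)%R, y))) /=; last 2 first.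
- apply: (measurableT_comp (f := fun p : mR2 R => \int[lam]_t f (p, t)) mg
    (g := fun x : mR2 R => (x.1 + a, x.2 + b)%R)); mfun.
- by move=> x; exact: integral_ge0.
rewrite -[RHS](lebesgue_integral_translate a); last 2 first.
- exact: (measurable_integral_fst lam mg).
- by move=> x; exact: integral_ge0.
apply: eq_integral => x _.
have mgx : measurable_fun [set: mR] (fun y : mR => \int[lam]_t f ((x + a)%R, y, t)).
  by apply: (measurableT_comp mg (g := fun y : mR => ((x + a)%R, y))); mfun.
by rewrite -[RHS](lebesgue_integral_translate b mgx)// => y; exact: integral_ge0.
Qed.

End lebesgue23.

Section lebesgue23.
Context {R : realType}.
Local Notation lam := (@lebesgue_measure R).
Local Notation mR := (measurableTypeR R).
Local Open Scope ereal_scope.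

Lemma norm3N (x : R3 R) : norm3 (- x)%R = norm3 x.
Proof. by rewrite /norm3 /dot3/=; congr Num.sqrt; ring. Qed.

Lemma leb3_box (A B C : set mR) : measurable A -> measurable B ->
  measurable C -> leb3 ((A `*` B) `*` C) = lam A * lam B * lam C.
Proof.
move=> mA mB mC.
transitivity (leb2s (A `*` B) * lam C).
  exact: (@product_measure1E _ _ _ _ R leb2s lam _ _ (measurableX mA mB) mC).
congr (_ * _); exact: (@product_measure1E _ _ _ _ R lam lam _ _ mA mB).
Qed.

(** Finiteness here and positivity below allow the volume of the ball to be cancelled in the
    uniqueness argument for Haar measure. *)
Lemma leb3_pball3_lty : leb3 (pball3 : set (mR3 R)) < +oo.
Proof.
pose I : set mR := `[(-1)%R, 1%R]%classic.
have mI : measurable I by exact: measurable_itv.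
have sub : (pball3 : set (mR3 R)) `<=` (I `*` I) `*` I.
  move=> [[x y] z]; rewrite /pball3/= => /andP[_].
  rewrite -(ler_pXn2r (n := 2)) ?nnegrE ?norm3_ge0//.
  rewrite /norm3 sqr_sqrtr ?dot3_ge0// /dot3/= => h.
  by rewrite /I /= !in_itv/=; split; [split|]; apply/andP; split; nra.
apply: (@le_lt_trans _ _ (leb3 ((I `*` I) `*` I))).
  apply: le_measure sub; rewrite inE; first exact: measurable_pball3.
  by apply: measurableX => //; exact: measurableX.
rewrite leb3_box//.
by rewrite /I !lebesgue_measure_itv/= lte_fin gtrN// -!EFinB -!EFinM ltry.
Qed.

Lemma leb3_pball3_gt0 : 0 < leb3 (pball3 : set (mR3 R)).
Proof.
pose I : set mR := `]0%R, 2^-1%R]%classic.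
have mI : measurable I by exact: measurable_itv.
have sub : (I `*` I) `*` I `<=` (pball3 : set (mR3 R)).
  move=> [[x y] z]; rewrite /pball3 /I /= !in_itv/= => -[[/andP[x0 x1] /andP[y0 y1]] /andP[z0 z1]].
  rewrite /norm3 sqrtr_gt0 /dot3/=; apply/andP; split; first by nra.
  by rewrite -[leRHS]sqrtr1 ler_sqrt//; nra.
apply: (@lt_le_trans _ _ (leb3 ((I `*` I) `*` I))).
- rewrite leb3_box//.
  rewrite /I !lebesgue_measure_itv/= !lte_fin invr_gt0 ltr0n/=.
  by rewrite oppr0 !adde0 !mule_gt0// lte_fin invr_gt0.
- apply: le_measure sub; rewrite inE; last exact: measurable_pball3.
  by apply: measurableX => //; exact: measurableX.
Qed.

(* Uniqueness of Haar measure, with its proof: [\int\int f(A x) 1_B(y) dy dx]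
   is rewritten by the translations [y -> y - A x] and [x -> x + A^-1 y]. *)
Lemma leb3_integral_isometry (A A' : R3 R -> R3 R) (f : mR3 R -> \bar R) :
  (forall x y, A (x + y)%R = A x + A y)%R -> (forall x, A (A' x) = x) ->
  (forall x, norm3 (A x) = norm3 x) ->
  measurable_fun [set: mR3 R] (A : mR3 R -> mR3 R) ->
  measurable_fun [set: mR3 R] f -> (forall x, 0 <= f x) ->
  \int[leb3]_x f (A x) = \int[leb3]_x f x.
Proof.
move=> AD AK An mA mf f0.
pose b (x : mR3 R) : \bar R := (\1_(pball3 : set (mR3 R)) x)%:E.
have mb : measurable_fun [set: mR3 R] b.
  by apply/measurable_EFinP; apply: measurable_indic; exact: measurable_pball3.
have b0 x : 0 <= b x by rewrite lee_fin.
have bE : \int[leb3]_x b x = leb3 (pball3 : set (mR3 R)).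
  by rewrite integral_indic ?setIT//; exact: measurable_pball3.
have mfA : measurable_fun [set: mR3 R] (fun x => f (A x)) by mfun.
have A_0 : A 0%R = 0%R by apply: (@addIr _ (A 0%R)); rewrite -AD !add0r.
have AN x : A (- x)%R = (- A x)%R.
  by apply: (@addIr _ (A x)); rewrite -AD !addNr.
have bA x : b (- A x)%R = b x.
  rewrite /b !indicE; congr ((nat_of_bool _)%:R%:E).
  by apply/idP/idP; rewrite !inE /pball3/= norm3N An.
suff : leb3 (pball3 : set (mR3 R)) * \int[leb3]_x f (A x) =
       leb3 (pball3 : set (mR3 R)) * \int[leb3]_x f x.
  have : leb3 (pball3 : set (mR3 R)) \is a fin_num.
    by rewrite ge0_fin_numE// leb3_pball3_lty.
  move=> /fineK <- /(congr1 (fun t => ((fine (leb3 (pball3 : set (mR3 R))))^-1%:E * t))).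
  have : fine (leb3 (pball3 : set (mR3 R))) != 0%R.
    by rewrite gt_eqF// fine_gt0// leb3_pball3_gt0 leb3_pball3_lty.
  by move=> h; rewrite !muleA -!EFinM mulVf// !mul1e.
transitivity (\int[leb3]_x \int[leb3]_y (f (A x) * b ((y : R3 R) - A x)%R)).
  rewrite -ge0_integralZl ?measure_ge0//.
  apply: eq_integral => x _.
  rewrite ge0_integralZl//; last first.
    by mfun.
  by rewrite muleC -bE; congr (_ * _); rewrite leb3_integral_translate.
rewrite (ge0_integral_swap leb3s leb3s
  (g := fun x y => f (A x) * b ((y : R3 R) - A x)%R)); last 2 first.
- by mfun.
- by move=> x y; rewrite mule_ge0.
transitivity (\int[leb3]_y \int[leb3]_x (f ((y : R3 R) + A x)%R * b x)).
  apply: eq_integral => y _.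
  rewrite -[LHS](leb3_integral_translate (A' y)).
  - apply: eq_integral => x _.
    have -> : ((y : R3 R) - A ((x : R3 R) + A' y))%R = (- A x)%R.
      by rewrite AD AK opprD addrCA subrr addr0.
    by rewrite bA AD AK [in RHS]addrC.
  - by mfun.
  - by move=> x; rewrite mule_ge0.
rewrite -(ge0_integral_swap leb3s leb3s
  (g := fun x y => f ((y : R3 R) + A x)%R * b x)); last 2 first.
- by mfun.
- by move=> x y; rewrite mule_ge0.
transitivity (\int[leb3]_x (b x * \int[leb3]_y f y)).
  apply: eq_integral => x _.
  rewrite ge0_integralZr//; last first.
    by mfun.
  by rewrite muleC leb3_integral_translate.
by rewrite ge0_integralZr ?bE//; exact: integral_ge0.
Qed.

End lebesgue23.

(** * Surface measure *)

Section euclidean3.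
Context {R : realType}.
Implicit Types (x y z : R3 R) (a b : R).

Lemma R3addE a b c a' b' c' :
  ((a, b, c) : R3 R) + (a', b', c') = (a + a', b + b', c + c').
Proof. by []. Qed.

Lemma R3scaleE k a b c : k *: ((a, b, c) : R3 R) = (k * a, k * b, k * c).
Proof. by []. Qed.

Lemma dot3C x y : dot3 x y = dot3 y x.
Proof. by rewrite /dot3; ring. Qed.

Lemma dot3Dl x y z : dot3 (x + y) z = dot3 x z + dot3 y z.
Proof. by rewrite /dot3 /=; ring. Qed.

Lemma dot3Zl a x y : dot3 (a *: x) y = a * dot3 x y.
Proof.
rewrite /dot3; case: x => [[x1 x2] x3]; case: y => [[y1 y2] y3] /=.
by rewrite /GRing.scale/=; ring.
Qed.

Lemma dot3Nl x y : dot3 (- x) y = - dot3 x y.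
Proof. by rewrite -scaleN1r dot3Zl mulN1r. Qed.

Lemma dot3Dr x y z : dot3 x (y + z) = dot3 x y + dot3 x z.
Proof. by rewrite dot3C dot3Dl !(dot3C x). Qed.

Lemma dot3Zr a x y : dot3 x (a *: y) = a * dot3 x y.
Proof. by rewrite dot3C dot3Zl dot3C. Qed.

Lemma dot3Nr x y : dot3 x (- y) = - dot3 x y.
Proof. by rewrite dot3C dot3Nl dot3C. Qed.

Definition dot3E := (dot3Dl, dot3Dr, dot3Nl, dot3Nr, dot3Zl, dot3Zr).

Lemma sqr_norm3 x : norm3 x ^+ 2 = dot3 x x.
Proof. by rewrite sqr_sqrtr// dot3_ge0. Qed.

Lemma norm3Z a x : norm3 (a *: x) = `|a| * norm3 x.
Proof.
by rewrite /norm3 dot3Zl dot3Zr mulrA -expr2 sqrtrM ?sqr_ge0// sqrtr_sqr.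
Qed.

Lemma normalize3_sphere x : 0 < norm3 x -> sphere2 (normalize3 x).
Proof.
move=> x0; rewrite /sphere2/= norm3Z ger0_norm ?invr_ge0 ?norm3_ge0//.
by rewrite mulVf// gt_eqF.
Qed.

Lemma normalize3N x : normalize3 (- x) = - normalize3 x.
Proof. by rewrite /normalize3 norm3N scalerN. Qed.

(* For the matrix M with rows e.1, e.2, omega: M M^T = 1 implies M^T M = 1. *)
Lemma frame_expand omega e x : sphere2 omega -> plane_frame omega e ->
  dot3 x e.1 *: e.1 + dot3 x e.2 *: e.2 + dot3 x omega *: omega = x.
Proof.
move=> /sphere2P w1 [e11 e22 e12 p1 p2].
pose v (i : 'I_3) : R3 R := if i == 0 then e.1 else if i == 1 then e.2 else omega.
pose c (k : 'I_3) (y : R3 R) : R := if k == 0 then y.1.1 else if k == 1 then y.1.2 else y.2.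
pose M : 'M[R]_3 := \matrix_(i, k) c k (v i).
have MMT : M *m M^T = 1%:M.
  apply/matrixP => i j; rewrite !mxE.
  have -> : \sum_k M i k * M^T k j = dot3 (v i) (v j).
    by rewrite !big_ord_recl big_ord0 !mxE /c /dot3/= addr0 addrA.
  move: p1 p2; rewrite /perp/= => p1 p2.
  case: i => [[|[|[|//]]] ?]; case: j => [[|[|[|//]]] ?]; rewrite /v/= //.
  - by rewrite dot3C.
  - by rewrite dot3C.
  - by rewrite dot3C.
have MTM : M^T *m M = 1%:M by exact: mulmx1C.
have E k l : \sum_i c k (v i) * c l (v i) = (k == l)%:R.
  move/matrixP : MTM => /(_ k l); rewrite !mxE => <-.
  by apply: eq_bigr => i _; rewrite !mxE.
move: (E 0 0) (E 0 1) (E 0 2) (E 1 1) (E 1 2) (E 2 2).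
rewrite !big_ord_recl !big_ord0 /v /c/= !addr0.
case: e {e11 e22 e12 p1 p2 v M MMT MTM E} => -[[a1 a2] a3] [[b1 b2] b3] /=.
case: omega {w1} => [[w1 w2] w3] /=; case: x => [[x1 x2] x3].
move=> E00 E01 E02 E11 E12 E22.
rewrite !R3scaleE !R3addE /dot3/=.
congr (_, _, _).
- transitivity (x1 * (a1 * a1 + (b1 * b1 + w1 * w1)) +
    x2 * (a1 * a2 + (b1 * b2 + w1 * w2)) + x3 * (a1 * a3 + (b1 * b3 + w1 * w3))).
    by ring.
  by rewrite E00 E01 E02; ring.
- transitivity (x1 * (a1 * a2 + (b1 * b2 + w1 * w2)) +
    x2 * (a2 * a2 + (b2 * b2 + w2 * w2)) + x3 * (a2 * a3 + (b2 * b3 + w2 * w3))).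
    by ring.
  by rewrite E11 E01 E12; ring.
- transitivity (x1 * (a1 * a3 + (b1 * b3 + w1 * w3)) +
    x2 * (a2 * a3 + (b2 * b3 + w2 * w3)) + x3 * (a3 * a3 + (b3 * b3 + w3 * w3))).
    by ring.
  by rewrite E22 E02 E12; ring.
Qed.

End euclidean3.

Section surface.
Context {R : realType}.
Local Notation lam := (@lebesgue_measure R).
Local Notation mR := (measurableTypeR R).
Local Open Scope ereal_scope.

Lemma ge0_integral_mrestr d (T : measurableType d)
    (mu : {measure set T -> \bar R}) (D : set T) (mD : measurable D)
    (f : T -> \bar R) : measurable_fun [set: T] f -> (forall x, 0 <= f x) ->
  \int[mrestr mu mD]_x f x = \int[mu]_(x in D) f x.
Proof.
move=> mf f0; have mDC : measurable (~` D) by exact: measurableC.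
have mfD : measurable_fun (D `|` ~` D) f by rewrite setUv.
rewrite -(setUv D) ge0_integral_setU//; last exact/disj_setPCl.
rewrite [X in _ + X](_ : _ = 0) ?adde0.
  by apply: eq_measure_integral => A mA AD; rewrite /= /mrestr setIidl.
rewrite (eq_measure_integral mzero) ?integral_measure_zero//.
by move=> A mA AD; rewrite /= /mrestr (disjoints_subset A D).2 ?measure0//.
Qed.

(** Common shape of [surface_measure] (factor 3, radial projection, punctured ball) and of
    [plane_measure] (factor 1, plane embedding, whole plane). *)
Lemma ge0_integral_scaled_pushforward d d' (T : measurableType d)
    (T' : measurableType d') (mu : {measure set T' -> \bar R})
    (nu : {measure set T -> \bar R}) (phi : T -> T') (k : {nonneg R})
    (D : set T) (f : T' -> \bar R) :
  measurable_fun [set: T] phi -> measurable D ->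
  (forall A, measurable A -> mu A = k%:num%:E * nu (phi @^-1` A `&` D)) ->
  measurable_fun [set: T'] f -> (forall x, 0 <= f x) ->
  \int[mu]_x f x = k%:num%:E * \int[nu]_x ((\1_D x)%:E * f (phi x)).
Proof.
move=> mphi mD muE mf f0.
pose p := measure_function_pushforward__canonical__measure_function_Measure
  (mrestr nu mD) mphi.
rewrite (@eq_measure_integral _ _ _ _ (mscale k p)); last first.
  by move=> A mA _; rewrite muE.
rewrite ge0_integral_mscale//; congr (_ * _).
have mfp : measurable_fun [set: T] (f \o phi) by exact: measurableT_comp.
rewrite ge0_integral_pushforward// preimage_setT ge0_integral_mrestr//=.
rewrite integral_mkcond; apply: eq_integral => x _.
by rewrite patchE indicE /preimage; case: ifPn => _; rewrite ?mul1e ?mul0e.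
Qed.

Lemma surface_integral (f : mR3 R -> \bar R) :
  measurable_fun [set: mR3 R] f -> (forall x, 0 <= f x) ->
  \int[surface_measure]_x f x =
  3%:E * \int[leb3]_x ((\1_(pball3 : set (mR3 R)) x)%:E * f (normalize3 x)).
Proof.
move=> mf f0.
have h A : measurable A -> (@surface_measure R) A =
    ((3%:nng)%R : {nonneg R})%:num%:E * leb3 ((@normalize3 R) @^-1` A `&` (pball3 : set (mR3 R))).
  by [].
exact: (ge0_integral_scaled_pushforward 
  measurable_normalize3 measurable_pball3 h mf f0).
Qed.

Lemma surface_measure_lty : surface_measure [set: mR3 R] < +oo.
Proof.
rewrite /= /surface_measure lte_mul_pinfty//.
have -> : [set x : R3 R | [set: mR3 R] (normalize3 x)] `&` pball3 = pball3.
  by apply/seteqP; split => x // -[].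
exact: leb3_pball3_lty.
Qed.

Lemma surface_measureC_sphere : surface_measure (~` (sphere2 : set (mR3 R))) = 0.
Proof.
rewrite /= /surface_measure (_ : _ `&` _ = set0) ?measure0 ?mule0//.
apply/seteqP; split => // x [/= nx /andP[x0 _]]; apply: nx.
exact: normalize3_sphere.
Qed.

Lemma measurable_sphere2 : measurable (sphere2 : set (mR3 R)).
Proof.
rewrite (_ : sphere2 = [set: mR3 R] `&` (@norm3 R : mR3 R -> R) @^-1` [set 1%R]).
  exact: measurable_norm3.
by rewrite setTI.
Qed.

End surface.

(** * Substitution *)

Section substitution.
Context {R : realType}.
Local Notation lam := (@lebesgue_measure R).
Local Notation mR := (measurableTypeR R).
Local Open Scope ereal_scope.

(** Half-open intervals are stable under intersection, generate the sigma-algebra, and exhaust the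
    line by the intervals from -k to k, on which both measures are finite. *)
Lemma lebesgue_restr_unique (J : set mR) (m : {measure set mR -> \bar R}) :
  measurable J ->
  (forall a b : R, (a < b)%R -> m `]a, b]%classic = lam (`]a, b]%classic `&` J)) ->
  forall A, measurable A -> m A = lam (A `&` J).
Proof.
move=> mJ mE A mA.
have mE' B : ocitv B -> m B = mrestr lam mJ B.
  case=> -[a b] _ <- /=; have [ab|ba] := ltP a b; first exact: mE.
  by rewrite set_itv_ge ?bnd_simp -?leNgt// /mrestr set0I !measure0.
apply: (@measure_unique _ R mR (@ocitv R)
  (fun k => `](- k%:R)%R, k%:R]%classic) _ _ _ _ m (mrestr lam mJ)) => //.
- exact: ocitvI.
- by move=> k; exists (- k%:R, k%:R)%R.
- apply/seteqP; split => // x _.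
  have [k xk] : exists k : nat, (`|x| < k%:R)%R.
    by exists (Num.truncn `|x|).+1; rewrite real_truncnS_gt.
  exists k => //=; rewrite in_itv/=; move: xk; rewrite ltr_norml => /andP[-> /ltW].
  by move->.
- move=> k; rewrite mE'; last first.
    by exists (- k%:R, k%:R)%R.
  apply: (@le_lt_trans _ _ (lam `](- k%:R)%R, k%:R]%classic)).
    by apply: le_measure; rewrite ?inE//; exact: measurableI.
  by rewrite lebesgue_measure_itv/=; case: ifP => _; rewrite ?ltry// -EFinB ltry.
Qed.

(* The measure with density [delta] is realised as Lebesgue measure on the
   region of the plane under the graph of [delta]. *)
Lemma ge0_integral_substitution (phi delta : mR -> R) (J : set mR)
    (h : mR -> \bar R) :
  measurable_fun [set: mR] (phi : mR -> mR) ->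
  measurable_fun [set: mR] delta -> (forall t, 0 <= delta t)%R ->
  measurable J ->
  (forall a b : R, (a < b)%R ->
    \int[lam]_t ((delta t)%:E * (\1_(`]a, b]%classic : set mR) (phi t))%:E) =
    lam (`]a, b]%classic `&` J)) ->
  measurable_fun [set: mR] h -> (forall s, 0 <= h s) ->
  \int[lam]_t ((delta t)%:E * h (phi t)) = \int[lam]_(s in J) h s.
Proof.
move=> mphi mdelta delta0 mJ H mh h0.
pose D : set (mR2 R) := [set z | (0 < z.2 <= delta z.1)%R].
have mD : measurable D.
  rewrite (_ : D = [set: mR2 R] `&`
      (fun z => (0 < z.2)%R && (z.2 <= delta z.1)%R) @^-1` [set true]).
    apply: measurable_and => //.
      by apply: measurable_fun_ltr; mfun.
    by apply: measurable_fun_ler; mfun.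
  by rewrite setTI; apply/seteqP; split.
have mphi1 : measurable_fun [set: mR2 R] (fun z => phi z.1 : mR) by mfun.
pose m := measure_function_pushforward__canonical__measure_function_Measure
  (mrestr (@leb2 R) mD) mphi1.
have mint g : measurable_fun [set: mR] g -> (forall s, 0 <= g s) ->
    \int[m]_s g s = \int[lam]_t ((delta t)%:E * g (phi t)).
  move=> mg g0.
  have mgp : measurable_fun [set: mR2 R] (fun z => g (phi z.1)) by mfun.
  rewrite ge0_integral_pushforward// preimage_setT ge0_integral_mrestr//=.
  transitivity (\int[leb2]_z ((\1_D z)%:E * g (phi z.1))).
    rewrite integral_mkcond; apply: eq_integral => x _.
    by rewrite patchE indicE; case: ifPn => _; rewrite ?mul1e ?mul0e.
  have m1D : measurable_fun [set: mR2 R] (fun z => (\1_D z)%:E : \bar R).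
    by apply/measurable_EFinP; exact: measurable_indic.
  rewrite leb2_tonelli; last 2 first.
  - by mfun.
  - by move=> z; rewrite mule_ge0// lee_fin.
  apply: eq_integral => t _ /=.
  have m1Dt : measurable_fun [set: mR] (fun y : mR => (\1_D (t, y))%:E : \bar R).
    by apply: (measurableT_comp m1D (g := fun y : mR => (t, y))); mfun.
  rewrite (ge0_integralZr lam measurableT m1Dt) //.
  congr (_ * _).
  transitivity (\int[lam]_y (\1_(`]0%R, delta t]%classic : set mR) y)%:E).
    apply: eq_integral => y _; rewrite !indicE.
    have -> // : ((t, y) \in D) = (y \in (`]0%R, delta t]%classic : set mR)).
    by apply/idP/idP => /set_mem yD; apply/mem_set; move: yD; rewrite /D/= ?in_itv/=.
  rewrite integral_indic ?setIT//.
  transitivity (lam [set` `]0%R, delta t]]); first by [].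
  rewrite lebesgue_measure_itv/= lte_fin oppr0 adde0.
  by case: ltP => // d0; congr EFin; apply/eqP; rewrite eq_le delta0 d0.
rewrite -mint//.
have mE A : measurable A -> m A = lam (A `&` J).
  apply: lebesgue_restr_unique => // a b ab.
  have mi : measurable (`]a, b]%classic : set mR) by exact: measurable_itv.
  rewrite -H// -[X in m X]setIT -integral_indic// mint//.
    by apply/measurable_EFinP; exact: measurable_indic.
transitivity (\int[mrestr lam mJ]_s h s); last by rewrite ge0_integral_mrestr.
by apply: eq_measure_integral => A mA _; rewrite mE.
Qed.

End substitution.

Section substitution_instances.
Context {R : realType}.
Local Notation lam := (@lebesgue_measure R).
Local Notation mR := (measurableTypeR R).
Local Open Scope ereal_scope.

Lemma integral_oc_derive (F f : R -> R) (x y : R) : (x < y)%R ->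
  (forall t, (x <= t <= y)%R -> is_derive t 1%R F (f t)) ->
  (forall t, (x <= t <= y)%R -> {for t, continuous f}) ->
  \int[lam]_(t in `]x, y]) (f t)%:E = (F y - F x)%:E.
Proof.
move=> xy dF cf.
have cF t : (x <= t <= y)%R -> {for t, continuous F}.
  move=> /dF Ft; apply/differentiable_continuous/derivable1_diffP.
  exact: ex_derive.
have cW : {within `[x, y], continuous f}.
  by apply: continuous_in_subspaceT => t; rewrite inE/= in_itv/= => /cf.
rewrite integral_itv_obnd_cbnd; last first.
  apply/measurable_EFinP.
  apply: (measurable_funS (E := `[x, y]%classic)) => //.
    exact: subset_itv_oc_cc.
  exact: subspace_continuous_measurable_fun.
rewrite EFinB; apply: continuous_FTC2 => //.
- split.
  + move=> t; rewrite in_itv/= => /andP[xt ty].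
    by have := dF t; rewrite !ltW// => /(_ isT) [].
  + by apply: cvg_at_right_filter; apply: cF; rewrite lexx ltW.
  + by apply: cvg_at_left_filter; apply: cF; rewrite lexx ltW.
- move=> t; rewrite in_itv/= => /andP[xt ty].
  by rewrite derive1E; have := dF t; rewrite !ltW// => /(_ isT) [].
Qed.

(** Supplies the interval hypothesis of [ge0_integral_substitution] for a map that increases on the
    positive half-line, with its derivative as density. *)
Lemma integral_density_itv (F f : R -> R) (a b u v : R) :
  (0 <= u <= v)%R ->
  (forall t, (0 < t)%R -> (a < F t <= b)%R = (u < t <= v)%R) ->
  (forall t, (u <= t <= v)%R -> is_derive t 1%R F (f t)) ->
  (forall t, (u <= t <= v)%R -> {for t, continuous f}) ->
  \int[lam]_t (((0 < t)%R%:R * f t)%:E * (\1_(`]a, b]%classic : set mR) (F t))%:E) =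
  (F v - F u)%:E.
Proof.
move=> /andP[u0 uv] Fuv dF cf.
transitivity (\int[lam]_(t in `]u, v]) (f t)%:E).
  rewrite [RHS]integral_mkcond; apply: eq_integral => t _.
  rewrite patchE mem_setE in_itv/= indicE.
  have -> : (F t \in (`]a, b]%classic : set mR)) = (a < F t <= b)%R.
    by apply/idP/idP; rewrite inE/= in_itv.
  have [t0|t0] := ltP 0%R t; last first.
    rewrite mul0r mul0e; case: ifPn => // /andP[ut _].
    by have := lt_le_trans ut (le_trans t0 u0); rewrite ltxx.
  by rewrite Fuv// mul1r; case: ifPn => _; rewrite ?mule1 ?mule0.
move: uv; rewrite le_eqVlt => /predU1P[<-|uv]; last exact: integral_oc_derive.
by rewrite set_itvoc0 integral_set0 subrr.
Qed.

(** The inverse map is c = s + sqrt (s ^ 2 + beta). For a point of height s whose squared distance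
    to the axis is beta, c is height plus norm: the number by which stereographic projection divides
    the horizontal part. *)
Lemma integral_hyperbola (beta : R) (h : mR -> \bar R) : (0 < beta)%R ->
  measurable_fun [set: mR] h -> (forall s, 0 <= h s) ->
  \int[lam]_c (((0 < c)%R%:R * ((1 + beta / c ^+ 2) / 2))%:E *
     h ((c - beta / c) / 2)%R) = \int[lam]_s h s.
Proof.
move=> b0 mh h0.
pose F (c : R) : R := ((c - beta / c) / 2)%R.
pose f (c : R) : R := ((1 + beta / c ^+ 2) / 2)%R.
pose psi (s : R) : R := (s + Num.sqrt (s ^+ 2 + beta))%R.
have sq s : (Num.sqrt (s ^+ 2 + beta) ^+ 2 = s ^+ 2 + beta)%R.
  by rewrite sqr_sqrtr// addr_ge0 ?sqr_ge0 ?ltW.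
have sq0 s : (0 < Num.sqrt (s ^+ 2 + beta))%R.
  by rewrite sqrtr_gt0 ltr_wpDl ?sqr_ge0.
have psi0 s : (0 < psi s)%R.
  by rewrite /psi; have := sq s; have := sq0 s; nra.
have Fpsi s : F (psi s) = s.
  rewrite /F; have p0 : psi s != 0%R by rewrite gt_eqF.
  have -> : beta = (psi s ^+ 2 - 2 * s * psi s)%R.
    by rewrite /psi sqrrD sq; ring.
  by field.
have Fmono x y : (0 < x)%R -> (0 < y)%R -> (F x < F y)%R = (x < y)%R.
  move=> x0 y0.
  have -> : (F x < F y)%R = (0 < (y - x) * ((1 + beta / (x * y)) / 2))%R.
    rewrite -subr_gt0; congr (0 < _)%R; rewrite /F; field.
    by rewrite !gt_eqF.
  rewrite pmulr_lgt0 ?subr_gt0//.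
  by rewrite divr_gt0// addr_gt0// divr_gt0// mulr_gt0.
rewrite -[RHS](ge0_integral_substitution (J := setT)
  (phi := F) (delta := fun c => ((0 < c)%R%:R * f c)%R))//.
- by rewrite /F; mfun.
- by rewrite /f; mfun.
- move=> t; have [t0|] := ltP 0%R t; last by rewrite mul0r.
  by rewrite mul1r /f divr_ge0// addr_ge0// divr_ge0 ?sqr_ge0// ltW.
- move=> a b ab.
  transitivity ((F (psi b) - F (psi a))%:E); last first.
    rewrite !Fpsi setIT; transitivity (lam [set` `]a, b]]); last by [].
    by rewrite lebesgue_measure_itv/= lte_fin ab EFinB.
  apply: integral_density_itv.
  + by rewrite ltW//= leNgt -Fmono// !Fpsi -leNgt ltW.
  + move=> t t0; rewrite -[in LHS](Fpsi a) -[in LHS](Fpsi b) Fmono//.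
    by rewrite !leNgt Fmono.
  + move=> t /andP[at_ tb]; have t0 : (0 < t)%R by exact: lt_le_trans at_.
    have tn0 : t != 0%R by rewrite gt_eqF.
    have dV : is_derive t 1%R (fun c : R => c^-1%R) (- t ^- 2 *: 1)%R.
      by apply: (@is_deriveV R id t 1%R 1%R tn0).
    have d1 : is_derive t 1%R (fun c : R => beta * c^-1)%R (beta *: (- t ^- 2 *: 1))%R.
      exact: is_deriveZ.
    have d2 : is_derive t 1%R (fun c : R => c - beta * c^-1)%R (1 - beta *: (- t ^- 2 *: 1))%R.
      exact: (is_deriveB (is_derive_id t 1%R) d1).
    have d3 : is_derive t 1%R F (2^-1 *: (1 - beta *: (- t ^- 2 *: 1)))%R.
      have -> : F = (2^-1 \*: (fun c : R => c - beta * c^-1))%R.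
        by apply/funext => c; rewrite /F/= mulrC.
      exact: is_deriveZ.
    apply: is_derive_eq.
    rewrite /f /GRing.scale/=. by field.
  + move=> t /andP[at_ tb]; have t0 : (0 < t)%R by exact: lt_le_trans at_.
    rewrite /f; apply: cvgM; last exact: cvg_cst.
    apply: cvgD; first exact: cvg_cst.
    apply: cvgM; first exact: cvg_cst.
    by apply: cvgV; [rewrite expf_neq0// gt_eqF|exact: exprn_continuous].
Qed.

(** Over a fixed point of the plane at squared distance beta from the origin, this trades the height
    t for the distance to the origin, which starts at sqrt beta. *)
Lemma integral_radius (beta : R) (h : mR -> \bar R) : (0 < beta)%R ->
  measurable_fun [set: mR] h -> (forall s, 0 <= h s) ->
  \int[lam]_t (((0 < t)%R%:R * (t / Num.sqrt (beta + t ^+ 2)))%:E *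
     h (Num.sqrt (beta + t ^+ 2))) =
  \int[lam]_(s in `]Num.sqrt beta, +oo[) h s.
Proof.
move=> b0 mh h0.
pose l := Num.sqrt beta.
pose F (t : R) : R := Num.sqrt (beta + t ^+ 2).
pose f (t : R) : R := (t / Num.sqrt (beta + t ^+ 2))%R.
pose psi (s : R) : R := Num.sqrt (s ^+ 2 - beta).
have l0 : (0 < l)%R by rewrite sqrtr_gt0.
have l2 : (l ^+ 2 = beta)%R by rewrite sqr_sqrtr// ltW.
have bt t : (0 < beta + t ^+ 2)%R by rewrite ltr_pwDl ?sqr_ge0.
have Fpsi s : (l <= s)%R -> F (psi s) = s.
  move=> ls; rewrite /F /psi sqr_sqrtr.
    by rewrite addrC subrK sqrtr_sqr ger0_norm// (le_trans _ ls)// ltW.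
  by rewrite subr_ge0 -l2 ler_pXn2r// nnegrE ?(ltW l0)// (le_trans _ ls)// ltW.
have Fmono x y : (0 <= x)%R -> (0 <= y)%R -> (F x < F y)%R = (x < y)%R.
  move=> x0 y0; rewrite /F ltr_sqrt// ltrD2l.
  by rewrite ltr_pXn2r// ?nnegrE.
have Fl t : (0 < t)%R -> (l < F t)%R.
  by move=> t0; rewrite /l /F ltr_sqrt// ltrDl exprn_gt0.
rewrite -[RHS](ge0_integral_substitution
  (phi := F) (delta := fun c => ((0 < c)%R%:R * f c)%R))//.
- by rewrite /F; mfun.
- by rewrite /f; mfun.
- move=> t; have [t0|] := ltP 0%R t; last by rewrite mul0r.
  by rewrite mul1r /f divr_ge0// ?sqrtr_ge0// ltW.
- move=> a b ab.
  (* On the positive half-line [F] takes values above [l] only, so the interval is clipped there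
     before its endpoints are pulled back by [psi]. *)
  pose a' := Num.max a l; pose b' := Num.max b l.
  have la' : (l <= a')%R by rewrite le_max lexx orbT.
  have lb' : (l <= b')%R by rewrite le_max lexx orbT.
  have ab' : (a' <= b')%R by rewrite ge_max !le_max lexx (ltW ab) !orbT.
  have psi0 s : (0 <= psi s)%R by exact: sqrtr_ge0.
  transitivity ((F (psi b') - F (psi a'))%:E); last first.
    rewrite !Fpsi//.
    have -> : (`]a, b]%classic : set mR) `&` `]l, +oo[%classic =
        [set` `]a', b']].
      apply/seteqP; split => s /=; rewrite !in_itv/= ?andbT.
        by move=> -[/andP[as_ sb] ls]; rewrite gt_max as_ ls le_max sb.
      rewrite gt_max le_max => /andP[/andP[as_ ls]] /orP[sb|sl].
        by rewrite as_ ls.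
      by move: (lt_le_trans ls sl); rewrite ltxx.
    rewrite lebesgue_measure_itv/= lte_fin EFinB.
    by move: ab'; rewrite le_eqVlt => /predU1P[->|->//]; rewrite ltxx -EFinB subrr.
  apply: integral_density_itv.
  + by rewrite psi0/= leNgt -Fmono// !Fpsi// -leNgt.
  + move=> t t0.
    have -> : (a < F t <= b)%R = (a' < F t <= b')%R.
      have /negbTE Ftl : ~~ (F t <= l)%R by rewrite -ltNge Fl.
      by rewrite gt_max Fl// andbT le_max Ftl orbF.
    rewrite -[in LHS](Fpsi a')// -[in LHS](Fpsi b')//.
    by rewrite !leNgt !Fmono// ltW.
  + move=> t _; rewrite /F.
    have d1 : is_derive t 1%R (fun t : R => beta + t ^+ 2)%R (2 * t)%R.
      apply: is_derive_eq; rewrite /GRing.scale/=; ring.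
    have d2 := @is_derive1_comp R Num.sqrt (fun t : R => beta + t ^+ 2)%R t _ _
      (is_derive1_sqrt (bt t)) d1.
    apply: is_derive_eq.
    have : (Num.sqrt (beta + t ^+ 2) != 0)%R by rewrite gt_eqF// sqrtr_gt0.
    by rewrite /f /GRing.scale/= => s0; field.
  + move=> t _; rewrite /f.
    apply: cvgM; first exact: cvg_id.
    apply: cvgV; first by rewrite gt_eqF// sqrtr_gt0.
    apply: continuous_comp; last exact: sqrt_continuous.
    by apply: cvgD; [exact: cvg_cst|exact: exprn_continuous].
Qed.

End substitution_instances.

(** * Charts of the sphere *)

Section frame_coordinates.
Context {R : realType}.
Local Notation lam := (@lebesgue_measure R).
Local Notation mR := (measurableTypeR R).

Definition sqn (p : R * R) : R := p.1 ^+ 2 + p.2 ^+ 2.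

Lemma sqn_ge0 p : 0 <= sqn p. Proof. by rewrite addr_ge0 ?sqr_ge0. Qed.

Lemma sqn_gt0 p : p != (0, 0) -> 0 < sqn p.
Proof.
move=> p0; rewrite lt_neqAle sqn_ge0 andbT eq_sym.
rewrite /sqn paddr_eq0 ?sqr_ge0// !sqrf_eq0; apply: contra p0 => /andP[/eqP a /eqP b].
by move: a b; case: p => x y /= -> ->.
Qed.

Lemma plane_mapD omega (p q : R * R) :
  plane_map omega (p + q) = plane_map omega p + plane_map omega q.
Proof. by rewrite /plane_map !scalerDl addrACA. Qed.

Lemma plane_mapZ omega (c : R) (p : R * R) :
  plane_map omega (c * p.1, c * p.2) = c *: plane_map omega p.
Proof. by rewrite /plane_map scalerDr !scalerA. Qed.

(** For unit [omega], the linear isometry that turns the third axis into [omega]: computations below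
    take place with [omega] as vertical direction. *)
Definition frame_map (omega : R3 R) (z : R3 R) : R3 R :=
  plane_map omega z.1 + z.2 *: omega.

Section sphere_point.
Variable omega : R3 R.
Hypothesis omega1 : sphere2 omega.

Lemma dot3_plane_map p q :
  dot3 (plane_map omega p) (plane_map omega q) = p.1 * q.1 + p.2 * q.2.
Proof.
have [e1 e2 e12 _ _] := frame3P omega1.
rewrite /plane_map !dot3E e1 e2 e12 (dot3C (frame3 omega).2) e12; ring.
Qed.

Lemma plane_map_perp p : dot3 (plane_map omega p) omega = 0.
Proof.
have [_ _ _ p1 p2] := frame3P omega1.
by rewrite /plane_map !dot3E p1 p2 !mulr0 addr0.
Qed.

Lemma dot3_frame_map z : dot3 (frame_map omega z) omega = z.2.
Proof.
by rewrite /frame_map dot3Dl dot3Zl plane_map_perp (sphere2P _).1// add0r mulr1.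
Qed.

Lemma dot3_frame_plane z q :
  dot3 (frame_map omega z) (plane_map omega q) = z.1.1 * q.1 + z.1.2 * q.2.
Proof.
rewrite /frame_map dot3Dl dot3Zl dot3_plane_map (dot3C omega) plane_map_perp.
by rewrite mulr0 addr0.
Qed.

Lemma norm3_frame_map z : norm3 (frame_map omega z) = Num.sqrt (sqn z.1 + z.2 ^+ 2).
Proof.
rewrite /norm3 {2}/frame_map dot3Dr dot3Zr dot3_frame_map dot3_frame_plane.
by congr Num.sqrt; rewrite /sqn; ring.
Qed.

Lemma frame_mapD y z : frame_map omega (y + z) = frame_map omega y + frame_map omega z.
Proof. by rewrite /frame_map/= plane_mapD scalerDl addrACA. Qed.

Definition frame_coord (x : R3 R) : R3 R :=
  (dot3 x (frame3 omega).1, dot3 x (frame3 omega).2, dot3 x omega).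

Lemma frame_mapK x : frame_map omega (frame_coord x) = x.
Proof. exact: (frame_expand x omega1 (frame3P omega1)). Qed.

Lemma measurable_frame_map :
  measurable_fun [set: mR3 R] (frame_map omega : mR3 R -> mR3 R).
Proof. have mp := measurable_plane_map omega; rewrite /frame_map; mfun. Qed.

Lemma leb3_frame (f : mR3 R -> \bar R) :
  measurable_fun [set: mR3 R] f -> (forall x, 0 <= f x)%E ->
  (\int[leb3]_x f x = \int[leb2]_p \int[lam]_t f (frame_map omega (p, t)))%E.
Proof.
move=> mf f0; have mF := measurable_frame_map.
rewrite -(leb3_integral_isometry frame_mapD frame_mapK) //; last first.
  move=> x; rewrite norm3_frame_map /norm3 /dot3 /sqn.
  by congr Num.sqrt; ring.
rewrite leb3_tonelli//; mfun.
Qed.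

End sphere_point.

Lemma measurable_sqn : measurable_fun [set: mR2 R] (sqn : mR2 R -> mR).
Proof. by rewrite /sqn; mfun. Qed.

Lemma leb2_point : leb2 [set ((0, 0) : mR2 R)] = 0%E.
Proof.
have -> : [set ((0, 0) : mR2 R)] = ([set (0 : mR)] `*` [set (0 : mR)]).
  by apply/seteqP; split => [_ -> //|[x y] [/= -> ->]].
transitivity (lam [set 0%R] * lam [set 0%R])%E.
  apply: (@product_measure1E _ _ _ _ R lam lam); exact: measurable_set1.
by rewrite lebesgue_measure_set1 mule0.
Qed.

(** The two substitutions need beta > 0, that is, a point off the axis; the axis meets the plane in
    one point, which is null. *)
Lemma ge0_ae_eq_integral_leb2 (f g : mR2 R -> \bar R) :
  measurable_fun [set: mR2 R] f -> measurable_fun [set: mR2 R] g ->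
  (forall x, 0 <= f x)%E -> (forall x, 0 <= g x)%E ->
  (forall p, p != (0, 0) -> f p = g p) ->
  (\int[leb2]_p f p = \int[leb2]_p g p)%E.
Proof.
move=> mf mg f0 g0 fg; apply: ge0_ae_eq_integral => //.
exists [set ((0, 0) : mR2 R)]; split.
- have -> : [set ((0, 0) : mR2 R)] = ([set (0 : mR)] `*` [set (0 : mR)]).
    by apply/seteqP; split => [_ -> //|[x y] [/= -> ->]].
  by apply: measurableX; exact: measurable_set1.
- exact: leb2_point.
- move=> p /= /not_implyP[_ fgp]; apply/eqP.
  by apply: contra_notT fgp; exact: fg.
Qed.

(** The radial integral over a cone: c ^ 2 comes from a dilation of the slice, [m] is the norm of
    the point of the ray with parameter 1, and the 1/3 cancels the 3 in [surface_measure]. *)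
Lemma integral_sqr_truncated (m : R) : 0 < m ->
  (\int[lam]_c ((0 < c)%R%:R * c ^+ 2 * (c * m <= 1)%R%:R)%:E = (m ^- 3 / 3)%:E)%E.
Proof.
move=> m0.
transitivity (\int[lam]_(c in `]0%R, m^-1%R]) (c ^+ 2)%:E)%E.
  rewrite [RHS]integral_mkcond; apply: eq_integral => c _.
  rewrite patchE mem_setE in_itv/= -[in RHS](mul1r m^-1) ler_pdivlMr//.
  by case: (0 < c); rewrite ?mul0r// mul1r; case: (c * m <= 1); rewrite ?mulr1 ?mulr0.
transitivity ((m^-1 ^+ 3 / 3 - 0 ^+ 3 / 3)%:E); last first.
  by rewrite expr0n/= mul0r subr0 exprVn.
apply: (@integral_oc_derive _ (fun c : R => c ^+ 3 / 3)).
- by rewrite invr_gt0.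
- move=> t _.
  have -> : (fun c : R => c ^+ 3 / 3) = (3^-1 \*: (fun c : R => c ^+ 3)).
    by apply/funext => c /=; rewrite mulrC.
  apply: is_derive_eq; rewrite /GRing.scale/=; by field.
- by move=> t _; exact: exprn_continuous.
Qed.

End frame_coordinates.

(** * Hemispheres and cones *)

Section sphere_changes.
Context {R : realType}.
Local Notation lam := (@lebesgue_measure R).
Local Notation mR := (measurableTypeR R).
Local Open Scope ereal_scope.

Lemma surface_integralN (f : mR3 R -> \bar R) :
  measurable_fun [set: mR3 R] f -> (forall x, 0 <= f x) ->
  \int[surface_measure]_x f (- (x : R3 R))%R = \int[surface_measure]_x f x.
Proof.
move=> mf f0.
have mN : measurable_fun [set: mR3 R] (fun x : mR3 R => (- (x : R3 R))%R : mR3 R).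
  by mfun.
have mfN : measurable_fun [set: mR3 R] (fun x : mR3 R => f (- (x : R3 R))%R).
  by mfun.
have mb : measurable_fun [set: mR3 R]
    (fun x : mR3 R => (\1_(pball3 : set (mR3 R)) x)%:E : \bar R).
  by apply/measurable_EFinP; apply: measurable_indic; exact: measurable_pball3.
rewrite [LHS](surface_integral mfN (fun=> f0 _)) [RHS](surface_integral mf f0).
congr (_ * _).
rewrite -[RHS](leb3_integral_isometry (A := -%R) (A' := -%R)).
- apply: eq_integral => x _; rewrite normalize3N !indicE; congr (_%:R%:E * _).
  by congr nat_of_bool; apply/idP/idP; rewrite !inE /pball3/= norm3N.
- by move=> x y; rewrite opprD.
- exact: opprK.
- exact: norm3N.
- exact: mN.
- by mfun.
- by move=> x; rewrite mule_ge0// lee_fin.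
Qed.

(** An even integrand folds onto a hemisphere. Its vanishing on the equator, provided in both uses
    by a factor |x . xi|, takes the place of the equator being null. *)
Lemma surface_half (xi : R3 R) (g : mR3 R -> \bar R) :
  measurable_fun [set: mR3 R] g -> (forall x, 0 <= g x) ->
  (forall x : R3 R, g (- x)%R = g x) ->
  (forall x : R3 R, dot3 x xi = 0%R -> g x = 0) ->
  \int[surface_measure]_x g x =
  2%:E * \int[surface_measure]_x ((0 < dot3 x xi)%R%:R%:E * g x).
Proof.
move=> mg g0 gN gx0.
pose gp (x : mR3 R) := (0 < dot3 x xi)%R%:R%:E * g x.
have mgp : measurable_fun [set: mR3 R] gp by rewrite /gp; mfun.
have gp0 x : 0 <= gp x by rewrite mule_ge0// lee_fin.
have mgpN : measurable_fun [set: mR3 R] (fun x : mR3 R => gp (- (x : R3 R))%R).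
  by mfun.
transitivity (\int[surface_measure]_x (gp x + gp (- (x : R3 R))%R)).
  apply: eq_integral => x _; rewrite /gp gN dot3Nl oppr_gt0.
  have [xi0|xi0|xi0] := ltgtP 0%R (dot3 x xi).
  - by rewrite mul1e mul0e adde0.
  - by rewrite mul1e mul0e add0e.
  - by rewrite gx0// !mule0 adde0.
rewrite ge0_integralD//=.
rewrite (surface_integralN mgp gp0) -/gp.
rewrite -[in LHS](mul1e (\int[_]_x _)) -ge0_muleDl ?lee_fin//.
Qed.

End sphere_changes.

Section cone_scaling.
Context {R : realType}.
Local Notation lam := (@lebesgue_measure R).
Local Notation mR := (measurableTypeR R).
Local Open Scope ereal_scope.

Lemma normalize3_scale (k : R) (s : R3 R) : (0 < k)%R -> sphere2 s ->
  normalize3 (k *: s)%R = s.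
Proof.
move=> k0 s1; rewrite /normalize3 norm3Z s1 mulr1 gtr0_norm// scalerA mulVf ?scale1r//.
by rewrite gt_eqF.
Qed.

Lemma pball3_scale (k : R) (s : R3 R) : (0 < k)%R -> sphere2 s ->
  \1_(pball3 : set (mR3 R)) (k *: s)%R = ((k <= 1)%R%:R : R).
Proof.
move=> k0 s1; rewrite indicE.
suff -> : ((k *: s)%R \in (pball3 : set (mR3 R))) = (k <= 1)%R by [].
apply/idP/idP; rewrite inE /pball3/= norm3Z s1 mulr1 gtr0_norm// ?k0//.
Qed.

(* Dilation by [c] in the horizontal slice at height [c]. *)
Lemma cone_scaling (D E : mR2 R -> mR -> \bar R) :
  measurable_fun [set: mR2 R * mR] (fun z => D z.1 z.2) ->
  measurable_fun [set: mR2 R * mR] (fun z => E z.1 z.2) ->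
  (forall p c, 0 <= D p c) -> (forall p c, 0 <= E p c) ->
  (forall p c, (c <= 0)%R -> D p c = 0) ->
  (forall p c, (c <= 0)%R -> E p c = 0) ->
  (forall p c, (0 < c)%R ->
    (c ^+ 2)%:E * D (c * p.1, c * p.2)%R c = E p c) ->
  \int[leb2]_p \int[lam]_c D p c = \int[leb2]_p \int[lam]_c E p c.
Proof.
move=> mD mE D0 E0 Dn En DE.
rewrite [LHS](ge0_integral_swap leb2s lam mD D0).
rewrite [RHS](ge0_integral_swap leb2s lam mE E0).
apply: eq_integral => c _.
have mDc : measurable_fun [set: mR2 R] (D^~ c).
  by apply: (measurableT_comp mD (g := fun p : mR2 R => (p, c))); mfun.
have [c0|c0] := leP c 0%R.
  by apply: eq_integral => p _; rewrite Dn// En.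
rewrite [LHS](leb2_integral_scale c0 mDc (fun=> D0 _ _)).
rewrite -ge0_integralZl_EFin ?sqr_ge0//.
  by apply: eq_integral => p _; exact: DE.
by apply: (measurableT_comp mDc (g := fun x : mR2 R => (c * x.1, c * x.2)%R)); mfun.
Qed.

End cone_scaling.

(** * The reflection as a change of variables *)

Section reflection.
Context {R : realType}.
Local Notation lam := (@lebesgue_measure R).
Local Notation mR := (measurableTypeR R).
Variable xi : R3 R.
Hypothesis xi1 : sphere2 xi.
Variable Phi : mR3 R -> \bar R.
Hypothesis mPhi : measurable_fun [set: mR3 R] Phi.
Hypothesis Phi0 : forall x, (0 <= Phi x)%E.

Let N (u : R * R) : R := 1 + sqn u.

Let N0 u : 0 < N u. Proof. by rewrite ltr_pwDl ?sqn_ge0. Qed.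

Let mN : measurable_fun [set: mR2 R] (N : mR2 R -> mR).
Proof. by have ms := @measurable_sqn R; rewrite /N; mfun. Qed.

(** Inverse of the stereographic projection from - xi onto the plane orthogonal to xi; the origin
    goes to xi. *)
Definition stereo (u : R * R) : R3 R :=
  (N u)^-1 *: frame_map xi ((2 * u.1, 2 * u.2), 1 - sqn u).

(** Inverse of the central projection of the open hemisphere around xi onto its tangent plane at
    xi. *)
Definition gnomonic (u : R * R) : R3 R :=
  (Num.sqrt (N u))^-1 *: frame_map xi (u, 1).

Let sqrtN0 u : 0 < Num.sqrt (N u). Proof. by rewrite sqrtr_gt0. Qed.

Let stereo1 u : sphere2 (stereo u).
Proof.
rewrite /sphere2/= norm3Z (norm3_frame_map xi1)/=.
have -> : sqn (2 * u.1, 2 * u.2) + (1 - sqn u) ^+ 2 = N u ^+ 2.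
  by rewrite /N /sqn/=; ring.
by rewrite sqrtr_sqr !gtr0_norm ?invr_gt0// mulVf// gt_eqF.
Qed.

Let gnomonic1 u : sphere2 (gnomonic u).
Proof.
rewrite /sphere2/= norm3Z (norm3_frame_map xi1)/= expr1n addrC -/(N u).
by rewrite gtr0_norm ?invr_gt0// mulVf// gt_eqF.
Qed.

Let gnomonic_xi u : dot3 (gnomonic u) xi = (Num.sqrt (N u))^-1.
Proof. by rewrite dot3Zl (dot3_frame_map xi1)/= mulr1. Qed.

(** Reflecting xi through a point doubles its angle to xi, while the length of [u] is the tangent of
    the angle in the gnomonic chart and of half the angle in the stereographic one. *)
Let reflect_gnomonic u : reflect3 (gnomonic u) xi = stereo u.
Proof.
have f1 : frame_map xi (u, 1) = plane_map xi u + xi.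
  by rewrite /frame_map/= scale1r.
have f2 : frame_map xi ((2 * u.1, 2 * u.2), 1 - sqn u) =
    2 *: plane_map xi u + (1 - sqn u) *: xi.
  by rewrite /frame_map/= plane_mapZ.
rewrite /reflect3 gnomonic_xi /gnomonic /stereo f1 f2 scalerA.
have -> : 2 * (Num.sqrt (N u))^-1 * (Num.sqrt (N u))^-1 = 2 * (N u)^-1.
  by rewrite -mulrA -invfM -expr2 sqr_sqrtr// ltW.
move: (plane_map xi u) => P.
rewrite !scalerDr !scalerA -addrA; congr (_ + _).
  by rewrite mulrC.
rewrite -[X in _ - X]scale1r -scalerBl; congr (_ *: _).
by rewrite /N; field; rewrite gt_eqF// N0.
Qed.

Let mstereo : measurable_fun [set: mR2 R] (stereo : mR2 R -> mR3 R).
Proof.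
have mF := measurable_frame_map xi; have ms := @measurable_sqn R.
rewrite /stereo; mfun.
Qed.

Local Open Scope ereal_scope.

(** After p = c u the point at parameter c is c (N / 2) times [stereo u]. The hyperbolic density is
    then N / 2, and 3 * (N / 2) * (N / 2)^-3 / 3 is the classical density 4 / N ^ 2. *)
Lemma surface_stereo : \int[surface_measure]_x Phi x =
  \int[leb2]_u ((4 / N u ^+ 2)%:E * Phi (stereo u)).
Proof.
have mF := measurable_frame_map xi; have ms := @measurable_sqn R.
have mb : measurable_fun [set: mR3 R]
    (fun x : mR3 R => (\1_(pball3 : set (mR3 R)) x)%:E : \bar R).
  by apply/measurable_EFinP; apply: measurable_indic; exact: measurable_pball3.
pose H0 (x : mR3 R) := (\1_(pball3 : set (mR3 R)) x)%:E * Phi (normalize3 x).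
have mH0 : measurable_fun [set: mR3 R] H0 by rewrite /H0; mfun.
have H00 x : 0 <= H0 x by rewrite mule_ge0// lee_fin.
pose H (p : mR2 R) (t : mR) := H0 (frame_map xi (p, t)).
have mH : measurable_fun [set: mR2 R * mR] (fun z => H z.1 z.2).
  by rewrite /H; mfun.
have HH0 p t : 0 <= H p t by exact: H00.
(* [D] is the integrand after the hyperbolic substitution with beta = |p| ^ 2, and [E] the one after
   the dilation p = c u. *)
pose D (p : mR2 R) (c : mR) := ((0 < c)%R%:R * ((1 + sqn p / c ^+ 2) / 2))%:E *
   H p ((c - sqn p / c) / 2)%R.
have mD : measurable_fun [set: mR2 R * mR] (fun z => D z.1 z.2).
  rewrite /D; apply: emeasurable_funM; first by mfun.
  apply: (measurableT_comp mH
    (g := fun z : mR2 R * mR => (z.1, (z.2 - sqn z.1 / z.2) / 2)%R)).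
  by mfun.
have D0 p c : 0 <= D p c.
  by rewrite mule_ge0// lee_fin mulr_ge0// divr_ge0// addr_ge0// divr_ge0 ?sqn_ge0 ?sqr_ge0.
pose E (u : mR2 R) (c : mR) :=
  ((N u / 2) * ((0 < c)%R%:R * c ^+ 2 * (c * (N u / 2) <= 1)%R%:R))%:E * Phi (stereo u).
have mE : measurable_fun [set: mR2 R * mR] (fun z => E z.1 z.2).
  by rewrite /E; mfun.
have E0 p c : 0 <= E p c.
  rewrite mule_ge0// lee_fin; apply: mulr_ge0; last by rewrite mulr_ge0// mulr_ge0// sqr_ge0.
  by rewrite divr_ge0// ltW.
rewrite (surface_integral mPhi Phi0) (leb3_frame xi1 mH0 H00).
transitivity (3%:E * \int[leb2]_p \int[lam]_c D p c).
  congr (_ * _); apply: ge0_ae_eq_integral_leb2.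
  - exact: (measurable_integral_fst lam mH).
  - exact: (measurable_integral_fst lam mD).
  - by move=> p; exact: integral_ge0.
  - by move=> p; exact: integral_ge0.
  - move=> p p0; rewrite -(integral_hyperbola (sqn_gt0 p0))//.
    by apply: (measurableT_comp mH (g := fun t : mR => (p, t))); mfun.
rewrite (cone_scaling mD mE D0 E0); last 3 first.
- by move=> p c c0; rewrite /D ltNge c0 mul0r mul0e.
- by move=> p c c0; rewrite /E ltNge c0 !mul0r mulr0 mul0e.
- move=> u c c0.
  have -> : D (c * u.1, c * u.2)%R c =
      (N u / 2)%:E * ((c * (N u / 2) <= 1)%R%:R%:E * Phi (stereo u)).
    have k0 : (0 < c * (N u / 2))%R by rewrite mulr_gt0// divr_gt0.
    rewrite /D c0 mul1r /H /H0.
    have -> : frame_map xi ((c * u.1, c * u.2), (c - sqn (c * u.1, c * u.2) / c) / 2)%R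
      = (c * (N u / 2)) *: stereo u.
      have fE (k z : R) : frame_map xi ((k * u.1, k * u.2), z)%R =
          (k *: plane_map xi u + z *: xi)%R by rewrite /frame_map/= plane_mapZ.
      rewrite /stereo !fE; move: (plane_map xi u) => P.
      rewrite scalerA scalerDr !scalerA.
      congr (_ *: _ + _ *: _)%R.
        by field; rewrite gt_eqF.
      by rewrite /sqn/=; field; rewrite !gt_eqF.
    rewrite (pball3_scale k0 (stereo1 u)) (normalize3_scale k0 (stereo1 u)).
    congr (_%:E * _); rewrite /N /sqn/=; field.
    by rewrite gt_eqF.
  by rewrite /E c0 mul1r !muleA -!EFinM; congr (_%:E * _); ring.
rewrite -ge0_integralZl_EFin//; last first.
- exact: (measurable_integral_fst lam mE).
- by move=> p _; exact: integral_ge0.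
apply: eq_integral => u _.
have mc : measurable_fun [set: mR]
    (fun c : mR => ((0 < c)%R%:R * c ^+ 2 * (c * (N u / 2) <= 1)%R%:R)%:E : \bar R).
  by mfun.
have w0 (c : mR) :
    0 <= ((0 < c)%R%:R * c ^+ 2 * (c * (N u / 2) <= 1)%R%:R)%:E :> \bar R.
  by rewrite lee_fin mulr_ge0// mulr_ge0// sqr_ge0.
have k0 : 0 <= (N u / 2)%:E * Phi (stereo u).
  by rewrite mule_ge0// lee_fin divr_ge0// ltW.
transitivity (3%:E * (((N u / 2) ^- 3 / 3)%:E * ((N u / 2)%:E * Phi (stereo u)))).
  rewrite -integral_sqr_truncated ?divr_gt0//.
  rewrite -(ge0_integralZr lam measurableT mc (fun c _ => w0 c) k0).
  congr (_ * _); apply: eq_integral => c _.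
  by rewrite /E [(N u / 2 * _)%R]mulrC EFinM muleA.
rewrite !muleA -!EFinM; congr (_%:E * _).
by field; rewrite gt_eqF.
Qed.

(** The weight |omega . xi| is N^-1/2 and the gnomonic chart has density N^-3/2, so together they
    give N^-2. Of the factor 4, one 2 is in the statement and the other comes from folding onto the
    hemisphere around xi. *)
Lemma surface_gnomonic :
  2%:E * \int[surface_measure]_x (`|dot3 x xi|%:E * Phi (reflect3 x xi)) =
  \int[leb2]_u ((4 / N u ^+ 2)%:E * Phi (stereo u)).
Proof.
have mF := measurable_frame_map xi; have ms := @measurable_sqn R.
have mb : measurable_fun [set: mR3 R]
    (fun x : mR3 R => (\1_(pball3 : set (mR3 R)) x)%:E : \bar R).
  by apply/measurable_EFinP; apply: measurable_indic; exact: measurable_pball3.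
pose g (x : mR3 R) := `|dot3 x xi|%:E * Phi (reflect3 x xi).
have mg : measurable_fun [set: mR3 R] g by rewrite /g /reflect3; mfun.
have g0 x : 0 <= g x by rewrite mule_ge0// lee_fin.
have gN (x : R3 R) : g (- x)%R = g x.
  rewrite /g dot3Nl normrN; congr (_ * Phi _).
  by rewrite /reflect3 dot3Nl mulrN scaleNr scalerN opprK.
have gx0 (x : R3 R) : dot3 x xi = 0%R -> g x = 0.
  by move=> x0; rewrite /g x0 normr0 mul0e.
pose gp (x : mR3 R) := (0 < dot3 x xi)%R%:R%:E * g x.
have mgp : measurable_fun [set: mR3 R] gp by rewrite /gp; mfun.
have gp0 x : 0 <= gp x by rewrite mule_ge0// lee_fin.
pose H0 (x : mR3 R) := (\1_(pball3 : set (mR3 R)) x)%:E * gp (normalize3 x).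
have mH0 : measurable_fun [set: mR3 R] H0 by rewrite /H0; mfun.
have H00 x : 0 <= H0 x by rewrite mule_ge0// lee_fin.
pose D (p : mR2 R) (t : mR) := H0 (frame_map xi (p, t)).
have mD : measurable_fun [set: mR2 R * mR] (fun z => D z.1 z.2).
  by rewrite /D; mfun.
have D0 p t : 0 <= D p t by exact: H00.
pose E (u : mR2 R) (t : mR) :=
  ((Num.sqrt (N u))^-1 * ((0 < t)%R%:R * t ^+ 2 * (t * Num.sqrt (N u) <= 1)%R%:R))%:E
  * Phi (stereo u).
have mE : measurable_fun [set: mR2 R * mR] (fun z => E z.1 z.2).
  by rewrite /E; mfun.
have w0 u (c : mR) :
    0 <= ((0 < c)%R%:R * c ^+ 2 * (c * Num.sqrt (N u) <= 1)%R%:R)%:E :> \bar R.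
  by rewrite lee_fin mulr_ge0// mulr_ge0// sqr_ge0.
have E0 p c : 0 <= E p c.
  rewrite mule_ge0// EFinM mule_ge0// lee_fin invr_ge0; exact: sqrtr_ge0.
rewrite (surface_half mg g0 gN gx0) (surface_integral mgp gp0) (leb3_frame xi1 mH0 H00).
rewrite [X in 2%:E * (2%:E * (3%:E * X))](_ : _ = \int[leb2]_p \int[lam]_c D p c)//.
rewrite (cone_scaling mD mE D0 E0); last 3 first.
- move=> p c c0; rewrite /D /H0 /gp [X in _ * (X * _)](_ : _ = 0) ?mul0e ?mule0//.
  rewrite /normalize3 dot3Zl (dot3_frame_map xi1)/= ltNge mulr_ge0_le0//.
  by rewrite invr_ge0 norm3_ge0.
- by move=> p c c0; rewrite /E ltNge c0 !mul0r mulr0 mul0e.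
- move=> u t t0.
  have k0 : (0 < t * Num.sqrt (N u))%R by rewrite mulr_gt0.
  have fE : frame_map xi ((t * u.1, t * u.2), t)%R = (t * Num.sqrt (N u)) *: gnomonic u.
    rewrite /gnomonic scalerA -mulrA mulfV ?gt_eqF// mulr1.
    rewrite /frame_map/= plane_mapZ scale1r; move: (plane_map xi u) => P.
    by rewrite scalerDr.
  rewrite /D /H0 fE (pball3_scale k0 (gnomonic1 u)) (normalize3_scale k0 (gnomonic1 u)).
  rewrite /gp /g gnomonic_xi reflect_gnomonic invr_gt0 sqrtN0 mul1e gtr0_norm ?invr_gt0//.
  by rewrite /E t0 mul1r !muleA -!EFinM; congr (_%:E * _); ring.
rewrite !muleA -!EFinM -ge0_integralZl_EFin//; last first.
- exact: (measurable_integral_fst lam mE).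
- by move=> p _; exact: integral_ge0.
apply: eq_integral => u _.
have mc : measurable_fun [set: mR]
    (fun c : mR => ((0 < c)%R%:R * c ^+ 2 * (c * Num.sqrt (N u) <= 1)%R%:R)%:E : \bar R).
  by mfun.
have k0 : 0 <= (Num.sqrt (N u))^-1%:E * Phi (stereo u).
  by rewrite mule_ge0// lee_fin invr_ge0 sqrtr_ge0.
transitivity ((2 * 2 * 3)%:E * (((Num.sqrt (N u)) ^- 3 / 3)%:E *
    ((Num.sqrt (N u))^-1%:E * Phi (stereo u)))).
  rewrite -integral_sqr_truncated//.
  rewrite -(ge0_integralZr lam measurableT mc (fun c _ => w0 u c) k0).
  congr (_ * _); apply: eq_integral => c _.
  by rewrite /E [((Num.sqrt (N u))^-1 * _)%R]mulrC EFinM muleA.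
rewrite !muleA -!EFinM; congr (_%:E * _).
have -> : (N u ^+ 2 = (Num.sqrt (N u)) ^+ 4)%R.
  by rewrite (exprM _ 2 2) sqr_sqrtr// ltW.
by field; rewrite gt_eqF.
Qed.

(* The reflection [omega |-> R_omega xi] is two-to-one onto the sphere, with
   Jacobian [4 |omega . xi|]: in the gnomonic chart [u] of [omega] the point
   [R_omega xi] has stereographic coordinate [u]. *)
Lemma surface_reflection :
  \int[surface_measure]_x Phi x =
  2%:E * \int[surface_measure]_x (`|dot3 x xi|%:E * Phi (reflect3 x xi)).
Proof. by rewrite surface_stereo surface_gnomonic. Qed.

End reflection.

(** * Projection of chords to the orthogonal plane *)

Section projection.
Context {R : realType}.
Local Notation lam := (@lebesgue_measure R).
Local Notation mR := (measurableTypeR R).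
Variable omega : R3 R.
Hypothesis omega1 : sphere2 omega.
Variable F : mR3 R -> \bar R.
Hypothesis mF : measurable_fun [set: mR3 R] F.
Hypothesis F0 : forall x, (0 <= F x)%E.
Hypothesis FN : forall x : R3 R, F (- x) = F x.
Local Open Scope ereal_scope.

(* The chord [xi - R_omega xi] is twice the orthogonal projection of [xi] to
   the plane orthogonal to [omega]. *)
Lemma surface_projection :
  2%:E * \int[surface_measure]_x
    (`|dot3 omega x|%:E * F ((x : R3 R) - reflect3 omega x)%R) =
  \int[leb2]_p ((sqn p < 4)%R%:R%:E * F (plane_map omega p)).
Proof.
have mFr := measurable_frame_map omega; have ms := @measurable_sqn R.
have mpl := measurable_plane_map omega.
have mb : measurable_fun [set: mR3 R]
    (fun x : mR3 R => (\1_(pball3 : set (mR3 R)) x)%:E : \bar R).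
  by apply/measurable_EFinP; apply: measurable_indic; exact: measurable_pball3.
pose g (x : mR3 R) := `|dot3 omega x|%:E * F ((x : R3 R) - reflect3 omega x)%R.
have mg : measurable_fun [set: mR3 R] g by rewrite /g /reflect3; mfun.
have g0 x : 0 <= g x by rewrite mule_ge0// lee_fin.
have gN (x : R3 R) : g (- x)%R = g x.
  rewrite /g dot3Nr normrN -[in RHS]FN; congr (_ * F _).
  by rewrite /reflect3 dot3Nr mulrN scaleNr !opprD opprK.
have gx0 (x : R3 R) : dot3 x omega = 0%R -> g x = 0.
  by move=> x0; rewrite /g dot3C x0 normr0 mul0e.
pose gp (x : mR3 R) := (0 < dot3 x omega)%R%:R%:E * g x.
have mgp : measurable_fun [set: mR3 R] gp by rewrite /gp; mfun.
have gp0 x : 0 <= gp x by rewrite mule_ge0// lee_fin.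
pose H0 (x : mR3 R) := (\1_(pball3 : set (mR3 R)) x)%:E * gp (normalize3 x).
have mH0 : measurable_fun [set: mR3 R] H0 by rewrite /H0; mfun.
have H00 x : 0 <= H0 x by rewrite mule_ge0// lee_fin.
(* A point at distance r from the origin with plane component a gives, once normalized, the chord (2
   / r) a. The later dilation a = r u frees the chord from r, and only a radial integral remains. *)
pose h (a : mR2 R) (r : mR) := ((0 < r)%R%:R * (r <= 1)%R%:R)%:E *
  F ((2 / r) *: plane_map omega a)%R.
have mh : measurable_fun [set: mR2 R * mR] (fun z => h z.1 z.2).
  by rewrite /h; mfun.
have h0 a r : 0 <= h a r by rewrite mule_ge0// lee_fin mulr_ge0.
pose D (a : mR2 R) (r : mR) := (Num.sqrt (sqn a) < r)%R%:R%:E * h a r.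
have mD : measurable_fun [set: mR2 R * mR] (fun z => D z.1 z.2).
  by rewrite /D; mfun.
have D0 p t : 0 <= D p t by rewrite mule_ge0// lee_fin.
pose G (u : mR2 R) := (sqn u < 1)%R%:R%:E * F (plane_map omega (2 * u.1, 2 * u.2)%R).
have mG : measurable_fun [set: mR2 R] G by rewrite /G; mfun.
have G0 u : 0 <= G u by rewrite mule_ge0// lee_fin.
pose E (u : mR2 R) (r : mR) :=
  ((0 < r)%R%:R * r ^+ 2 * (r * 1 <= 1)%R%:R)%:E * G u.
have mE : measurable_fun [set: mR2 R * mR] (fun z => E z.1 z.2).
  by rewrite /E; mfun.
have w0 (c : mR) : 0 <= ((0 < c)%R%:R * c ^+ 2 * (c * 1 <= 1)%R%:R)%:E :> \bar R.
  by rewrite lee_fin mulr_ge0// mulr_ge0// sqr_ge0.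
have E0 p c : 0 <= E p c by rewrite mule_ge0.
rewrite (surface_half mg g0 gN gx0) (surface_integral mgp gp0) (leb3_frame omega1 mH0 H00).
transitivity (2%:E * (2%:E * (3%:E * \int[leb2]_p \int[lam]_c D p c))).
  congr (_ * (_ * (_ * _))).
  have mH : measurable_fun [set: mR2 R * mR] (fun z => H0 (frame_map omega (z.1, z.2))).
    by mfun.
  apply: ge0_ae_eq_integral_leb2.
  - exact: (measurable_integral_fst lam mH).
  - exact: (measurable_integral_fst lam mD).
  - by move=> p; exact: integral_ge0.
  - by move=> p; exact: integral_ge0.
  - move=> p p0; have b0 := sqn_gt0 p0.
    transitivity (\int[lam]_(r in `]Num.sqrt (sqn p), +oo[) h p r); last first.
      rewrite integral_mkcond; apply: eq_integral => r _.
      rewrite patchE mem_setE in_itv/= andbT /D.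
      by case: ifPn; rewrite ?mul1e ?mul0e.
    have mhp : measurable_fun [set: mR] (h p).
      by apply: (measurableT_comp mh (g := fun t : mR => (p, t))); mfun.
    (* The weight |omega . x| is t / r for the point at height t and distance r, which is exactly
       the derivative of r in t. *)
    rewrite -(integral_radius b0 mhp (h0 p)).
    apply: eq_integral => t _.
    have r0 : (0 < Num.sqrt (sqn p + t ^+ 2))%R.
      by rewrite sqrtr_gt0 ltr_pwDl ?sqr_ge0.
    have rE : norm3 (frame_map omega (p, t)) = Num.sqrt (sqn p + t ^+ 2).
      by rewrite (norm3_frame_map omega1).
    have tE : dot3 (normalize3 (frame_map omega (p, t))) omega =
        (t / Num.sqrt (sqn p + t ^+ 2))%R.
      by rewrite /normalize3 dot3Zl (dot3_frame_map omega1)/= rE mulrC.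
    rewrite /H0 /gp /g tE [dot3 omega _]dot3C tE.
    rewrite pmulr_lgt0 ?invr_gt0//.
    have [t0|t0] := ltP 0%R t; last by rewrite !mul0e mule0 mul0r mul0e.
    rewrite !mul1e mul1r gtr0_norm ?divr_gt0//.
    have -> : (normalize3 (frame_map omega (p, t)) -
        reflect3 omega (normalize3 (frame_map omega (p, t))))%R =
        ((2 / Num.sqrt (sqn p + t ^+ 2)) *: plane_map omega p)%R.
      rewrite /reflect3 [dot3 omega _]dot3C tE /normalize3 rE /frame_map/=.
      move: (plane_map omega p) => P.
      rewrite opprB addrA -mulr2n -scaler_nat scalerA scalerDr scalerA.
      rewrite -addrA -scalerBl [X in (_ + X *: _)%R](_ : _ = 0%R); last by ring.
      by rewrite scale0r addr0.
    rewrite /h r0 mul1r muleCA; congr (_ * (_ * _)).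
    rewrite indicE; congr (_%:R%:E); congr nat_of_bool.
    by apply/idP/idP; rewrite inE /pball3/= rE r0.
rewrite (cone_scaling mD mE D0 E0); last 3 first.
- by move=> p c c0; rewrite /D /h [(0 < c)%R]ltNge c0 mul0r mul0e mule0.
- by move=> p c c0; rewrite /E ltNge c0 !mul0r mul0e.
- move=> u c c0; rewrite /D /h /E /G c0 !mul1r mulr1.
  have -> : (Num.sqrt (sqn (c * u.1, c * u.2)) < c)%R = (sqn u < 1)%R.
    have -> : sqn (c * u.1, c * u.2)%R = (c ^+ 2 * sqn u)%R.
      by rewrite /sqn/=; ring.
    rewrite sqrtrM ?sqr_ge0// sqrtr_sqr gtr0_norm// -[ltRHS]mulr1 ltr_pM2l//.
    by rewrite -[in LHS]sqrtr1 ltr_sqrt.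
  have -> : ((2 / c) *: plane_map omega (c * u.1, c * u.2))%R =
      plane_map omega (2 * u.1, 2 * u.2)%R.
    by rewrite !plane_mapZ scalerA divfK// gt_eqF.
  by rewrite muleCA !muleA -!EFinM; congr (_%:E * _); ring.
rewrite !muleA -!EFinM -ge0_integralZl_EFin//; last first.
- exact: (measurable_integral_fst lam mE).
- by move=> p _; exact: integral_ge0.
rewrite [RHS](leb2_integral_scale (c := 2%R))//; last 2 first.
- by mfun.
- by move=> p; rewrite mule_ge0// lee_fin.
rewrite -ge0_integralZl_EFin//; last first.
- by mfun.
- by move=> p _; rewrite mule_ge0// lee_fin.
apply: eq_integral => u _.
have mc : measurable_fun [set: mR]
    (fun c : mR => ((0 < c)%R%:R * c ^+ 2 * (c * 1 <= 1)%R%:R)%:E : \bar R).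
  by mfun.
rewrite (ge0_integralZr lam measurableT mc (fun c _ => w0 c) (G0 u)).
rewrite integral_sqr_truncated// /G muleA -EFinM expr1n; congr (_ * (_%:R%:E * _)).
  by congr EFin; field.
congr nat_of_bool; have -> : sqn (2 * u.1, 2 * u.2)%R = (4 * sqn u)%R.
  by rewrite /sqn/=; ring.
by rewrite gtr_pMr.
Qed.

End projection.

(** * Fubini's theorem for real integrals *)

(** Both parts of [f] transfer, and with them the real integral, which is [fine] of their
    difference. *)
Lemma integral_comp_ge0 d d' (T : measurableType d) (T' : measurableType d')
    (R : realType) (mu : {measure set T -> \bar R})
    (nu : {measure set T' -> \bar R}) (phi : T -> T') :
  (forall g : T' -> \bar R, measurable_fun [set: T'] g ->
     (forall x, 0 <= g x)%E -> \int[mu]_x g (phi x) = \int[nu]_x g x)%E ->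
  forall f : T' -> R, measurable_fun [set: T'] f ->
    \int[mu]_x f (phi x) = \int[nu]_x f x.
Proof.
move=> H f mf; congr fine; rewrite [LHS]integralE [RHS]integralE.
have mfE : measurable_fun [set: T'] (EFin \o f) by exact/measurable_EFinP.
congr (_ - _)%E.
- transitivity (\int[mu]_x ((EFin \o f)^\+)%E (phi x))%E.
  by apply: eq_integral => x _; rewrite !funeposE.
  by apply: H => //; exact: measurable_funepos.
- transitivity (\int[mu]_x ((EFin \o f)^\-)%E (phi x))%E.
  by apply: eq_integral => x _; rewrite !funenegE.
  by apply: H => //; exact: measurable_funeneg.
Qed.

Lemma integral_le_ge0 d (T : measurableType d) (R : realType)
    (mu : {measure set T -> \bar R}) (h G : T -> \bar R) :
  measurable_fun [set: T] h -> measurable_fun [set: T] G ->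
  (forall x, 0 <= G x)%E -> (forall x, h x <= G x)%E ->
  (\int[mu]_x h x <= \int[mu]_x G x)%E.
Proof.
move=> mh mG G0 hG; rewrite integralE.
apply: (@le_trans _ _ (\int[mu]_x h^\+ x)%E).
  rewrite -[leRHS]sube0 leeB//.
  exact: integral_ge0.
apply: ge0_le_integral => //; first exact: measurable_funepos.
by move=> x _; rewrite funeposE ge_max hG G0.
Qed.

Section real_fubini.
Context d1 d2 (T1 : measurableType d1) (T2 : measurableType d2) (R : realType).
Variable m1 : {sigma_finite_measure set T1 -> \bar R}.
Variable m2 : {sigma_finite_measure set T2 -> \bar R}.

Lemma prodm_tonelli1 (h : T1 * T2 -> \bar R) :
  measurable_fun [set: T1 * T2] h -> (forall z, 0 <= h z)%E ->
  (\int[prodm m1 m2]_z h z = \int[m1]_x \int[m2]_y h (x, y))%E.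
Proof. by move=> mh h0; exact: (@fubini_tonelli1 _ _ _ _ R m1 m2 h mh h0). Qed.

Lemma prodm_tonelli2 (h : T1 * T2 -> \bar R) :
  measurable_fun [set: T1 * T2] h -> (forall z, 0 <= h z)%E ->
  (\int[prodm m1 m2]_z h z = \int[m2]_y \int[m1]_x h (x, y))%E.
Proof. by move=> mh h0; exact: (@fubini_tonelli2 _ _ _ _ R m1 m2 h mh h0). Qed.

Section fubini.
Variable h : T1 * T2 -> R.
Hypothesis ih : (prodm m1 m2).-integrable setT (EFin \o h).
Let mh : measurable_fun [set: T1 * T2] h.

Proof. by apply/measurable_EFinP; exact: (measurable_int _ ih). Qed.

Let mhs : measurable_fun [set: T2 * T1] (fun z => h (z.2, z.1)).
Proof.
apply: (measurableT_comp mh (g := fun z : T2 * T1 => (z.2, z.1))); mfun.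
Qed.

(** The real inner integral is [fine] of the extended one; the two agree where the slice is
    integrable, which is known almost everywhere. *)
Let fst_ae : ae_eq m1 setT (fun x => (\int[m2]_y h (x, y))%:E)
  (fun x => \int[m2]_y (h (x, y))%:E)%E.
Proof.
have := ae_integrable1 ih; apply: filterS => x ihx _.
by rewrite /= /Rintegral fineK//; exact: integrable_fin_num.
Qed.

Let snd_ae : ae_eq m2 setT (fun y => (\int[m1]_x h (x, y))%:E)
  (fun y => \int[m1]_x (h (x, y))%:E)%E.
Proof.
have := ae_integrable2 ih; apply: filterS => x ihx _.
by rewrite /= /Rintegral fineK//; exact: integrable_fin_num.
Qed.

Lemma integral_fubini1 :
  (\int[m1]_x (\int[m2]_y h (x, y))%:E = (\int[prodm m1 m2]_z h z)%:E)%E.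
Proof.
rewrite [in RHS]/Rintegral fineK; last exact: integrable_fin_num.
transitivity (\int[m1]_x \int[m2]_y (h (x, y))%:E)%E.
  apply: ae_eq_integral => //.
  - by apply/measurable_EFinP; exact: measurable_Rintegral_fst.
  - by apply: (measurable_integral_fst m2 (f := EFin \o h)); exact/measurable_EFinP.
exact: (integral12_prod_meas1 ih).
Qed.

Lemma integral_fubini2 :
  (\int[m2]_y (\int[m1]_x h (x, y))%:E = (\int[prodm m1 m2]_z h z)%:E)%E.
Proof.
rewrite [in RHS]/Rintegral fineK; last exact: integrable_fin_num.
transitivity (\int[m2]_y \int[m1]_x (h (x, y))%:E)%E.
  apply: ae_eq_integral => //.
  - by apply/measurable_EFinP; exact: (measurable_Rintegral_fst m1 mhs).
  - apply: (measurable_integral_fst m1 (f := fun z : T2 * T1 => (h (z.2, z.1))%:E)).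
    exact/measurable_EFinP.
exact: (integral21_prod_meas1 ih).
Qed.

Lemma Rintegral_fubini1 :
  \int[m1]_x (\int[m2]_y h (x, y)) = \int[prodm m1 m2]_z h z.
Proof. by rewrite [LHS]/Rintegral integral_fubini1. Qed.

Lemma Rintegral_fubini2 :
  \int[m2]_y (\int[m1]_x h (x, y)) = \int[prodm m1 m2]_z h z.
Proof. by rewrite [LHS]/Rintegral integral_fubini2. Qed.

End fubini.

Section product.
Variables (f : T1 -> R) (g : T2 -> R).
Hypothesis If : m1.-integrable setT (EFin \o f).
Hypothesis Ig : m2.-integrable setT (EFin \o g).

Lemma integrable_prod :
  (prodm m1 m2).-integrable setT (EFin \o (fun z => f z.1 * g z.2)).
Proof.
have mf : measurable_fun [set: T1] f.
  by apply/measurable_EFinP; exact: (measurable_int _ If).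
have mg : measurable_fun [set: T2] g.
  by apply/measurable_EFinP; exact: (measurable_int _ Ig).
have mh : measurable_fun [set: T1 * T2] (EFin \o (fun z => f z.1 * g z.2)).
  by apply/measurable_EFinP; mfun.
apply/(integrable12ltyP m1 m2 mh) => /=.
have [_ fy] := integrableP _ _ _ If; have [_ gy] := integrableP _ _ _ Ig.
rewrite (eq_integral (fun x => `|(f x)%:E| * \int[m2]_y `|(g y)%:E|)%E); last first.
  move=> x _; rewrite -ge0_integralZl//.
    by apply: eq_integral => y _; rewrite /= normrM EFinM.
  by apply: measurableT_comp => //; exact/measurable_EFinP.
rewrite ge0_integralZr//.
- apply: lte_mul_pinfty => //; first exact: integral_ge0.
  by rewrite ge0_fin_numE//; exact: integral_ge0.
- by apply: measurableT_comp => //; exact/measurable_EFinP.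
- exact: integral_ge0.
Qed.

Lemma Rintegral_prod :
  \int[prodm m1 m2]_z (f z.1 * g z.2) = (\int[m1]_x f x) * (\int[m2]_y g y).
Proof.
rewrite -Rintegral_fubini1 /=; last exact: integrable_prod.
rewrite -RintegralZr//; apply: eq_Rintegral => x _ /=.
by rewrite RintegralZl.
Qed.

End product.
End real_fubini.

(** * A Plancherel inequality in the plane *)

Section poisson_kernel.
Context {R : realType}.
Local Notation lam := (@lebesgue_measure R).
Local Notation mR := (measurableTypeR R).
Variable e : R.
Hypothesis e0 : 0 < e.

(** With the exponential of |s|, both the transform and the total mass of the transform (a Poisson
    kernel) come from explicit primitives. *)
Definition damping (s : R) : R := expR (- (e * `|s|)).

Let dampC c := e ^+ 2 + c ^+ 2.

Let dampC0 c : 0 < dampC c. Proof. by rewrite ltr_pwDl ?sqr_ge0// exprn_gt0. Qed.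

Let cvg_exp : expR (- (e * s)) @[s --> +oo] --> (0 : R).
Proof.
apply: (cvg_comp (fun s => e * s) (fun s => expR (- s))); last exact: cvgr_expR.
exact: gt0_cvgMry.
Qed.

(** The summand 1 keeps the integrand nonnegative, as the fundamental theorem on a half-line
    requires here. It is subtracted later by means of the case c = 0. *)
Let half (c : R) :
  (\int[lam]_(s in `[0%R, +oo[) (expR (- (e * s)) * (1 + cos (c * s)))%:E =
   (e^-1 + e / dampC c)%:E)%E.
Proof.
pose w (s : R) := - e^-1 + (c * sin (c * s) - e * cos (c * s)) / dampC c.
pose F (s : R) := expR (- (e * s)) * w s.
have dw (s : R) : is_derive s 1 w ((c ^+ 2 * cos (c * s) + e * c * sin (c * s)) / dampC c).
  have -> : w = (cst (- e^-1) + (dampC c)^-1 \*: (c \*: (fun s => sin (c * s)) - e \*: (fun s => cos (c * s)))).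
    by apply/funext => t; rewrite /w /= mulrC.
  apply: is_derive_eq; rewrite /GRing.scale/=; field.
  by rewrite gt_eqF.
have dF (s : R) : is_derive s 1 F (expR (- (e * s)) * (1 + cos (c * s))).
  have dE : is_derive s 1 (fun s => expR (- (e * s))) (- e * expR (- (e * s))).
    apply: is_derive_eq; rewrite /GRing.scale/=; ring.
  have dEw := is_deriveM dE (dw s).
  have -> : F = ((fun s => expR (- (e * s))) * w) by [].
  apply: is_derive_eq; rewrite /w /dampC /GRing.scale/=; field.
  by rewrite (gt_eqF e0) gt_eqF// dampC0.
have cF (s : R) : {for s, continuous F}.
  by apply/differentiable_continuous/derivable1_diffP; exact: ex_derive.
have wM (s : R) : `|w s| <= e^-1 + (`|c| + e) / dampC c.
  apply: le_trans (ler_normD _ _) _.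
  rewrite normrN ger0_norm ?invr_ge0 ?(ltW e0)// lerD2l.
  rewrite normrM [X in _ * X]ger0_norm ?invr_ge0 ?(ltW (dampC0 _))//.
  rewrite ler_pM2r ?invr_gt0//; apply: le_trans (ler_normB _ _) _.
  rewrite !normrM (ger0_norm (ltW e0)); apply: lerD.
    by rewrite ler_piMr// ler_norml sin_geN1 sin_le1.
  by rewrite ler_piMr ?(ltW e0)// ler_norml cos_geN1 cos_le1.
set M := e^-1 + _ in wM.
have Fy : F s @[s --> +oo] --> (0 : R).
  apply/cvgr0Pnorm_le => eps eps0.
  have eM : expR (- (e * s)) * M @[s --> +oo] --> (0 : R).
    by rewrite -(mul0r M); apply: cvgMl.
  move/cvgr0Pnorm_le : eM => /(_ _ eps0); apply: filterS => s.
  apply: le_trans; rewrite !normrM ler_wpM2l//.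
  by rewrite (le_trans (wM s))// ler_norm.
rewrite (@ge0_continuous_FTC2y _ (fun s => expR (- (e * s)) * (1 + cos (c * s))) F 0 0).
- rewrite /F /w !mulr0 oppr0 expR0 cos0 sin0 mul1r mulr0 sub0r mulr1 sub0e -EFinN.
  by congr EFin; field; rewrite (gt_eqF e0) gt_eqF// dampC0.
- by move=> s _; rewrite mulr_ge0 ?expR_ge0//; have := cos_geN1 (c * s); lra.
- apply: continuous_subspaceT => s.
  apply: cvgM.
    apply: continuous_comp; last exact: continuous_expR.
    by apply: cvgN; apply: cvgM; [exact: cvg_cst|exact: cvg_id].
  apply: cvgD; first exact: cvg_cst.
  apply: continuous_comp; last exact: continuous_cos.
  by apply: cvgM; [exact: cvg_cst|exact: cvg_id].
- exact: Fy.
- by move=> s _; have [] := dF s.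
- by apply: cvg_at_right_filter; exact: cF.
- by move=> s _; rewrite derive1E; have [] := dF s.
Qed.

Let damping_cos0 (c : R) :
  (\int[lam]_s (damping s * (1 + cos (c * s)))%:E =
   (2 * (e^-1 + e / dampC c))%:E)%E.
Proof.
rewrite ge0_symfun_integralT.
- rewrite EFinM -half -set_itvcy; congr (_ * _)%E.
  apply: eq_integral => s; rewrite inE/= in_itv/= andbT => s0.
  by rewrite /damping ger0_norm.
- by move=> s; rewrite mulr_ge0 ?expR_ge0//; have := cos_geN1 (c * s); lra.
- move=> s; apply: cvgM.
    apply: continuous_comp; last exact: continuous_expR.
    by apply: cvgN; apply: cvgM; [exact: cvg_cst|exact: norm_continuous].
  apply: cvgD; first exact: cvg_cst.
  apply: continuous_comp; last exact: continuous_cos.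
  by apply: cvgM; [exact: cvg_cst|exact: cvg_id].
- by move=> s; rewrite /damping /= normrN mulrN cosN.
Qed.

Lemma damping_ge0 s : 0 <= damping s. Proof. exact: expR_ge0. Qed.

Lemma measurable_damping : measurable_fun [set: mR] (damping : mR -> mR).
Proof. rewrite /damping; mfun. Qed.

Lemma integrable_damping_cos1 c :
  lam.-integrable [set: mR] (EFin \o (fun s => damping s * (1 + cos (c * s)))).
Proof.
have md := measurable_damping.
apply/integrableP; split; first by apply/measurable_EFinP; mfun.
under eq_integral => s _.
  rewrite /= ger0_norm; last first.
    by rewrite mulr_ge0 ?damping_ge0//; have := cos_geN1 (c * s); lra.
  over.
by rewrite damping_cos0 ltry.
Qed.

Lemma integral_damping : (\int[lam]_s (damping s)%:E = (2 / e)%:E)%E.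
Proof.
have := damping_cos0 0; rewrite /dampC expr0n/= addr0.
under eq_integral do rewrite mul0r cos0 mulrC EFinM.
rewrite ge0_integralZl//; last 2 first.
- by apply/measurable_EFinP; exact: measurable_damping.
- by move=> s _; rewrite lee_fin damping_ge0.
move=> /(congr1 (fun t => 2^-1%:E * t)%E).
rewrite muleA -!EFinM (_ : 2^-1 * (1 + 1) = 1) ?mul1e; last by field.
by move=> ->; congr EFin; field; rewrite gt_eqF.
Qed.

Lemma integrable_damping : lam.-integrable [set: mR] (EFin \o damping).
Proof.
apply/integrableP; split.
  by apply/measurable_EFinP; exact: measurable_damping.
under eq_integral do rewrite /= ger0_norm ?damping_ge0//.
by rewrite integral_damping ltry.
Qed.

Lemma integrable_dampingM (b : R -> R) :
  measurable_fun [set: mR] (b : mR -> mR) -> (forall s, `|b s| <= 1) ->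
  lam.-integrable [set: mR] (EFin \o (fun s => damping s * b s)).
Proof.
move=> mb b1; have md := measurable_damping.
apply: (le_integrable measurableT _ _ integrable_damping) => /=.
  by apply/measurable_EFinP; mfun.
by move=> s _; rewrite lee_fin normrM ler_piMr.
Qed.

Lemma Rintegral_damping_cos c :
  \int[lam]_s (damping s * cos (c * s)) = 2 * e / (e ^+ 2 + c ^+ 2).
Proof.
have E : (fun s => damping s * cos (c * s)) =
    (fun s => damping s * (1 + cos (c * s)) - damping s).
  by apply/funext => s; ring.
rewrite E RintegralB//; [|exact: integrable_damping_cos1|exact: integrable_damping].
rewrite /Rintegral damping_cos0 integral_damping /= /dampC; field.
by rewrite (gt_eqF e0) gt_eqF// dampC0.
Qed.

(** An odd integrand: the integral equals its own opposite. *)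
Lemma Rintegral_damping_sin c : \int[lam]_s (damping s * sin (c * s)) = 0.
Proof.
have md := measurable_damping.
pose h (s : mR) := damping s * sin (c * s).
have mh : measurable_fun [set: mR] h by rewrite /h; mfun.
have : \int[lam]_s h (- s) = \int[lam]_s h s.
  exact: (integral_comp_ge0 (@lebesgue_integral_opp R)).
have -> : (fun s => h (- s)) = (fun s => -1 * h s).
  by apply/funext => s; rewrite /h /damping normrN mulrN sinN mulrN mulN1r.
rewrite RintegralZl//; last first.
  apply: integrable_dampingM; first by mfun.
  by move=> s; rewrite ler_norml sin_geN1 sin_le1.
by rewrite -/h; lra.
Qed.

(** The primitive is an arctangent. That the mass is 1 whatever [e] is makes the damped Plancherel
    bound uniform. *)
Lemma integral_poisson :
  (\int[lam]_x (2 * e / (e ^+ 2 + (2 * pi * x) ^+ 2))%:E = 1)%E.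
Proof.
pose f (x : R) := 2 * e / (e ^+ 2 + (2 * pi * x) ^+ 2).
have D0 (x : R) : 0 < e ^+ 2 + (2 * pi * x) ^+ 2 by exact: dampC0.
have pi0 : (0 : R) < pi by exact: pi_gt0.
have cf : continuous f.
  move=> x; apply: cvgM; first exact: cvg_cst.
  apply: cvgV; first by rewrite gt_eqF.
  apply: cvgD; first exact: cvg_cst.
  apply: (cvg_comp (fun y => 2 * pi * y) (fun y => y ^+ 2)).
    by apply: cvgM; [exact: cvg_cst|exact: cvg_id].
  exact: exprn_continuous.
rewrite (@ge0_symfun_integralT _ f).
- rewrite -set_itvcy.
  rewrite (@ge0_continuous_FTC2y _ f (fun x => pi^-1 * atan (2 * pi / e * x)) 0 (pi^-1 * (pi / 2))).
  + rewrite mulr0 atan0 mulr0 sube0 -EFinM; congr EFin.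
    by rewrite [pi^-1 * _]mulrA mulVf ?gt_eqF// mul1r divff.
  + by move=> x _; rewrite /f divr_ge0// ?ltW// mulr_gt0.
  + exact: continuous_subspaceT.
  + apply: cvgMr; apply: (cvg_comp (fun x => 2 * pi / e * x) atan); last exact: cvgy_atan.
    by apply: gt0_cvgMry => //; rewrite divr_gt0// mulr_gt0.
  + move=> x _; exact: ex_derive.
  + apply: cvg_at_right_filter; apply: cvgM; first exact: cvg_cst.
    apply: continuous_comp; last exact: continuous_atan.
    by apply: cvgM; [exact: cvg_cst|exact: cvg_id].
  + move=> x _; rewrite derive1E; apply: derive_val; apply: is_derive_eq.
    rewrite /f /GRing.scale/=.
    move: pi0 (D0 x); move: (@pi R) => q q0 Dq.
    by field; rewrite (gt_eqF e0) (gt_eqF q0) gt_eqF.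
- by move=> x; rewrite divr_ge0// ?ltW// mulr_gt0.
- exact: cf.
- by move=> x; rewrite /f /= mulrN sqrrN.
Qed.

End poisson_kernel.

Section plancherel.
Context {R : realType}.
Local Notation lam := (@lebesgue_measure R).
Local Notation mR := (measurableTypeR R).
Variable f : mR2 R -> mR.
Hypothesis If : (@leb2s R).-integrable [set: mR2 R] (EFin \o f).

Let mf : measurable_fun [set: mR2 R] f.
Proof. by apply/measurable_EFinP; exact: (measurable_int _ If). Qed.

Definition phase2 (q p : R * R) : R := 2 * pi * (q.1 * p.1 + q.2 * p.2).

Definition cosine2 (p : R * R) : R := \int[leb2]_q (f q * cos (phase2 q p)).
Definition sine2 (p : R * R) : R := \int[leb2]_q (f q * sin (phase2 q p)).

Let mcosine2 : measurable_fun [set: mR2 R] (cosine2 : mR2 R -> mR).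
Proof.
apply: (@measurable_Rintegral_fst _ _ _ _ _ leb2s
  (fun z => f z.2 * cos (phase2 z.2 z.1))).
rewrite /phase2; mfun.
Qed.

Let msine2 : measurable_fun [set: mR2 R] (sine2 : mR2 R -> mR).
Proof.
apply: (@measurable_Rintegral_fst _ _ _ _ _ leb2s
  (fun z => f z.2 * sin (phase2 z.2 z.1))).
rewrite /phase2; mfun.
Qed.

Let bounded_integrable (b : mR2 R -> mR) :
  measurable_fun [set: mR2 R] b -> (forall q, `|b q| <= 1) ->
  (@leb2s R).-integrable [set: mR2 R] (EFin \o (fun q => f q * b q)).
Proof.
move=> mb b1; apply: (le_integrable measurableT _ _ If) => /=.
  by apply/measurable_EFinP; mfun.
by move=> s _; rewrite lee_fin normrM ler_piMr.
Qed.

Let LL := prodm (@leb2s R) (@leb2s R).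

Let cos1 (x : R) : `|cos x| <= 1.
Proof. by rewrite ler_norml cos_geN1 cos_le1. Qed.

Let sin1 (x : R) : `|sin x| <= 1.
Proof. by rewrite ler_norml sin_geN1 sin_le1. Qed.

Lemma sqr_cosine2_sine2 (p : R * R) : cosine2 p ^+ 2 + sine2 p ^+ 2 =
  \int[LL]_z (f z.1 * f z.2 * cos (phase2 (z.1 - z.2) p)).
Proof.
have Ic : (@leb2s R).-integrable [set: mR2 R] (EFin \o (fun q => f q * cos (phase2 q p))).
  by apply: bounded_integrable => //; rewrite /phase2; mfun.
have Is : (@leb2s R).-integrable [set: mR2 R] (EFin \o (fun q => f q * sin (phase2 q p))).
  by apply: bounded_integrable => //; rewrite /phase2; mfun.
rewrite !expr2 -(Rintegral_prod Ic Ic) -(Rintegral_prod Is Is).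
rewrite -RintegralD//; [|exact: (integrable_prod Ic Ic)|exact: (integrable_prod Is Is)].
apply: eq_Rintegral => -[a b] _ /=.
have -> : phase2 (a - b) p = phase2 a p - phase2 b p by rewrite /phase2/=; ring.
by rewrite cosB; ring.
Qed.

Section damped.
Variable e : R.
Hypothesis e0 : 0 < e.

Let P (x : R) : R := 2 * e / (e ^+ 2 + (2 * pi * x) ^+ 2).

Let P0 x : 0 <= P x.
Proof. by rewrite divr_ge0// ?addr_ge0 ?sqr_ge0// mulr_ge0// ltW. Qed.

Let mP : measurable_fun [set: mR] (P : mR -> mR).
Proof. by rewrite /P; mfun. Qed.

Let k2 (p : R * R) : R := damping e p.1 * damping e p.2.

Let mk := @measurable_damping R e.

Let mk2 : measurable_fun [set: mR2 R] (k2 : mR2 R -> mR).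
Proof. by rewrite /k2; mfun. Qed.

Let k20 p : 0 <= k2 p. Proof. by rewrite mulr_ge0 ?damping_ge0. Qed.

Let Ik2 : (@leb2s R).-integrable [set: mR2 R] (EFin \o k2).
Proof. exact: (integrable_prod (integrable_damping e0) (integrable_damping e0)). Qed.

Lemma Rintegral_damping2_cos (q : R * R) :
  \int[leb2]_p (k2 p * cos (phase2 q p)) = P q.1 * P q.2.
Proof.
have Ib (b : R -> R) (c : R) : measurable_fun [set: mR] (b : mR -> mR) ->
    (forall x, `|b x| <= 1) ->
    lam.-integrable [set: mR] (EFin \o (fun s => damping e s * b (c * s))).
  by move=> mb b1; apply: integrable_dampingM => //; mfun.
have mc : measurable_fun [set: mR] (@cos R : mR -> mR) by mfun.
have ms : measurable_fun [set: mR] (@sin R : mR -> mR) by mfun.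
have Icc := integrable_prod (Ib _ (2 * pi * q.1) mc cos1) (Ib _ (2 * pi * q.2) mc cos1).
have Iss := integrable_prod (Ib _ (2 * pi * q.1) ms sin1) (Ib _ (2 * pi * q.2) ms sin1).
transitivity (\int[prodm lam lam]_z
   (damping e z.1 * cos (2 * pi * q.1 * z.1) * (damping e z.2 * cos (2 * pi * q.2 * z.2))
  - damping e z.1 * sin (2 * pi * q.1 * z.1) * (damping e z.2 * sin (2 * pi * q.2 * z.2)))).
  apply: eq_Rintegral => -[x y] _ /=.
  have -> : phase2 q (x, y) = 2 * pi * q.1 * x + 2 * pi * q.2 * y.
    by rewrite /phase2/=; ring.
  by rewrite cosD /k2/=; ring.
rewrite RintegralB//.
rewrite (Rintegral_prod (Ib _ (2 * pi * q.1) mc cos1) (Ib _ (2 * pi * q.2) mc cos1)).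
rewrite (Rintegral_prod (Ib _ (2 * pi * q.1) ms sin1) (Ib _ (2 * pi * q.2) ms sin1)).
by rewrite !Rintegral_damping_cos// !Rintegral_damping_sin// mul0r subr0.
Qed.

Let Psi (p : mR2 R) (z : mR2 R * mR2 R) : R :=
  k2 p * (f z.1 * f z.2) * cos (phase2 (z.1 - z.2) p).

Let IPsi : (prodm (@leb2s R) LL).-integrable setT (EFin \o (fun y => Psi y.1 y.2)).
Proof.
have IkF := integrable_prod Ik2 (integrable_prod If If).
apply: (le_integrable measurableT _ _ IkF) => /=.
  by apply/measurable_EFinP; rewrite /Psi /phase2/=; mfun.
by move=> z _; rewrite lee_fin /Psi normrM ler_piMr.
Qed.

Let K (z : mR2 R * mR2 R) : R := P (z.1.1 - z.2.1) * P (z.1.2 - z.2.2).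

Let mK : measurable_fun [set: mR2 R * mR2 R] K.
Proof. by rewrite /K; mfun. Qed.

Let K0 z : 0 <= K z. Proof. by rewrite mulr_ge0. Qed.

(** Damping makes the integrand absolutely integrable in all variables, so [p] may be integrated
    first; this turns the phase into a product of two Poisson kernels. *)
Lemma integral_damped_square :
  (\int[leb2]_p (k2 p * (cosine2 p ^+ 2 + sine2 p ^+ 2))%:E =
   \int[LL]_z (f z.1 * f z.2 * K z)%:E)%E.
Proof.
transitivity (\int[leb2s]_p (\int[LL]_z Psi p z)%:E)%E.
  apply: eq_integral => p _; rewrite sqr_cosine2_sine2 -RintegralZl//.
    by congr EFin; apply: eq_Rintegral => z _; rewrite mulrA.
  apply: (le_integrable measurableT _ _ (integrable_prod If If)) => /=.
    by apply/measurable_EFinP; rewrite /phase2/=; mfun.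
  by move=> z _; rewrite lee_fin normrM ler_piMr.
rewrite (integral_fubini1 IPsi) -(integral_fubini2 IPsi).
apply: eq_integral => z _ /=; congr EFin.
have E : (fun p : mR2 R => Psi p z) =
    (fun p => f z.1 * f z.2 * (k2 p * cos (phase2 (z.1 - z.2) p))).
  by apply/funext => p; rewrite /Psi; ring.
rewrite E RintegralZl//; first by rewrite Rintegral_damping2_cos.
apply: (le_integrable measurableT _ _ Ik2) => /=.
  by apply/measurable_EFinP; rewrite /phase2/=; mfun.
by move=> p _; rewrite lee_fin normrM ler_piMr.
Qed.

Let integral_P (x : R) :
  (\int[lam]_y (P (x - y))%:E = 1)%E /\ (\int[lam]_y (P (y - x))%:E = 1)%E.
Proof.
have mPE : measurable_fun [set: mR] (fun y : mR => (P y)%:E) by mfun.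
have PE0 (y : mR) : (0 <= (P y)%:E)%E by rewrite lee_fin.
have T : (\int[lam]_y (P (y - x))%:E = 1)%E.
  rewrite -(integral_poisson e0).
  exact: (lebesgue_integral_translate (- x) mPE PE0).
split => //; rewrite -[RHS]T; apply: eq_integral => y _; congr EFin.
by rewrite /P -opprB mulrN sqrrN.
Qed.

Let integral_K1 (a : mR2 R) : (\int[leb2]_b (K (a, b))%:E = 1)%E.
Proof.
rewrite leb2_tonelli; last 2 first.
- by rewrite /K; mfun.
- by move=> b; rewrite lee_fin.
transitivity (\int[lam]_x ((P (a.1 - x))%:E * \int[lam]_y (P (a.2 - y))%:E))%E.
  apply: eq_integral => x _.
  have mPx : measurable_fun [set: mR] (fun y : mR => (P (a.2 - y))%:E) by mfun.
  have Px0 (y : mR) : [set: mR] y -> (0 <= (P (a.2 - y))%:E)%E.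
    by move=> _; rewrite lee_fin.
  by rewrite -ge0_integralZl_EFin.
by rewrite (integral_P a.2).1; under eq_integral do rewrite mule1; rewrite (integral_P a.1).1.
Qed.

Let integral_K2 (b : mR2 R) : (\int[leb2]_a (K (a, b))%:E = 1)%E.
Proof.
rewrite -[RHS](integral_K1 b); apply: eq_integral => a _; congr EFin.
by rewrite /K /P/= -(opprB a.1) -(opprB a.2) !mulrN !sqrrN.
Qed.

(** By f(a) f(b) <= (f(a) ^ 2 + f(b) ^ 2) / 2 and since [K] has mass 1 in each variable separately,
    each half contributes half of the squared norm. *)
Lemma integral_damped_le :
  (\int[leb2]_p (k2 p * (cosine2 p ^+ 2 + sine2 p ^+ 2))%:E <=
   \int[leb2]_q (f q ^+ 2)%:E)%E.
Proof.
pose G1 (z : mR2 R * mR2 R) := ((f z.1 ^+ 2 / 2)%:E * (K z)%:E)%E.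
pose G2 (z : mR2 R * mR2 R) := ((f z.2 ^+ 2 / 2)%:E * (K z)%:E)%E.
have mG1 : measurable_fun [set: mR2 R * mR2 R] G1 by rewrite /G1; mfun.
have mG2 : measurable_fun [set: mR2 R * mR2 R] G2 by rewrite /G2; mfun.
have f20 q : 0 <= f q ^+ 2 / 2 by rewrite divr_ge0 ?sqr_ge0.
have G10 z : (0 <= G1 z)%E by rewrite mule_ge0// lee_fin.
have G20 z : (0 <= G2 z)%E by rewrite mule_ge0// lee_fin.
have mf2 : measurable_fun [set: mR2 R] (fun q => (f q ^+ 2 / 2)%:E) by mfun.
have I1 : (\int[LL]_z G1 z = \int[leb2]_q (f q ^+ 2 / 2)%:E)%E.
  rewrite prodm_tonelli1//; apply: eq_integral => q _; rewrite /G1 /=.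
  have mKq : measurable_fun [set: mR2 R] (fun b => (K (q, b))%:E).
    by rewrite /K; mfun.
  transitivity ((f q ^+ 2 / 2)%:E * \int[leb2s]_b (K (q, b))%:E)%E.
    by apply: ge0_integralZl => //; [move=> b _|]; rewrite lee_fin.
  by rewrite (integral_K1 q) mule1.
have I2 : (\int[LL]_z G2 z = \int[leb2]_q (f q ^+ 2 / 2)%:E)%E.
  rewrite prodm_tonelli2//; apply: eq_integral => q _; rewrite /G2 /=.
  have mKq : measurable_fun [set: mR2 R] (fun b => (K (b, q))%:E).
    by rewrite /K; mfun.
  transitivity ((f q ^+ 2 / 2)%:E * \int[leb2s]_b (K (b, q))%:E)%E.
    by apply: ge0_integralZl => //; [move=> b _|]; rewrite lee_fin.
  by rewrite (integral_K2 q) mule1.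
rewrite integral_damped_square.
apply: (@le_trans _ _ (\int[LL]_z (G1 z + G2 z))%E).
  apply: integral_le_ge0.
  - by apply/measurable_EFinP; mfun.
  - exact: emeasurable_funD.
  - by move=> z; rewrite adde_ge0.
  - move=> z; rewrite /G1 /G2 -!EFinM -EFinD lee_fin -mulrDl ler_wpM2r//.
    by rewrite -subr_ge0 (_ : _ - _ = (f z.1 - f z.2) ^+ 2 / 2) ?divr_ge0 ?sqr_ge0//; field.
rewrite ge0_integralD// I1 I2 -ge0_integralD//; last 2 first.
- by move=> q _; rewrite lee_fin.
- by move=> q _; rewrite lee_fin.
rewrite le_eqVlt; apply/orP; left; apply/eqP; apply: eq_integral => q _.
by rewrite -EFinD; congr EFin; field.
Qed.

End damped.

(** On a bounded disc the damping is as close to 1 as desired, so the uniform bound is used for one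
    [e] per factor r < 1 and no limit is taken under the integral. *)
Lemma plancherel_le :
  (\int[leb2]_p ((sqn p < 4)%R%:R * (cosine2 p ^+ 2 + sine2 p ^+ 2))%:E <=
   \int[leb2]_q (f q ^+ 2)%:E)%E.
Proof.
have ms := @measurable_sqn R; have mc := mcosine2; have msi := msine2.
have c0 p : 0 <= cosine2 p ^+ 2 + sine2 p ^+ 2 by rewrite addr_ge0 ?sqr_ge0.
apply/lee_mul01Pr.
  by apply: integral_ge0 => p _; rewrite lee_fin mulr_ge0.
move=> r /andP[r0 r1].
(* In the disc of radius 2 both coordinates are at most 2 in absolute value, so the damping there is
   at least exp (- 4 e) = r. *)
pose e := - (ln r) / 4.
have lnr : ln r < 0 by rewrite ln_lt0// r0.
have e0 : 0 < e by rewrite divr_gt0// oppr_gt0.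
apply: le_trans (integral_damped_le e0).
have t0 (p : mR2 R) : [set: mR2 R] p ->
    (0 <= ((sqn p < 4)%R%:R * (cosine2 p ^+ 2 + sine2 p ^+ 2))%:E)%E.
  by rewrite lee_fin mulr_ge0.
have mt : measurable_fun [set: mR2 R]
    (fun p => ((sqn p < 4)%R%:R * (cosine2 p ^+ 2 + sine2 p ^+ 2))%:E).
  by apply/measurable_EFinP; mfun.
rewrite -ge0_integralZl_EFin ?(ltW r0)//.
have md := @measurable_damping R e.
have k0 p : 0 <= damping e p.1 * damping e p.2 by rewrite mulr_ge0 ?damping_ge0.
apply: integral_le_ge0.
- by apply: emeasurable_funM.
- by apply/measurable_EFinP; mfun.
- by move=> p; rewrite lee_fin mulr_ge0.
move=> p; rewrite -EFinM lee_fin mulrA ler_wpM2r//.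
have d0 := damping_ge0 e; have [p4|_] := ltP (sqn p) 4; last first.
  by rewrite mulr0 mulr_ge0.
rewrite mulr1 /damping -expRD -[leLHS]lnK ?posrE// ler_expR.
have le2 (x y : R) : x ^+ 2 + y ^+ 2 < 4 -> `|x| <= 2.
  by move=> h; rewrite ler_norml; apply/andP; split; nra.
have x2 := le2 _ _ p4.
have y2 : `|p.2| <= 2 by apply: (le2 _ p.1); rewrite addrC.
have -> : ln r = - (e * 4) by rewrite /e; field.
rewrite -opprD -mulrDr lerN2 ler_wpM2l ?(ltW e0)//; lra.
Qed.

End plancherel.

(** * Essential supports *)

Section borel_R3.
Context {R : realType}.
Local Notation mR := (measurableTypeR R).

(** A countable base of the topology; balls of the product are cubes, which makes their
    measurability a matter of coordinates. *)
Definition qbox (i : rat * rat * rat * nat) : set (R3 R) :=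
  ball ((ratr i.1.1.1, ratr i.1.1.2, ratr i.1.2) : R3 R) (i.2.+1%:R^-1 : R).

Lemma qboxE i (x : R3 R) : qbox i x <->
  [/\ `|ratr i.1.1.1 - x.1.1| < (i.2.+1%:R^-1 : R),
    `|ratr i.1.1.2 - x.1.2| < (i.2.+1%:R^-1 : R) & `|ratr i.1.2 - x.2| < (i.2.+1%:R^-1 : R)].
Proof. by split => [[[]]|[]]. Qed.

Lemma qbox_open i : open (qbox i).
Proof. exact: ball_open. Qed.

Lemma open_qbox (U : set (R3 R)) (x : R3 R) : open U -> U x ->
  exists i, qbox i x /\ qbox i `<=` U.
Proof.
move=> oU Ux; have /nbhs_ballP[e /= e0 eU] : nbhs x U by exact: open_nbhs_nbhs.
(* Half of [e], because the given point and any other point of the cube are compared through its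
   centre. *)
have [n] := @ltr_add_invr R 0 (e / 2) (divr_gt0 e0 (ltr0n _ 2)).
rewrite add0r => ne; set r := n.+1%:R^-1 in ne.
have r0 : 0 < r by rewrite invr_gt0.
have Q (y : R) : exists q : rat, `|ratr q - y| < r.
  have /rat_in_itvoo[q] : y - r < y + r by rewrite ltrBlDr -addrA ltrDl addr_gt0.
  rewrite in_itv/= => /andP[q1 q2]; exists q; rewrite ltr_norml.
  by apply/andP; split; lra.
have [a xa] := Q x.1.1; have [b xb] := Q x.1.2; have [c xc] := Q x.2.
exists (a, b, c, n); split; first exact/qboxE.
move=> y /qboxE[/= ya yb yc]; apply: eU.
have T (u v q : R) : `|q - u| < r -> `|q - v| < r -> `|u - v| < e.
  move=> uq vq; rewrite -[u - v](subrKA q) (le_lt_trans (ler_normD _ _))//.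
  by rewrite [X in X + _]distrC; lra.
by split; [split|]; rewrite /ball/=; [exact: T xa ya|exact: T xb yb|exact: T xc yc].
Qed.

Lemma measurable_qbox i : measurable (qbox i : set (mR3 R)).
Proof.
pose b (x : mR3 R) := [&& `|ratr i.1.1.1 - x.1.1| < (i.2.+1%:R^-1 : R),
    `|ratr i.1.1.2 - x.1.2| < (i.2.+1%:R^-1 : R) & `|ratr i.1.2 - x.2| < (i.2.+1%:R^-1 : R)].
have mb : measurable_fun [set: mR3 R] b by rewrite /b; mfun.
rewrite (_ : qbox i = [set: mR3 R] `&` b @^-1` [set true]).
  exact: mb.
rewrite setTI; apply/seteqP; split => x /=.
  by move=> /qboxE h; exact/and3P.
by move=> /and3P h; exact/qboxE.
Qed.

Lemma open_measurable_R3 (U : set (R3 R)) : open U -> measurable (U : set (mR3 R)).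
Proof.
move=> oU; rewrite (_ : U = \bigcup_(i in [set i | qbox i `<=` U]) qbox i).
  rewrite bigcup_mkcond; apply: countable_bigcupT_measurable.
    exact: countableP.
  by move=> i; case: ifPn => _; [exact: measurable_qbox|exact: measurable0].
apply/seteqP; split => [x Ux|x [i iU]]; last exact: iU.
by have [i [ix iU]] := open_qbox oU Ux; exists i.
Qed.

Lemma continuous_measurable_R3 (f : R3 R -> R) : continuous f ->
  measurable_fun [set: mR3 R] (f : mR3 R -> mR).
Proof.
move=> /continuousP cf; apply: (measurability _ (RGenOpens.measurableE R)).
move=> _ [_ [a [b ->] <-]]; rewrite setTI; apply: open_measurable_R3.
exact/cf/interval_open.
Qed.

Section essential_support.
Variable g : R3 R -> R[i].

Let null (U : set (R3 R)) :=
  {ae surface_measure, forall x, sphere2 x -> U x -> g x = 0}.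

Let aeF : Filter (almost_everywhere (@surface_measure R)) :=
  ae_filter_ringOfSetsType surface_measure.

Let nullbox := [set i | null (qbox i)].

(** Every null open set is a union of null cubes, so the union in the definition becomes countable.
    Measurability of the support and vanishing almost everywhere off it both follow from this. *)
Lemma ess_support_qbox :
  ess_support g = sphere2 `\` \bigcup_(i in nullbox) qbox i.
Proof.
rewrite /ess_support; congr (_ `\` _); apply/seteqP; split => x.
  move=> [U [oU nU] Ux]; have [i [ix iU]] := open_qbox oU Ux.
  exists i => //; rewrite /nullbox/= /null.
  apply: (@filterS _ _ aeF _ _ _ nU) => y h sy iy.
  by apply: h => //; exact: iU.
move=> [i ni ix]; exists (qbox i) => //; split => //; exact: qbox_open.
Qed.

Lemma measurable_ess_support : measurable (ess_support g : set (mR3 R)).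
Proof.
rewrite ess_support_qbox; apply: measurableD; first exact: measurable_sphere2.
rewrite bigcup_mkcond; apply: countable_bigcupT_measurable.
  exact: countableP.
by move=> i; case: ifPn => _; [exact: measurable_qbox|exact: measurable0].
Qed.

Lemma ess_supportP :
  {ae surface_measure, forall x, sphere2 x -> ~ ess_support g x -> g x = 0}.
Proof.
(* An enumeration of the null cubes padded with empty sets, so that countably many null exceptions
   can be merged. *)
pose Q n := if unpickle n is Some i then
   if pselect (nullbox i) then qbox i else set0 else set0.
have : {ae (@surface_measure R), forall x, forall n, sphere2 x -> Q n x -> g x = 0}.
  apply/ae_foralln => n; rewrite /Q; case: unpickle => [i|]; last exact: aeW.
  by case: pselect => ni; [exact: ni|exact: aeW].
apply: (@filterS _ _ aeF) => x h sx; rewrite ess_support_qbox => nE.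
have [i ni ix] : (\bigcup_(i in nullbox) qbox i) x.
  by apply: contrapT => nx; apply: nE.
have Qi : Q (pickle i) = qbox i.
  by rewrite /Q pickleK; case: (pselect (nullbox i)).
by have := h (pickle i) sx; rewrite Qi; apply.
Qed.

End essential_support.

End borel_R3.

(** * The Fourier transform of a weight *)

Section weight.
Context {R : realType}.
Local Notation lam := (@lebesgue_measure R).
Local Notation mR := (measurableTypeR R).

Section schwartz_bounds.
Variable w : R3 R -> R.
Hypothesis sw : schwartz w.

Lemma schwartz_measurable : measurable_fun [set: mR3 R] (w : mR3 R -> mR).
Proof.
apply: continuous_measurable_R3 => x.
by apply: differentiable_continuous; have [] := sw [::].
Qed.

Lemma schwartz_decay k : exists C : R, forall x, norm3 x ^+ k * `|w x| <= C.
Proof. by have [_] := sw [::]; exact. Qed.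

Let e : R := 2 * pi.
Let e0 : 0 < e. Proof. by rewrite mulr_gt0// pi_gt0. Qed.

(** The Poisson kernel with e = 2 pi is 1 / (pi (1 + x ^ 2)), a ready-made integrable majorant for
    rapidly decreasing functions. *)
Let P (x : mR) : R := 2 * e / (e ^+ 2 + (2 * pi * x) ^+ 2).

Let PE x : P x = 2 / e / (1 + x ^+ 2).
Proof.
rewrite /P -/e; have x0 : 1 + x ^+ 2 != 0 by rewrite gt_eqF// ltr_pwDl ?sqr_ge0.
move: e0; move: e => q q0; have x1 : q ^+ 2 + (q * x) ^+ 2 != 0.
  rewrite (_ : _ + _ = q ^+ 2 * (1 + x ^+ 2)); last by ring.
  by rewrite mulf_neq0// expf_neq0// gt_eqF.
by field; rewrite (gt_eqF q0) x0 x1.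
Qed.

Let P0 x : 0 <= P x.
Proof. by rewrite divr_ge0// ?addr_ge0 ?sqr_ge0// mulr_ge0// ltW. Qed.

Let mP : measurable_fun [set: mR] P.
Proof. by rewrite /P; mfun. Qed.

Let IP : lam.-integrable [set: mR] (EFin \o P).
Proof.
apply/integrableP; split; first exact/measurable_EFinP.
under eq_integral do rewrite /= ger0_norm ?P0//.
by rewrite (integral_poisson e0) ltry.
Qed.

Lemma integrable_rational_bound (h : mR -> mR) (C : R) :
  measurable_fun [set: mR] h ->
  (forall t, (1 + t ^+ 2) * `|h t| <= C) -> lam.-integrable [set: mR] (EFin \o h).
Proof.
move=> mh hC.
have I : lam.-integrable [set: mR] (EFin \o (fun t => C * e / 2 * P t)).
  have := @integrableZl _ _ _ lam _ measurableT (C * e / 2) _ IP.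
  by apply: eq_integrable => // t _; rewrite /= EFinM.
apply: (le_integrable measurableT _ _ I) => /=; first exact/measurable_EFinP.
move=> t _; rewrite lee_fin (le_trans _ (ler_norm _))// PE.
have t0 : 0 < 1 + t ^+ 2 by rewrite ltr_pwDl ?sqr_ge0.
rewrite (_ : _ * _ = C / (1 + t ^+ 2)); last first.
  by field; rewrite !gt_eqF.
by rewrite ler_pdivlMr// mulrC.
Qed.

(** The product of 1 + x ^ 2, 1 + y ^ 2 and 1 + z ^ 2 is at most (1 + s) ^ 3 <= 4 (1 + s ^ 3), where
    s is the squared norm. Decay of orders 0 and 6 thus bounds [w] by a product of three Poisson
    kernels. *)
Lemma schwartz_integrable : (@leb3s R).-integrable [set: mR3 R] (EFin \o w).
Proof.
have [C0 hC0] := schwartz_decay 0; have [C6 hC6] := schwartz_decay 6.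
(* The cube of e / 2 undoes the normalisation of the three kernels. *)
pose C := (4 * (C0 + C6)) * (e / 2) ^+ 3.
have I := integrable_prod (integrable_prod IP IP) IP.
have IC : (@leb3s R).-integrable [set: mR3 R]
    (EFin \o (fun x => C * (P x.1.1 * P x.1.2 * P x.2))).
  have := @integrableZl _ _ _ (@leb3s R) _ measurableT C _ I.
  by apply: eq_integrable => // t _; rewrite /= EFinM.
apply: (le_integrable measurableT _ _ IC) => /=.
  by apply/measurable_EFinP; exact: schwartz_measurable.
move=> -[[x y] z] _; rewrite lee_fin (le_trans _ (ler_norm _))//= !PE.
have h0 := hC0 (x, y, z); have h6 := hC6 (x, y, z).
have X0 : 0 < 1 + x ^+ 2 by rewrite ltr_pwDl ?sqr_ge0.
have Y0 : 0 < 1 + y ^+ 2 by rewrite ltr_pwDl ?sqr_ge0.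
have Z0 : 0 < 1 + z ^+ 2 by rewrite ltr_pwDl ?sqr_ge0.
have -> : C * (2 / e / (1 + x ^+ 2) * (2 / e / (1 + y ^+ 2)) * (2 / e / (1 + z ^+ 2)))
   = 4 * (C0 + C6) / ((1 + x ^+ 2) * (1 + y ^+ 2) * (1 + z ^+ 2)).
  rewrite /C; move: e0; move: e => q q0; field.
  by rewrite (gt_eqF q0) (gt_eqF X0) (gt_eqF Y0) (gt_eqF Z0).
rewrite ler_pdivlMr ?mulr_gt0//.
move: h0 h6; rewrite expr0 mul1r (exprM _ 2 3) sqr_norm3 /dot3/= -!expr2.
have := normr_ge0 (w (x, y, z)); move: `|w _| => v v0 h0 h6.
have /ler_wpM2l := v0.
set s := x ^+ 2 + y ^+ 2 + z ^+ 2 in h6.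
have A := sqr_ge0 x; have B := sqr_ge0 y; have D := sqr_ge0 z.
have s0 : 0 <= s by rewrite /s !addr_ge0.
have le3 : (1 + x ^+ 2) * (1 + y ^+ 2) * (1 + z ^+ 2) <= 4 * (1 + s ^+ 3).
  apply: (@le_trans _ _ ((1 + s) ^+ 3)).
    rewrite [leRHS](_ : _ = (1 + s) * (1 + s) * (1 + s)); last by ring.
    apply: ler_pM; rewrite ?mulr_ge0 ?addr_ge0//.
      apply: ler_pM; rewrite ?addr_ge0// lerD2l /s; lra.
    rewrite lerD2l /s; lra.
  have -> : 4 * (1 + s ^+ 3) = (1 + s) ^+ 3 + 3 * ((s - 1) ^+ 2 * (1 + s)) by ring.
  by rewrite lerDl mulr_ge0// mulr_ge0 ?sqr_ge0// addr_ge0.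
move=> /(_ _ _ le3) /le_trans; apply.
have : v * (4 * (1 + s ^+ 3)) = 4 * (v + s ^+ 3 * v) by ring.
by move=> ->; rewrite ler_pM2l// lerD.
Qed.

End schwartz_bounds.
End weight.

(** * The Fourier slice theorem *)

Section weight_fourier.
Context {R : realType}.
Local Notation lam := (@lebesgue_measure R).
Local Notation mR := (measurableTypeR R).
Variable w : R3 R -> R.
Hypothesis sw : schwartz w.

Let mw : measurable_fun [set: mR3 R] (w : mR3 R -> mR).
Proof. exact: schwartz_measurable. Qed.

Let Iw : (@leb3s R).-integrable [set: mR3 R] (EFin \o w).
Proof. exact: schwartz_integrable. Qed.

Definition phase3 (x y : R3 R) : R := 2 * pi * dot3 x y.

(** The Fourier transform of [w] is [cosine3] - i [sine3]; the two real functions are handled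
    separately throughout. *)
Definition cosine3 (y : R3 R) : R := \int[leb3]_x (w x * cos (phase3 x y)).
Definition sine3 (y : R3 R) : R := \int[leb3]_x (w x * sin (phase3 x y)).

Lemma measurable_cosine3 : measurable_fun [set: mR3 R] (cosine3 : mR3 R -> mR).
Proof.
apply: (@measurable_Rintegral_fst _ _ _ _ _ leb3s
  (fun z => w z.2 * cos (phase3 z.2 z.1))).
rewrite /phase3; mfun.
Qed.

Lemma measurable_sine3 : measurable_fun [set: mR3 R] (sine3 : mR3 R -> mR).
Proof.
apply: (@measurable_Rintegral_fst _ _ _ _ _ leb3s
  (fun z => w z.2 * sin (phase3 z.2 z.1))).
rewrite /phase3; mfun.
Qed.

Let bounded_integrable (b : mR3 R -> mR) :
  measurable_fun [set: mR3 R] b -> (forall q, `|b q| <= 1) ->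
  (@leb3s R).-integrable [set: mR3 R] (EFin \o (fun q => w q * b q)).
Proof.
move=> mb b1; apply: (le_integrable measurableT _ _ Iw) => /=.
  by apply/measurable_EFinP; mfun.
by move=> s _; rewrite lee_fin normrM ler_piMr.
Qed.

Let bounded_Rintegral (b : mR3 R -> mR) :
  measurable_fun [set: mR3 R] b -> (forall q, `|b q| <= 1) ->
  `|\int[leb3]_x (w x * b x)| <= \int[leb3]_x `|w x|.
Proof.
move=> mb b1; have Ib := bounded_integrable mb b1.
apply: (@le_trans _ _ (\int[leb3s]_x `|w x * b x|)).
  exact: (le_normr_Rintegral measurableT Ib).
apply: (le_Rintegral (mu := leb3s)) => //.
- exact: (integrable_norm Ib).
- exact: (integrable_norm Iw).
- by move=> x _; rewrite normrM ler_piMr.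
Qed.

Let cos1 (x : R) : `|cos x| <= 1.
Proof. by rewrite ler_norml cos_geN1 cos_le1. Qed.

Let sin1 (x : R) : `|sin x| <= 1.
Proof. by rewrite ler_norml sin_geN1 sin_le1. Qed.

Lemma cosine3_bounded y : `|cosine3 y| <= \int[leb3]_x `|w x|.
Proof. by apply: bounded_Rintegral => //; rewrite /phase3; mfun. Qed.

Lemma sine3_bounded y : `|sine3 y| <= \int[leb3]_x `|w x|.
Proof. by apply: bounded_Rintegral => //; rewrite /phase3; mfun. Qed.

Lemma cosine3N y : cosine3 (- y) = cosine3 y.
Proof.
by apply: eq_Rintegral => x _; rewrite /phase3 dot3Nr mulrN cosN.
Qed.

Lemma sine3N y : sine3 (- y) = - sine3 y.
Proof.
rewrite /sine3 -[RHS]mulN1r -RintegralZl//; last first.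
  by apply: bounded_integrable => //; rewrite /phase3; mfun.
by apply: eq_Rintegral => x _; rewrite /phase3 dot3Nr mulrN sinN; ring.
Qed.

Lemma measurable_xray omega :
  measurable_fun [set: mR3 R] (xray w omega : mR3 R -> mR).
Proof.
apply: (@measurable_Rintegral_fst _ _ _ _ _ lam
  (fun z : mR3 R * mR => w ((z.1 : R3 R) + (z.2 : R) *: omega))).
mfun.
Qed.

Section slice.
Variable omega : R3 R.
Hypothesis omega1 : sphere2 omega.

Let mF := measurable_frame_map omega.

Lemma norm3_frame_mapE z : norm3 (frame_map omega z) = norm3 z.
Proof.
rewrite norm3_frame_map// /norm3 /dot3 /sqn.
Qed.

Lemma ge0_integral_frame (g : mR3 R -> \bar R) :
  measurable_fun [set: mR3 R] g -> (forall x, 0 <= g x)%E ->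
  (\int[leb3]_x g (frame_map omega x) = \int[leb3]_x g x)%E.
Proof.
by move=> mg g0; apply: (leb3_integral_isometry (frame_mapD omega)
  (frame_mapK omega1) norm3_frame_mapE mF mg g0).
Qed.

Definition xray_plane (q : mR2 R) : mR := xray w omega (plane_map omega q).

Let wF (z : mR3 R) : mR := w (frame_map omega z).

Let mwF : measurable_fun [set: mR3 R] wF. Proof. by rewrite /wF; mfun. Qed.

Let IwF : (prodm (@leb2s R) lam).-integrable setT (EFin \o wF).
Proof.
apply/integrableP; split; first exact/measurable_EFinP.
have [_] := integrableP _ _ _ Iw; apply: le_lt_trans.
rewrite le_eqVlt; apply/orP; left; apply/eqP.
apply: (ge0_integral_frame (g := fun x => `|(w x)%:E|%E)) => //.
by apply: measurableT_comp => //; exact/measurable_EFinP.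
Qed.

(** Integrability on every line, not almost every one, identifies [xray_plane] with the extended
    inner integral at each point. Since [t] is at most the norm in absolute value, decay of orders 0
    and 2 bounds (1 + t ^ 2) |w|. *)
Let line_integrable (q : mR2 R) :
  lam.-integrable [set: mR] (EFin \o (fun t => wF (q, t))).
Proof.
have [C0 hC0] := schwartz_decay sw 0; have [C2 hC2] := schwartz_decay sw 2.
apply: (@integrable_rational_bound _ _ (C0 + C2)).
  by apply: (measurableT_comp mwF (g := fun t : mR => (q, t))); mfun.
move=> t; set v := frame_map omega (q, t).
have := hC0 v; have := hC2 v.
rewrite expr0 mul1r /v norm3_frame_map// sqr_sqrtr ?addr_ge0 ?sqn_ge0 ?sqr_ge0//= => h2 h0.
rewrite mulrDl mul1r; apply: lerD => //.
by apply: le_trans h2; apply: ler_wpM2r => //; rewrite lerDr sqn_ge0.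
Qed.

Let xray_planeE q : xray_plane q = \int[lam]_t wF (q, t).
Proof. by []. Qed.

Lemma integrable_xray_plane :
  (@leb2s R).-integrable [set: mR2 R] (EFin \o xray_plane).
Proof.
have := integrable_fubini_F IwF; apply: eq_integrable => // q _ /=.
rewrite xray_planeE /Rintegral fineK//.
apply: integrable_fin_num => //; exact: line_integrable.
Qed.

(** In frame coordinates the phase at a vector orthogonal to [omega] ignores the coordinate along
    [omega], so Fubini integrates [w] along that coordinate and leaves the X-ray transform. *)
Let slice (b : R -> R) (p : R * R) : measurable_fun [set: mR] (b : mR -> mR) ->
  (forall t, `|b t| <= 1) ->
  \int[leb3]_x (w x * b (phase3 x (plane_map omega p))) =
  \int[leb2]_q (xray_plane q * b (phase2 q p)).
Proof.
move=> mb b1.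
have mpl := measurable_plane_map omega.
transitivity (\int[leb3]_x (wF x * b (phase2 x.1 p))).
  transitivity (\int[leb3]_x ((fun y : mR3 R => w y * b (phase3 y (plane_map omega p))) (frame_map omega x))).
    apply/esym; apply: (integral_comp_ge0 ge0_integral_frame).
    by rewrite /phase3; mfun.
  by apply: eq_Rintegral => x _ /=; rewrite /phase3 dot3_frame_plane.
rewrite [LHS](_ : _ = \int[prodm leb2s lam]_x (wF x * b (phase2 x.1 p)))//.
rewrite -Rintegral_fubini1; last first.
  apply: (le_integrable measurableT _ _ IwF) => /=.
    by apply/measurable_EFinP; rewrite /phase2; mfun.
  by move=> z _; rewrite lee_fin normrM ler_piMr.
apply: eq_Rintegral => q _ /=; by rewrite xray_planeE -RintegralZr.
Qed.

Lemma cosine3_slice p : cosine3 (plane_map omega p) = cosine2 xray_plane p.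
Proof. by rewrite /cosine3 slice//; mfun. Qed.

Lemma sine3_slice p : sine3 (plane_map omega p) = sine2 xray_plane p.
Proof. by rewrite /sine3 slice//; mfun. Qed.

Lemma measurable_perp : measurable (perp omega : set (mR3 R)).
Proof.
have md : measurable_fun [set: mR3 R] (fun x : mR3 R => dot3 x omega : mR) by mfun.
rewrite (_ : perp omega = [set: mR3 R] `&` (fun x : mR3 R => dot3 x omega : mR) @^-1` [set 0]).
  by apply: md => //; exact: measurable_set1.
by rewrite setTI.
Qed.

Lemma integral_plane_measure (g : mR3 R -> \bar R) :
  measurable_fun [set: mR3 R] g -> (forall x, 0 <= g x)%E ->
  (\int[plane_measure omega]_(v in perp omega) g v =
   \int[leb2]_p g (plane_map omega p))%E.
Proof.
move=> mg g0; rewrite integral_mkcond.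
have mgr : measurable_fun [set: mR3 R] (g \_ (perp omega : set (mR3 R))).
  by apply/(measurable_restrictT _ measurable_perp); exact: measurable_funTS.
have g0r x : (0 <= (g \_ (perp omega : set (mR3 R))) x)%E.
  by rewrite patchE; case: ifPn.
have h A : measurable A -> plane_measure omega A =
    ((1%:nng : {nonneg R})%:num%:E * leb2 ((plane_map omega : mR2 R -> mR3 R) @^-1` A `&` setT))%E.
  by move=> _; rewrite mul1e setIT.
rewrite (ge0_integral_scaled_pushforward (measurable_plane_map omega) measurableT h mgr g0r).
rewrite mul1e; apply: eq_integral => p _.
rewrite indicT mul1e patchE ifT// inE; exact: plane_map_perp.
Qed.

Lemma chord_energy :
  (\int[leb2]_p ((sqn p < 4)%R%:R *
     (cosine3 (plane_map omega p) ^+ 2 + sine3 (plane_map omega p) ^+ 2))%:E <=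
   \int[plane_measure omega]_(v in perp omega) (`|xray w omega v| ^+ 2)%:E)%E.
Proof.
have mx := measurable_xray omega.
rewrite integral_plane_measure; last 2 first.
- by mfun.
- by move=> x; rewrite lee_fin sqr_ge0.
under eq_integral do rewrite cosine3_slice sine3_slice.
apply: le_trans (plancherel_le integrable_xray_plane) _.
rewrite le_eqVlt; apply/orP; left; apply/eqP; apply: eq_integral => p _.
by rewrite /xray_plane real_normK// num_real.
Qed.

End slice.
End weight_fourier.

(** * Chords of the sphere *)

Section surface_finite.
Context {R : realType}.

Lemma surface_fin_num_fun : fin_num_fun (@surface_measure R).
Proof.
move=> A mA; rewrite ge0_fin_numE//; apply: le_lt_trans surface_measure_lty.
by apply: le_measure; rewrite ?inE.
Qed.

(* Existentially quantified so that unification cannot unfold the measure. *)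
Lemma surface_sigma_finite :
  exists s : {sigma_finite_measure set (mR3 R) -> \bar R},
    forall A, s A = surface_measure A.
Proof.
pose f := Measure_isFinite.Build _ _ _ (@surface_measure R) surface_fin_num_fun.
pose s : {finite_measure set (mR3 R) -> \bar R} := HB.pack (@surface_measure R) f.
by exists s.
Qed.

End surface_finite.

Lemma ge0_integralTZl d (T : measurableType d) (R : realType)
    (mu : {measure set T -> \bar R}) (k : R) (f : T -> \bar R) :
  (0 <= k)%R -> measurable_fun [set: T] f -> (forall x, 0 <= f x)%E ->
  (\int[mu]_x (k%:E * f x) = k%:E * \int[mu]_x f x)%E.
Proof. by move=> k0 mf f0; rewrite ge0_integralZl_EFin. Qed.

Lemma ge0_integral_carrier d (T : measurableType d) (R : realType)
    (mu : {measure set T -> \bar R}) (D : set T) (f : T -> \bar R) :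
  measurable D -> mu (~` D) = 0 -> measurable_fun [set: T] f ->
  (forall x, 0 <= f x)%E -> (\int[mu]_x f x = \int[mu]_(x in D) f x)%E.
Proof.
move=> mD D0 mf f0; rewrite (@ge0_negligible_integral _ _ _ mu setT (~` D))//.
  by rewrite setTD setCK.
exact: measurableC.
Qed.

Lemma eq_measure_integralT d (T : measurableType d) (R : realType)
    (mu nu : {measure set T -> \bar R}) (f : T -> \bar R) :
  (forall A, nu A = mu A) -> (\int[mu]_x f x = \int[nu]_x f x)%E.
Proof. by move=> munu; apply: eq_measure_integral => A _ _; rewrite munu. Qed.

Section chord_inequality.
Context {R : realType}.
Local Notation mR := (measurableTypeR R).
Local Notation sigma := (@surface_measure R).
Variable w : R3 R -> R.
Hypothesis sw : schwartz w.
Local Open Scope ereal_scope.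

Let F (y : mR3 R) : \bar R := (cosine3 w y ^+ 2 + sine3 w y ^+ 2)%:E.

Let mF : measurable_fun [set: mR3 R] F.
Proof.
have mc := measurable_cosine3 sw; have ms := measurable_sine3 sw.
by rewrite /F; mfun.
Qed.

Let F0 y : 0 <= F y. Proof. by rewrite lee_fin addr_ge0 ?sqr_ge0. Qed.

Let FN (y : R3 R) : F (- y)%R = F y.
Proof. by rewrite /F cosine3N (sine3N sw) sqrrN. Qed.

Let G (omega : R3 R) : \bar R :=
  \int[plane_measure omega]_(v in perp omega) (`|xray w omega v| ^+ 2)%:E.

(** [K] is an arbitrary set and [G] is not known to be measurable. [T] first confines omega to [K],
    pointwise, and is then bounded by 1. *)
Lemma chord_inequality (K : set (R3 R)) (T : mR3 R * mR3 R -> bool) :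
  measurable_fun [set: mR3 R * mR3 R] T ->
  (forall xi eta, T (xi, eta) -> sphere2 xi) ->
  (forall omega xi, sphere2 omega -> T (xi, reflect3 omega xi) -> K omega) ->
  \int[sigma]_xi \int[sigma]_eta
     ((T (xi, eta))%:R%:E * F ((xi : R3 R) - (eta : R3 R))%R) <=
  \int[sigma]_(omega in K) G omega.
Proof.
move=> mT Tsphere TK.
have [s sE] := @surface_sigma_finite R.
have I (f : mR3 R -> \bar R) : \int[sigma]_x f x = \int[s]_x f x.
  exact: eq_measure_integralT.
pose H (xi omega : mR3 R) := `|dot3 omega xi|%:E *
  ((T (xi, reflect3 omega xi))%:R%:E * F ((xi : R3 R) - reflect3 omega xi)%R).
have mH : measurable_fun [set: mR3 R * mR3 R] (fun z => H z.1 z.2).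
  by rewrite /H /reflect3; mfun.
have H0 xi omega : 0 <= H xi omega by rewrite !mule_ge0// lee_fin.
(* The reflection formula holds for unit xi; for any other xi, [T] is false and both sides
   vanish. *)
have E1 : \int[sigma]_xi \int[sigma]_eta
     ((T (xi, eta))%:R%:E * F ((xi : R3 R) - (eta : R3 R))%R) =
   \int[sigma]_xi (2%:E * \int[sigma]_omega H xi omega).
  apply: eq_integral => xi _; have [xi1|xi1] := pselect (sphere2 xi).
    rewrite (surface_reflection xi1 (Phi := fun eta : mR3 R =>
      (T (xi, eta))%:R%:E * F ((xi : R3 R) - (eta : R3 R))%R))//.
      by mfun.
    by move=> x; rewrite mule_ge0// lee_fin.
  have T0 eta : T (xi, eta) = false.
    by apply/negP => /Tsphere.
  rewrite !integral0_eq ?mule0//.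
    by move=> omega _; rewrite /H T0 mul0e mule0.
  by move=> eta _; rewrite T0 mul0e.
pose Q (omega : mR3 R) := 2%:E * \int[sigma]_xi H xi omega.
have mHs : measurable_fun [set: mR3 R * mR3 R] (fun z => H z.2 z.1).
  by apply: (measurableT_comp mH (g := fun z : mR3 R * mR3 R => (z.2, z.1))); mfun.
have m1 := measurable_integral_fst s mH.
have m2 := measurable_integral_fst s mHs.
have QE omega : Q omega = 2%:E * \int[s]_xi H xi omega by rewrite /Q I.
have mQ : measurable_fun [set: mR3 R] Q.
  by rewrite (_ : Q = fun omega => 2%:E * \int[s]_xi H xi omega);
    [exact: emeasurable_funM|exact/funext].
have Q0 omega : 0 <= Q omega by rewrite mule_ge0//; exact: integral_ge0.
have E2 : \int[sigma]_xi (2%:E * \int[sigma]_omega H xi omega) = \int[sigma]_omega Q omega.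
  have p1 xi : 0 <= \int[s]_omega H xi omega by exact: integral_ge0.
  have p2 omega : 0 <= \int[s]_xi H xi omega by exact: integral_ge0.
  rewrite [LHS]I [RHS]I.
  transitivity (\int[s]_xi (2%:E * \int[s]_omega H xi omega)).
    by apply: eq_integral => xi _; rewrite I.
  rewrite (ge0_integralTZl s (ler0n _ 2) m1 p1) (ge0_integral_swap s s mH H0).
  rewrite -(ge0_integralTZl s (ler0n _ 2) m2 p2).
  by apply: eq_integral => xi _; rewrite QE.
(* The hypothesis on [T] and the chord energy bound concern unit omega, so the integral is cut down
   to the sphere, which carries the measure. *)
have E3 : \int[sigma]_omega Q omega = \int[sigma]_(omega in sphere2) Q omega.
  exact: (ge0_integral_carrier measurable_sphere2 surface_measureC_sphere mQ Q0).
rewrite E1 E2 E3 [leLHS]integral_mkcond [leRHS]integral_mkcond.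
apply: le_ge0_integral => omega _; rewrite !patchE.
  by case: ifPn => _; [exact: Q0|exact: lexx].
case: ifPn => [/set_mem omega1|_]; last first.
  case: ifPn => _; last exact: lexx.
  by apply: integral_ge0 => v _; rewrite lee_fin sqr_ge0.
case: ifPn => [_|/negP Kn]; last first.
  have H00 xi : H xi omega = 0.
    rewrite /H; have -> : T (xi, reflect3 omega xi) = false.
      by apply/negP => /(TK _ _ omega1) /mem_set.
    by rewrite mul0e mule0.
  rewrite QE; under eq_integral do rewrite H00.
  by rewrite integral0 mule0 lexx.
apply: le_trans (chord_energy sw omega1).
have SP := surface_projection omega1 mF F0 FN.
have PE : \int[leb2]_p ((sqn p < 4)%R%:R%:E * F (plane_map omega p)) =
    \int[leb2]_p ((sqn p < 4)%R%:R *
      (cosine3 w (plane_map omega p) ^+ 2 + sine3 w (plane_map omega p) ^+ 2))%:E.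
  by apply: eq_integral => p _; rewrite EFinM.
rewrite -PE -SP /Q; apply: lee_wpmul2l; first by rewrite lee_fin.
apply: le_ge0_integral => xi _; first exact: H0.
rewrite /H; apply: lee_wpmul2l; first by rewrite lee_fin.
by case: (T _); rewrite ?mul1e ?mul0e ?lexx.
Qed.

End chord_inequality.

(** * Bessel's inequality *)

Section square_integrable.
Context d (T : measurableType d) (R : realType).
Variable mu : {measure set T -> \bar R}.

Definition sqint (f : T -> R) : Prop :=
  measurable_fun [set: T] f /\ mu.-integrable setT (EFin \o (fun x => f x ^+ 2)).

Lemma sqint_mul f g : sqint f -> sqint g ->
  mu.-integrable setT (EFin \o (fun x => f x * g x)).
Proof.
move=> [mf If] [mg Ig].
have I : mu.-integrable setT (EFin \o (fun x => f x ^+ 2 + g x ^+ 2)).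
  by have := integrableD measurableT If Ig; apply: eq_integrable.
apply: (le_integrable measurableT _ _ I) => /=.
  by apply/measurable_EFinP; mfun.
move=> x _; rewrite lee_fin [leRHS]ger0_norm ?addr_ge0 ?sqr_ge0// ler_norml.
by apply/andP; split; rewrite /= ; nra.
Qed.

Lemma sqint_bounded (f : T -> R) (M : R) : (mu [set: T] < +oo)%E ->
  measurable_fun [set: T] f -> (forall x, `|f x| <= M) -> sqint f.
Proof.
move=> mu1 mf fM; split=> //; apply: measurable_bounded_integrable => //.
  by mfun.
exists (M ^+ 2); split; first exact: num_real.
move=> y My x _ /=; rewrite ger0_norm ?sqr_ge0// (le_trans _ (ltW My))//.
by rewrite -real_normK ?num_real// ler_pXn2r// nnegrE ?(le_trans _ (fM x)).
Qed.

Lemma sqintD f g : sqint f -> sqint g -> sqint (fun x => f x + g x).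
Proof.
move=> hf hg; have Ifg := sqint_mul hf hg; case: hf hg => mf If [mg Ig].
split; first by mfun.
have := integrableD measurableT (integrableD measurableT If Ig)
  (integrableZl measurableT 2 Ifg).
by apply: eq_integrable => // x _ /=; rewrite -?EFinM -?EFinD; congr EFin; ring.
Qed.

Lemma sqintZ c f : sqint f -> sqint (fun x => c * f x).
Proof.
move=> [mf If]; split; first by mfun.
have := integrableZl measurableT (c ^+ 2) If.
by apply: eq_integrable => // x _ /=; rewrite -?EFinM; congr EFin; ring.
Qed.

(* Real part of the inner product of complex functions, given as pairs of their
   real and imaginary parts. *)
Definition ip2 (f g : (T -> R) * (T -> R)) : R :=
  \int[mu]_x (f.1 x * g.1 x + f.2 x * g.2 x).

Definition sqint2 (f : (T -> R) * (T -> R)) := sqint f.1 /\ sqint f.2.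

Lemma ip2C f g : ip2 f g = ip2 g f.
Proof. by apply: eq_Rintegral => x _; ring. Qed.

Lemma integrable_ip2 f g : sqint2 f -> sqint2 g ->
  mu.-integrable setT (EFin \o (fun x => f.1 x * g.1 x + f.2 x * g.2 x)).
Proof.
move=> [f1 f2] [g1 g2].
have := integrableD measurableT (sqint_mul f1 g1) (sqint_mul f2 g2).
by apply: eq_integrable.
Qed.

Definition sub2 (c : R) (f g : (T -> R) * (T -> R)) : (T -> R) * (T -> R) :=
  (fun x => f.1 x + - c * g.1 x, fun x => f.2 x + - c * g.2 x).

Lemma sqint2_sub c f g : sqint2 f -> sqint2 g -> sqint2 (sub2 c f g).
Proof.
by move=> [f1 f2] [g1 g2]; split; apply: sqintD => //; exact: sqintZ.
Qed.

Lemma ip2_sub c f g h : sqint2 f -> sqint2 g -> sqint2 h ->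
  ip2 (sub2 c f g) h = ip2 f h - c * ip2 g h.
Proof.
move=> sf sg sh; have Igh := integrable_ip2 sg sh.
rewrite /ip2 -RintegralZl// -RintegralB//; last 2 first.
- exact: integrable_ip2.
- by have := integrableZl measurableT c Igh; apply: eq_integrable.
by apply: eq_Rintegral => x _ /=; ring.
Qed.

Lemma ip2_ge0 f : 0 <= ip2 f f.
Proof. by apply: Rintegral_ge0 => x _; rewrite addr_ge0// -expr2 sqr_ge0. Qed.

(* Induction on the list, subtracting one projection at a time. *)
Lemma bessel (I : eqType) (u : I -> (T -> R) * (T -> R)) (s : seq I) h :
  uniq s -> (forall j, j \in s -> sqint2 (u j)) -> sqint2 h ->
  (forall j, j \in s -> ip2 (u j) (u j) <= 1) ->
  (forall j k, j \in s -> k \in s -> j != k -> ip2 (u j) (u k) = 0) ->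
  \sum_(j <- s) ip2 h (u j) ^+ 2 <= ip2 h h.
Proof.
elim: s h => [|i s IH] h; first by rewrite big_nil ip2_ge0.
move=> /= /andP[ni us] su sh u1 u0; rewrite big_cons.
have si : sqint2 (u i) by apply: su; rewrite mem_head.
have insW j : j \in s -> j \in i :: s by rewrite inE => ->; rewrite orbT.
pose c := ip2 h (u i); pose h' := sub2 c h (u i).
have sh' : sqint2 h' by exact: sqint2_sub.
have E : \sum_(j <- s) ip2 h (u j) ^+ 2 = \sum_(j <- s) ip2 h' (u j) ^+ 2.
  rewrite big_seq [RHS]big_seq; apply: eq_bigr => j js.
  rewrite ip2_sub//; last exact/su/insW.
  rewrite (u0 i j) ?mem_head ?mulr0 ?subr0//; first exact: insW.
  by apply: contraNneq ni => ->.
rewrite E -/c; have : \sum_(j <- s) ip2 h' (u j) ^+ 2 <= ip2 h' h'.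
  apply: IH => // [j js|j js|j k js ks].
  - exact/su/insW.
  - exact/u1/insW.
  - by apply: u0; exact: insW.
(* As [u i] has norm at most 1, the last two terms add up to at most - c ^ 2, which pays for the
   summand split off. *)
have -> : ip2 h' h' = ip2 h h - 2 * c ^+ 2 + c ^+ 2 * ip2 (u i) (u i).
  rewrite ip2_sub// (ip2C h) (ip2C (u i)) !ip2_sub// (ip2C (u i) h) -/c; ring.
move=> h1; have := u1 i (mem_head _ _) => u1i.
have := sqr_ge0 c; nra.
Qed.

End square_integrable.

(** * Orthogonality of the averaged kernels *)

Section wigner_bessel.
Context d (X : measurableType d) (R : realType).
Variable s : {sigma_finite_measure set X -> \bar R}.
Hypothesis s_fin : (s [set: X] < +oo)%E.
Variable N : X -> X.
Hypothesis mN : measurable_fun [set: X] N.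
Hypothesis sN : forall g : X -> \bar R, measurable_fun [set: X] g ->
  (forall x, 0 <= g x)%E -> (\int[s]_x g (N x) = \int[s]_x g x)%E.

Let ss := prodm s s.

Definition flip (z : X * X) : X * X := (N z.2, N z.1).

Lemma measurable_flip : measurable_fun [set: X * X] flip.
Proof. rewrite /flip; mfun. Qed.

Lemma ge0_integral_flip (g : X * X -> \bar R) :
  measurable_fun [set: X * X] g -> (forall z, 0 <= g z)%E ->
  (\int[ss]_z g (flip z) = \int[ss]_z g z)%E.
Proof.
move=> mg g0; have mf := measurable_flip.
have mgf : measurable_fun [set: X * X] (fun z => g (flip z)).
  exact: (measurableT_comp mg mf).
rewrite (prodm_tonelli1 s s mgf (fun=> g0 _)) (prodm_tonelli2 s s mg g0).
rewrite /flip/=.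
transitivity (\int[s]_x \int[s]_y g (y, N x))%E.
  apply: eq_integral => x _; apply: (sN (g := fun y => g (y, N x))) => //.
  by apply: (measurableT_comp mg (g := fun y => (y, N x))); mfun.
apply: (sN (g := fun x => \int[s]_y g (y, x))%E).
  apply: (measurable_integral_fst s (f := fun z => g (z.2, z.1))).
  by apply: (measurableT_comp mg (g := fun z : X * X => (z.2, z.1))); mfun.
by move=> x; exact: integral_ge0.
Qed.

Lemma Rintegral_flip (f : X * X -> R) : measurable_fun [set: X * X] f ->
  \int[ss]_z f (flip z) = \int[ss]_z f z.
Proof. exact: (integral_comp_ge0 ge0_integral_flip). Qed.

Lemma sqint_flip f : sqint ss f -> sqint ss (fun z => f (flip z)).
Proof.
have mf := measurable_flip.
move=> [mff /integrableP[mi fi]]; split; first by mfun.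
apply/integrableP; split; first by apply/measurable_EFinP; mfun.
apply: le_lt_trans fi; rewrite le_eqVlt; apply/orP; left; apply/eqP.
apply: (ge0_integral_flip (g := fun z => `|(f z ^+ 2)%:E|%E)) => //.
by apply: measurableT_comp.
Qed.

Lemma sqint_N f : sqint s f -> sqint s (fun z => f (N z)).
Proof.
move=> [mff /integrableP[mi fi]]; split; first by mfun.
apply/integrableP; split; first by apply/measurable_EFinP; mfun.
apply: le_lt_trans fi; rewrite le_eqVlt; apply/orP; left; apply/eqP.
apply: (sN (g := fun z => `|(f z ^+ 2)%:E|%E)) => //.
by apply: measurableT_comp.
Qed.

Lemma sqint_tensor f g : sqint s f -> sqint s g ->
  sqint ss (fun z => f z.1 * g z.2).
Proof.
move=> [mf If] [mg Ig]; split; first by mfun.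
have := integrable_prod If Ig; apply: eq_integrable => // z _ /=.
by congr EFin; ring.
Qed.

Section functions.
Variables (I : eqType) (J : pred I) (a b : I -> X -> R).
Hypothesis sa : forall j, J j -> sqint s (a j).
Hypothesis sb : forall j, J j -> sqint s (b j).

(* Real and imaginary parts of [g_j(x) conj(g_j(y))], for [g_j = a_j + i b_j]. *)
Definition reU j (z : X * X) : R := a j z.1 * a j z.2 + b j z.1 * b j z.2.
Definition imU j (z : X * X) : R := b j z.1 * a j z.2 - a j z.1 * b j z.2.

Definition pairU j : (X * X -> R) * (X * X -> R) := (reU j, imU j).

Definition pairUf j : (X * X -> R) * (X * X -> R) :=
  (fun z => reU j (flip z), fun z => imU j (flip z)).

(* The antipodal hypothesis makes these averages orthogonal, of norm at most 1. *)
Definition symU j : (X * X -> R) * (X * X -> R) :=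
  (fun z => 2^-1 * reU j z + 2^-1 * reU j (flip z),
   fun z => 2^-1 * imU j z + 2^-1 * imU j (flip z)).

(** With g~ the conjugate of g composed with [N], these four are the real and imaginary parts of
    <g_j, g_k> and of <g_j, g~_k>. *)
Definition re_ip j k := \int[s]_x (a j x * a k x + b j x * b k x).
Definition im_ip j k := \int[s]_x (b j x * a k x - a j x * b k x).
Definition re_ipN j k := \int[s]_x (a j x * a k (N x) - b j x * b k (N x)).
Definition im_ipN j k := \int[s]_x (a j x * b k (N x) + b j x * a k (N x)).

Lemma sqint2_pairU j : J j -> sqint2 ss (pairU j).
Proof.
move=> jJ; split; first by apply: sqintD; apply: sqint_tensor; auto.
have := sqintD (sqint_tensor (sb jJ) (sa jJ))
  (sqintZ (-1) (sqint_tensor (sa jJ) (sb jJ))).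
rewrite /pairU/= /imU; congr sqint; apply/funext => z; ring.
Qed.

Lemma sqint2_pairUf j : J j -> sqint2 ss (pairUf j).
Proof. by move=> /sqint2_pairU[h1 h2]; split; exact: sqint_flip. Qed.

Lemma sqint2_symU j : J j -> sqint2 ss (symU j).
Proof.
move=> jJ; have [h1 h2] := sqint2_pairU jJ; have [h3 h4] := sqint2_pairUf jJ.
by split; apply: sqintD; exact: sqintZ.
Qed.

Lemma Rintegral_square (p q : X -> R) :
  s.-integrable setT (EFin \o p) -> s.-integrable setT (EFin \o q) ->
  \int[ss]_z (p z.1 * p z.2 + q z.1 * q z.2) =
  (\int[s]_x p x) ^+ 2 + (\int[s]_x q x) ^+ 2.
Proof.
move=> Ip Iq; have Ipp := integrable_prod Ip Ip; have Iqq := integrable_prod Iq Iq.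
by rewrite RintegralD// !Rintegral_prod// !expr2.
Qed.

Let integrable2 (f g h k : X -> R) (e : R) : sqint s f -> sqint s g ->
  sqint s h -> sqint s k ->
  s.-integrable setT (EFin \o (fun x => f x * g x + e * (h x * k x))).
Proof.
move=> sf sg sh sk.
have := integrableD measurableT (sqint_mul sf sg)
   (integrableZl measurableT e (sqint_mul sh sk)).
by apply: eq_integrable.
Qed.

(** Inner products of rank-one kernels factor into |<g_j, g_k>| ^ 2, which is real, so nothing is
    lost in taking real parts. *)
Lemma ip2_UU j k : J j -> J k ->
  ip2 ss (pairU j) (pairU k) = re_ip j k ^+ 2 + im_ip j k ^+ 2.
Proof.
move=> jJ kJ; rewrite -Rintegral_square.
- by apply: eq_Rintegral => z _; rewrite /= /reU /imU; ring.
- have := integrable2 1 (sa jJ) (sa kJ) (sb jJ) (sb kJ).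
  by apply: eq_integrable => // x _ /=; rewrite mul1r.
- have := integrable2 (-1) (sb jJ) (sa kJ) (sa jJ) (sb kJ).
  by apply: eq_integrable => // x _ /=; rewrite mulN1r.
Qed.

(** Flipping the kernel g_k(x) conj(g_k(y)) produces the rank-one kernel of g~_k, whence |<g_j,
    g~_k>| ^ 2. This is where the antipodal inner products enter. *)
Lemma ip2_UUf j k : J j -> J k ->
  ip2 ss (pairU j) (pairUf k) = re_ipN j k ^+ 2 + im_ipN j k ^+ 2.
Proof.
move=> jJ kJ; rewrite -Rintegral_square.
- by apply: eq_Rintegral => z _; rewrite /= /reU /imU /flip/=; ring.
- have := integrable2 (-1) (sa jJ) (sqint_N (sa kJ)) (sb jJ) (sqint_N (sb kJ)).
  by apply: eq_integrable => // x _ /=; rewrite mulN1r.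
- have := integrable2 1 (sa jJ) (sqint_N (sb kJ)) (sb jJ) (sqint_N (sa kJ)).
  by apply: eq_integrable => // x _ /=; rewrite mul1r.
Qed.

Lemma ip2_UfUf j k : J j -> J k ->
  ip2 ss (pairUf j) (pairUf k) = ip2 ss (pairU j) (pairU k).
Proof.
move=> jJ kJ; rewrite /ip2 -[RHS]Rintegral_flip//.
by have := measurable_int _ (integrable_ip2 (sqint2_pairU jJ) (sqint2_pairU kJ));
  move/measurable_EFinP.
Qed.

(** Expresses the average through [sub2], for which bilinearity is available: U - U / 2 + U' / 2,
    with U' the flipped kernel. *)
Lemma symUE j : symU j = sub2 (- 2^-1) (sub2 2^-1 (pairU j) (pairU j)) (pairUf j).
Proof.
by congr pair; apply/funext => z /=; field.
Qed.

Lemma ip2_symU h j : J j -> sqint2 ss h ->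
  ip2 ss h (symU j) = 2^-1 * ip2 ss h (pairU j) + 2^-1 * ip2 ss h (pairUf j).
Proof.
move=> jJ sh; have s1 := sqint2_pairU jJ; have s2 := sqint2_pairUf jJ.
rewrite symUE ip2C ip2_sub//; last exact: sqint2_sub.
rewrite ip2_sub// !(ip2C _ _ h); by field.
Qed.

Lemma ip2_symU_symU j k : J j -> J k ->
  ip2 ss (symU j) (symU k) = 4^-1 * (2 * (re_ip j k ^+ 2 + im_ip j k ^+ 2) +
   (re_ipN j k ^+ 2 + im_ipN j k ^+ 2) + (re_ipN k j ^+ 2 + im_ipN k j ^+ 2)).
Proof.
move=> jJ kJ; have s1 := sqint2_pairU kJ; have s2 := sqint2_pairUf kJ.
rewrite ip2_symU//; last exact: sqint2_symU.
rewrite ip2C ip2_symU// [ip2 ss (symU j) _]ip2C ip2_symU//.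
rewrite (ip2C _ (pairUf k) (pairUf j)) ip2_UfUf//.
rewrite (ip2C _ (pairU k) (pairU j)) (ip2C _ (pairUf k) (pairU j)).
by rewrite !ip2_UU// !ip2_UUf//; field.
Qed.

Hypothesis orthonormal : forall j k, J j -> J k ->
  re_ip j k = (j == k)%:R /\ im_ip j k = 0.
Hypothesis antipodal : forall j k, J j -> J k -> j != k ->
  re_ipN j k = 0 /\ im_ipN j k = 0.

Lemma ip2_symU_orthogonal j k : J j -> J k -> j != k ->
  ip2 ss (symU j) (symU k) = 0.
Proof.
move=> jJ kJ jk; rewrite ip2_symU_symU//.
have [-> ->] := orthonormal jJ kJ; have [-> ->] := antipodal jJ kJ jk.
have [-> ->] := antipodal kJ jJ ltac:(by rewrite eq_sym).
by rewrite (negbTE jk) expr0n/= !addr0 !mulr0.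
Qed.

(** The squared norm is (1 + r) / 2 with r = |<g_j, g~_j>| ^ 2, and r <= 1 follows because the
    difference of the kernel and its flip has squared norm 2 - 2 r. *)
Lemma ip2_symU_le1 j : J j -> ip2 ss (symU j) (symU j) <= 1.
Proof.
move=> jJ; rewrite ip2_symU_symU//; have [re im] := orthonormal jJ jJ.
have s1 := sqint2_pairU jJ; have s2 := sqint2_pairUf jJ.
have := ip2_ge0 ss (sub2 1 (pairU j) (pairUf j)).
rewrite ip2_sub//; last exact: sqint2_sub.
rewrite !(ip2C _ _ (sub2 _ _ _)) !ip2_sub// ip2_UfUf// (ip2C _ (pairUf j)).
rewrite ip2_UU// ip2_UUf// re im eqxx/= expr1n expr0n/=.
lra.
Qed.

(* Since [(P, Q)] is invariant under [flip], pairing it with [pairU j] or with the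
   average [symU j] is the same, and Bessel's inequality applies to the latter;
   truncating the kernel to [T] beforehand does not change the pairings. *)
Lemma sum_sqr_pairing_le (P Q : X * X -> R) (T : X * X -> bool) (M : R)
    (l : seq I) : uniq l -> (forall j, j \in l -> J j) ->
  measurable_fun [set: X * X] P -> measurable_fun [set: X * X] Q ->
  measurable_fun [set: X * X] T ->
  (forall z, `|P z| <= M) -> (forall z, `|Q z| <= M) ->
  (forall z, P (flip z) = P z) -> (forall z, Q (flip z) = Q z) ->
  (forall z, T (flip z) = T z) ->
  (forall j z, j \in l -> ~~ T z -> reU j z = 0 /\ imU j z = 0) ->
  \sum_(j <- l) ip2 ss (P, Q) (pairU j) ^+ 2 <=
  \int[ss]_z ((T z)%:R * (P z ^+ 2 + Q z ^+ 2)).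
Proof.
move=> ul lJ mP mQ mT PM QM Pf Qf Tf lT.
have mTr : measurable_fun [set: X * X] (fun z => (T z)%:R : R).
  exact: measurable_bool_indic.
pose h : (X * X -> R) * (X * X -> R) :=
  (fun z => (T z)%:R * P z, fun z => (T z)%:R * Q z).
have ss_fin : (ss [set: X * X] < +oo)%E.
  have -> : ss setT = ((s \x s) (setT `*` setT))%E by rewrite setXTT.
  rewrite product_measure1E//.
  by rewrite lte_mul_pinfty// ge0_fin_numE.
have le1 (b0 : bool) (x : R) : `|x| <= M -> `|b0%:R * x| <= M.
  by case: b0; rewrite ?mul1r// mul0r normr0 => /(le_trans (normr_ge0 x)).
have sh : sqint2 ss h.
  split; apply: (sqint_bounded (M := M)) => // [|z]; try exact: measurable_funM.
  - exact/le1/PM.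
  - exact/le1/QM.
have E j : j \in l -> ip2 ss (P, Q) (pairU j) = ip2 ss h (symU j).
  move=> jl; have jJ := lJ j jl; have s1 := sqint2_pairU jJ.
  have mU := measurable_int _ (integrable_ip2 sh s1).
  have -> : ip2 ss (P, Q) (pairU j) = ip2 ss h (pairU j).
    apply: eq_Rintegral => z _; rewrite /=.
    case: (boolP (T z)) => [_|/(lT j z jl)[-> ->]]; first by rewrite !mul1r.
    by rewrite !mulr0.
  rewrite ip2_symU//.
  have -> : ip2 ss h (pairUf j) = ip2 ss h (pairU j).
    rewrite /ip2 -[RHS]Rintegral_flip; last by move/measurable_EFinP : mU.
    by apply: eq_Rintegral => z _; rewrite /= Pf Qf Tf.
  by field.
have -> : \int[ss]_z ((T z)%:R * (P z ^+ 2 + Q z ^+ 2)) = ip2 ss h h.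
  by apply: eq_Rintegral => z _ /=; case: (T z); rewrite /=; ring.
rewrite big_seq (eq_bigr (fun j => ip2 ss h (symU j) ^+ 2)); last first.
  by move=> j jl; rewrite E.
rewrite -big_seq; apply: bessel => // [j /lJ|j /lJ|j k /lJ jJ /lJ kJ].
- exact: sqint2_symU.
- exact: ip2_symU_le1.
- exact: ip2_symU_orthogonal.
Qed.

End functions.
End wigner_bessel.

(** * Energies of extensions *)

Section extension_energy.
Context {R : realType}.
Local Notation mR := (measurableTypeR R).
Variable w : R3 R -> R.
Hypothesis sw : schwartz w.
Variable s : {sigma_finite_measure set (mR3 R) -> \bar R}.
Hypothesis s_fin : (s [set: mR3 R] < +oo)%E.
Variables a b : mR3 R -> R.
Hypothesis sa : sqint s a.
Hypothesis sb : sqint s b.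

Let mw : measurable_fun [set: mR3 R] (w : mR3 R -> mR).
Proof. exact: schwartz_measurable. Qed.

Let Iw : (@leb3s R).-integrable [set: mR3 R] (EFin \o w).
Proof. exact: schwartz_integrable. Qed.

Let ma : measurable_fun [set: mR3 R] a. Proof. by case: sa. Qed.
Let mb : measurable_fun [set: mR3 R] b. Proof. by case: sb. Qed.

Let integrable_phase (f g : mR3 R -> R) (u v : mR3 R -> R) :
  sqint s f -> sqint s g -> measurable_fun [set: mR3 R] u ->
  measurable_fun [set: mR3 R] v -> (forall x, `|u x| <= 1) ->
  (forall x, `|v x| <= 1) ->
  s.-integrable setT (EFin \o (fun x => f x * u x + g x * v x)).
Proof.
move=> sf sg mu mv u1 v1.
have su : sqint s u by exact: (sqint_bounded (M := 1)).
have sv : sqint s v by exact: (sqint_bounded (M := 1)).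
have := integrableD measurableT (sqint_mul sf su) (sqint_mul sg sv).
by apply: eq_integrable.
Qed.

Let reG (z : mR3 R * mR3 R) : R := a z.1 * a z.2 + b z.1 * b z.2.
Let imG (z : mR3 R * mR3 R) : R := b z.1 * a z.2 - a z.1 * b z.2.

(** Real part of g(xi) conj(g(eta)) exp (- 2 pi i x . (xi - eta)), for g = a + i b. *)
Let k (x : mR3 R) (z : mR3 R * mR3 R) : R :=
  reG z * cos (phase3 x ((z.1 : R3 R) - (z.2 : R3 R))) +
  imG z * sin (phase3 x ((z.1 : R3 R) - (z.2 : R3 R))).

Let sqr_extension (x : mR3 R) :
  (\int[s]_xi (a xi * cos (phase3 x xi) + b xi * sin (phase3 x xi))) ^+ 2 +
  (\int[s]_xi (b xi * cos (phase3 x xi) - a xi * sin (phase3 x xi))) ^+ 2 =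
  \int[prodm s s]_z k x z.
Proof.
have mc : measurable_fun [set: mR3 R] (fun xi : mR3 R => cos (phase3 x xi) : R).
  by rewrite /phase3; mfun.
have ms : measurable_fun [set: mR3 R] (fun xi : mR3 R => sin (phase3 x xi) : R).
  by rewrite /phase3; mfun.
have c1 xi : `|cos (phase3 x xi)| <= 1 :> R by exact: cos_max.
have s1 xi : `|sin (phase3 x xi)| <= 1 :> R by exact: sin_max.
rewrite -Rintegral_square; last 2 first.
- exact: integrable_phase.
- have := integrable_phase sb (sqintZ (-1) sa) mc ms c1 s1.
  by apply: eq_integrable => // xi _ /=; congr EFin; ring.
apply: eq_Rintegral => z _; rewrite /k.
have -> : phase3 x ((z.1 : R3 R) - (z.2 : R3 R)) = phase3 x z.1 - phase3 x z.2.
  by rewrite /phase3 dot3Dr dot3Nr; ring.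
by rewrite cosB sinB /reG /imG; ring.
Qed.

(** Fubini with majorant |w| (|reG| + |imG|), integrable because on a finite measure space
    square-integrable functions are integrable. Integrating in x first yields the Fourier transform
    of [w] at the chord. *)
Lemma extension_energy :
  \int[leb3]_x (((\int[s]_xi
       (a xi * cos (phase3 x xi) + b xi * sin (phase3 x xi))) ^+ 2 +
     (\int[s]_xi
       (b xi * cos (phase3 x xi) - a xi * sin (phase3 x xi))) ^+ 2) * w x) =
  ip2 (prodm s s) (fun z => cosine3 w ((z.1 : R3 R) - (z.2 : R3 R)),
                   fun z => sine3 w ((z.1 : R3 R) - (z.2 : R3 R))) (reG, imG).
Proof.
have ssre : sqint (prodm s s) reG by apply: sqintD; exact: sqint_tensor.
have ssim : sqint (prodm s s) imG.
  have := sqintD (sqint_tensor sb sa) (sqintZ (-1) (sqint_tensor sa sb)).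
  by congr sqint; apply/funext => z; rewrite /imG; ring.
have sqint1 (f : mR3 R * mR3 R -> R) : sqint (prodm s s) f ->
    (prodm s s).-integrable setT (EFin \o f).
  move=> sf; have s1 : sqint (prodm s s) (fun=> 1 : R).
    have h1 : sqint s (fun=> 1 : R).
      by apply: (sqint_bounded (M := 1)) => // x; rewrite normr1.
    have := sqint_tensor h1 h1.
    by congr sqint; apply/funext => z; rewrite mulr1.
  by have := sqint_mul sf s1; apply: eq_integrable => // x _ /=; rewrite mulr1.
have Ire := sqint1 _ ssre; have Iim := sqint1 _ ssim.
have mre : measurable_fun [set: mR3 R * mR3 R] reG by case: ssre.
have mim : measurable_fun [set: mR3 R * mR3 R] imG by case: ssim.
have mk : measurable_fun [set: mR3 R * (mR3 R * mR3 R)] (fun p => k p.1 p.2).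
  rewrite /k /phase3; mfun.
have c1 (u : R) : `|cos u| <= 1 by exact: cos_max.
have s1 (u : R) : `|sin u| <= 1 by exact: sin_max.
have k_le x z : `|k x z| <= `|reG z| + `|imG z|.
  by rewrite (le_trans (ler_normD _ _))// lerD// normrM ler_piMr.
have Ib : (prodm s s).-integrable setT (EFin \o (fun z => `|reG z| + `|imG z|)).
  have := integrableD measurableT (integrable_norm Ire) (integrable_norm Iim).
  by apply: eq_integrable.
have Ik x : (prodm s s).-integrable setT (EFin \o k x).
  apply: (le_integrable measurableT _ _ Ib) => /=.
    apply/measurable_EFinP.
    by apply: (measurableT_comp mk (g := fun z : mR3 R * mR3 R => (x, z))); mfun.
  move=> z _; rewrite lee_fin (le_trans (k_le x z))//.
  by rewrite [leRHS]ger0_norm ?addr_ge0.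
have IH : (prodm leb3s (prodm s s)).-integrable setT
    (EFin \o (fun p : mR3 R * (mR3 R * mR3 R) => w p.1 * k p.1 p.2)).
  apply: (le_integrable measurableT _ _ (integrable_prod (integrable_norm Iw) Ib)).
    by apply/measurable_EFinP; mfun.
  move=> z _; rewrite lee_fin /= normrM [leRHS]ger0_norm; last first.
    by rewrite mulr_ge0 ?addr_ge0.
  by rewrite ler_wpM2l.
transitivity (\int[leb3s]_x (\int[prodm s s]_z (w x * k x z))).
  apply: eq_Rintegral => x _; rewrite sqr_extension RintegralZl//.
  by rewrite mulrC.
rewrite (Rintegral_fubini1 IH) -(Rintegral_fubini2 IH).
apply: eq_Rintegral => z _ /=.
set y : R3 R := (z.1 : R3 R) - (z.2 : R3 R).
have Iwb (c : mR3 R -> R) : measurable_fun [set: mR3 R] c ->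
    (forall x, `|c x| <= 1) ->
    (@leb3s R).-integrable setT (EFin \o (fun x => w x * c x)).
  move=> mc c1'; apply: (le_integrable measurableT _ _ Iw) => /=.
    by apply/measurable_EFinP; mfun.
  by move=> x _; rewrite lee_fin normrM ler_piMr.
have Ic : (@leb3s R).-integrable setT (EFin \o (fun x => w x * cos (phase3 x y))).
  by apply: Iwb => //; rewrite /phase3; mfun.
have Is : (@leb3s R).-integrable setT (EFin \o (fun x => w x * sin (phase3 x y))).
  by apply: Iwb => //; rewrite /phase3; mfun.
transitivity (\int[leb3s]_x (reG z * (w x * cos (phase3 x y)) +
                             imG z * (w x * sin (phase3 x y)))).
  by apply: eq_Rintegral => x _; rewrite /k -/y; ring.
rewrite RintegralD//; last 2 first.
- by have := integrableZl measurableT (reG z) Ic; apply: eq_integrable.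
- by have := integrableZl measurableT (imG z) Is; apply: eq_integrable.
by rewrite !RintegralZl// mulrC [imG z * _]mulrC.
Qed.

End extension_energy.

(** * Representatives carried by the essential support *)

Section essential_part.
Context {R : realType}.
Local Notation mR := (measurableTypeR R).
Local Notation sigma := (@surface_measure R).
Implicit Types (f g : R3 R -> R[i]).

Lemma integral_carrier d (T : measurableType d)
    (mu : {measure set T -> \bar R}) (D : set T) (f : T -> \bar R) :
  measurable D -> mu (~` D) = 0%E -> measurable_fun [set: T] f ->
  (\int[mu]_x f x = \int[mu]_(x in D) f x)%E.
Proof.
move=> mD D0 mf; rewrite integralE [RHS]integralE.
congr (_ - _)%E; apply: ge0_integral_carrier => //.
- exact: measurable_funepos.
- exact: measurable_funeneg.
Qed.

Lemma Rintegral_surface (s : {measure set (mR3 R) -> \bar R})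
    (phi psi : mR3 R -> mR) :
  (forall A, s A = sigma A) ->
  measurable_fun (sphere2 : set (mR3 R)) phi ->
  measurable_fun [set: mR3 R] psi ->
  {ae sigma, forall x, sphere2 x -> phi x = psi x} ->
  \int[sigma]_(x in sphere2) phi x = \int[s]_x psi x.
Proof.
move=> sE mphi mpsi ae; rewrite /Rintegral; congr fine.
transitivity (\int[sigma]_(x in sphere2) (psi x)%:E)%E.
  apply: ae_eq_integral.
  - exact: measurable_sphere2.
  - exact/measurable_EFinP.
  - by apply/measurable_EFinP; exact: measurable_funS mpsi.
  - move: ae; apply: (@filterS _ _ (ae_filter_ringOfSetsType sigma)) => x h Dx.
    by rewrite /= h.
transitivity (\int[sigma]_x (psi x)%:E)%E.
  symmetry; apply: integral_carrier.
  - exact: measurable_sphere2.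
  - exact: surface_measureC_sphere.
  - exact/measurable_EFinP.
exact: eq_measure_integralT.
Qed.

Lemma ae_surfaceN (P : R3 R -> Prop) :
  {ae sigma, forall x, P x} -> {ae sigma, forall x, P (- x)}.
Proof.
move=> [B [mB B0 PB]].
have mN : measurable_fun [set: mR3 R] (fun x : mR3 R => - (x : R3 R) : mR3 R).
  by mfun.
have mB' : measurable ((fun x : mR3 R => - (x : R3 R) : mR3 R) @^-1` B).
  by rewrite -[X in measurable X]setTI; exact: mN.
exists ((fun x : mR3 R => - (x : R3 R) : mR3 R) @^-1` B); split; first exact: mB'.
- transitivity (\int[sigma]_x (\1_B (- (x : R3 R) : mR3 R))%:E)%E.
    rewrite (_ : (fun x => _) = (fun x => (\1_((fun x : mR3 R =>
      - (x : R3 R) : mR3 R) @^-1` B) x)%:E)); last first.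
      by apply/funext => x; rewrite !indicE.
    by rewrite (integral_indic _ measurableT mB') setIT.
  rewrite (surface_integralN (f := fun x => (\1_B x)%:E)).
  + by rewrite (integral_indic _ measurableT mB) setIT.
  + by apply/measurable_EFinP; exact: measurable_indic.
  + by move=> x; rewrite lee_fin.
- by move=> x /= nPx; apply: PB.
Qed.

(** A representative measurable on all of R^3 and zero everywhere off the support, not just almost
    everywhere, so that truncating the kernel to pairs of support points is exact at every point. *)
Definition ess_part f (h : R[i] -> R) (x : R3 R) : R :=
  if x \in ess_support f then h (f x) else 0.

Definition ess_re f := ess_part f (@complex.Re R).
Definition ess_im f := ess_part f (@complex.Im R).

Lemma ess_support_sphere f x : ess_support f x -> sphere2 x.
Proof. by case. Qed.

Lemma ess_reP f : {ae sigma, forall x, sphere2 x ->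
  complex.Re (f x) = ess_re f x /\ complex.Im (f x) = ess_im f x}.
Proof.
have := ess_supportP f.
apply: (@filterS _ _ (ae_filter_ringOfSetsType sigma)) => x h Sx.
rewrite /ess_re /ess_im /ess_part; case: (boolP (x \in ess_support f)) => //.
by move/negP; rewrite inE => /(h Sx) ->.
Qed.

Lemma measurable_ess_mem f :
  measurable_fun [set: mR3 R] (fun x : mR3 R => (x : R3 R) \in ess_support f).
Proof.
apply: (@measurable_fun_bool _ _ _ _ true); rewrite setTI.
rewrite (_ : _ @^-1` _ = (ess_support f : set (mR3 R))).
  exact: measurable_ess_support.
by apply/seteqP; split => x h; [exact: set_mem|exact: mem_set].
Qed.

Lemma measurable_ess_part f h :
  measurable_fun (sphere2 : set (mR3 R)) (fun x : mR3 R => h (f x) : mR) ->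
  measurable_fun [set: mR3 R] (ess_part f h : mR3 R -> mR).
Proof.
move=> mh; apply: measurable_fun_if => //.
- exact: measurable_ess_mem.
- apply: measurable_funS mh; first exact: measurable_sphere2.
  by move=> x [_ /set_mem]; exact: ess_support_sphere.
Qed.

Section L2.
Variable s : {measure set (mR3 R) -> \bar R}.
Hypothesis sE : forall A, s A = sigma A.
Variable g : R3 R -> R[i].
Hypothesis gL2 : L2_sphere g.

Lemma L2_measurable_re :
  measurable_fun (sphere2 : set (mR3 R)) (fun x : mR3 R => complex.Re (g x) : mR).
Proof. by case: gL2. Qed.

Lemma L2_measurable_im :
  measurable_fun (sphere2 : set (mR3 R)) (fun x : mR3 R => complex.Im (g x) : mR).
Proof. by case: gL2. Qed.

Lemma sqint_ess_part h :
  measurable_fun (sphere2 : set (mR3 R)) (fun x : mR3 R => h (g x) : mR) ->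
  (forall z, h z ^+ 2 <= Normc.normc z ^+ 2) -> sqint s (ess_part g h).
Proof.
move=> mh hle; have mp := measurable_ess_part mh; split => //.
apply/integrableP; split; first by apply/measurable_EFinP; mfun.
case: gL2 => _ _; apply: le_lt_trans.
set F : mR3 R -> \bar R := (X in (\int[_]_x X x)%E).
have mF : measurable_fun [set: mR3 R] F.
  by apply: measurableT_comp => //; apply/measurable_EFinP; mfun.
have -> : (\int[s]_x F x = \int[sigma]_(x in sphere2) F x)%E.
  transitivity (\int[sigma]_x F x)%E.
    by symmetry; exact: eq_measure_integralT.
  apply: integral_carrier => //; [exact: measurable_sphere2|].
  exact: surface_measureC_sphere.
apply: le_ge0_integral => [x _|x Sx]; first exact: abse_ge0.
rewrite /F /= lee_fin ger0_norm ?sqr_ge0// /ess_part.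
by case: ifP => // _; rewrite expr0n sqr_ge0.
Qed.

Lemma sqint_ess_re : sqint s (ess_re g).
Proof.
apply: sqint_ess_part; first exact: L2_measurable_re.
by case=> u v /=; rewrite sqr_sqrtr ?addr_ge0 ?sqr_ge0// lerDl sqr_ge0.
Qed.

Lemma sqint_ess_im : sqint s (ess_im g).
Proof.
apply: sqint_ess_part; first exact: L2_measurable_im.
by case=> u v /=; rewrite sqr_sqrtr ?addr_ge0 ?sqr_ge0// lerDr sqr_ge0.
Qed.

End L2.
End essential_part.

Section essential_integrals.
Context {R : realType}.
Local Notation mR := (measurableTypeR R).
Local Notation sigma := (@surface_measure R).
Variable s : {measure set (mR3 R) -> \bar R}.
Hypothesis sE : forall A, s A = sigma A.

Let mS := @measurable_sphere2 R.

Lemma cintegral_ess (f : R3 R -> R[i]) (p q : mR3 R -> mR) :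
  measurable_fun (sphere2 : set (mR3 R)) (fun x : mR3 R => complex.Re (f x) : mR) ->
  measurable_fun (sphere2 : set (mR3 R)) (fun x : mR3 R => complex.Im (f x) : mR) ->
  measurable_fun [set: mR3 R] p -> measurable_fun [set: mR3 R] q ->
  {ae sigma, forall x, sphere2 x ->
     complex.Re (f x) = p x /\ complex.Im (f x) = q x} ->
  cintegral sigma sphere2 f = ((\int[s]_x p x) +i* (\int[s]_x q x))%C.
Proof.
move=> mre mim mp mq fpq; rewrite /cintegral; congr (_ +i* _)%C.
- apply: (Rintegral_surface sE mre mp); move: fpq.
  by apply: (@filterS _ _ (ae_filter_ringOfSetsType sigma)) => x h /h[].
- apply: (Rintegral_surface sE mim mq); move: fpq.
  by apply: (@filterS _ _ (ae_filter_ringOfSetsType sigma)) => x h /h[].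
Qed.

Section pair.
Variables g h : R3 R -> R[i].
Hypothesis gL2 : L2_sphere g.
Hypothesis hL2 : L2_sphere h.

Let gr := L2_measurable_re gL2.
Let gi := L2_measurable_im gL2.
Let hr := L2_measurable_re hL2.
Let hi := L2_measurable_im hL2.
Let mgr : measurable_fun [set: mR3 R] (ess_re g : mR3 R -> mR) :=
  measurable_ess_part gr.
Let mgi : measurable_fun [set: mR3 R] (ess_im g : mR3 R -> mR) :=
  measurable_ess_part gi.
Let mhr : measurable_fun [set: mR3 R] (ess_re h : mR3 R -> mR) :=
  measurable_ess_part hr.
Let mhi : measurable_fun [set: mR3 R] (ess_im h : mR3 R -> mR) :=
  measurable_ess_part hi.

Let measurable_sphereN (f : mR3 R -> mR) :
  measurable_fun (sphere2 : set (mR3 R)) f ->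
  measurable_fun (sphere2 : set (mR3 R)) (fun x : mR3 R => f (- (x : R3 R))).
Proof.
move=> mf; apply: (measurable_comp (F := sphere2 : set (mR3 R))
  (g := fun x : mR3 R => - (x : R3 R) : mR3 R) mS _ mf).
  by move=> _ /= [x Sx <-]; rewrite /sphere2/= norm3N.
have mN : measurable_fun [set: mR3 R] (fun x : mR3 R => - (x : R3 R) : mR3 R).
  by mfun.
exact: measurable_funS mN.
Qed.

Lemma ReM (u v : R[i]) : complex.Re (u * v) =
  complex.Re u * complex.Re v - complex.Im u * complex.Im v.
Proof. by case: u v => [a b] [c e]. Qed.

Lemma ImM (u v : R[i]) : complex.Im (u * v) =
  complex.Re u * complex.Im v + complex.Im u * complex.Re v.
Proof. by case: u v => [a b] [c e]. Qed.

Lemma ReC (u : R[i]) : complex.Re (u^*)%C = complex.Re u.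
Proof. by case: u. Qed.

Lemma ImC (u : R[i]) : complex.Im (u^*)%C = - complex.Im u.
Proof. by case: u. Qed.

Lemma inner_sphere_ess : inner_sphere g h =
  ((\int[s]_x (ess_re g x * ess_re h x + ess_im g x * ess_im h x)) +i*
   (\int[s]_x (ess_im g x * ess_re h x - ess_re g x * ess_im h x)))%C.
Proof.
apply: cintegral_ess; [| |by mfun|by mfun|].
- rewrite (_ : (fun x : mR3 R => _ : mR) = (fun x => complex.Re (g x) * complex.Re (h x) +
    complex.Im (g x) * complex.Im (h x))); last first.
    by apply/funext => x; rewrite ReM ReC ImC; ring.
  by apply: measurable_funD; apply: measurable_funM.
- rewrite (_ : (fun x : mR3 R => _ : mR) = (fun x => complex.Im (g x) * complex.Re (h x) -
    complex.Re (g x) * complex.Im (h x))); last first.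
    by apply/funext => x; rewrite ImM ReC ImC; ring.
  by apply: measurable_funB; apply: measurable_funM.
- have := ess_reP h; have := ess_reP g.
  apply: (@filterS2 _ _ (ae_filter_ringOfSetsType sigma)) => x Hg Hh Sx.
  have [<- <-] := Hg Sx; have [<- <-] := Hh Sx.
  by rewrite ReM ImM ReC ImC; split; ring.
Qed.

Lemma inner_sphere_antipodal_ess : inner_sphere g (antipodal_conj h) =
  ((\int[s]_x (ess_re g x * ess_re h (- (x : R3 R)) -
               ess_im g x * ess_im h (- (x : R3 R)))) +i*
   (\int[s]_x (ess_re g x * ess_im h (- (x : R3 R)) +
               ess_im g x * ess_re h (- (x : R3 R)))))%C.
Proof.
have mN : measurable_fun [set: mR3 R] (fun x : mR3 R => - (x : R3 R) : mR3 R).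
  by mfun.
have mhrN : measurable_fun [set: mR3 R] (fun x : mR3 R => ess_re h (- (x : R3 R)) : mR).
  exact: (measurableT_comp mhr mN).
have mhiN : measurable_fun [set: mR3 R] (fun x : mR3 R => ess_im h (- (x : R3 R)) : mR).
  exact: (measurableT_comp mhi mN).
have hrN := measurable_sphereN hr; have hiN := measurable_sphereN hi.
apply: cintegral_ess; [| |by mfun|by mfun|].
- rewrite (_ : (fun x : mR3 R => _ : mR) = (fun x : mR3 R =>
    complex.Re (g x) * complex.Re (h (- (x : R3 R))) -
    complex.Im (g x) * complex.Im (h (- (x : R3 R))))); last first.
    by apply/funext => x; rewrite /antipodal_conj conjcK ReM.
  by apply: measurable_funB; apply: measurable_funM.
- rewrite (_ : (fun x : mR3 R => _ : mR) = (fun x : mR3 R =>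
    complex.Re (g x) * complex.Im (h (- (x : R3 R))) +
    complex.Im (g x) * complex.Re (h (- (x : R3 R))))); last first.
    by apply/funext => x; rewrite /antipodal_conj conjcK ImM.
  by apply: measurable_funD; apply: measurable_funM.
- have := ae_surfaceN (ess_reP h); have := ess_reP g.
  apply: (@filterS2 _ _ (ae_filter_ringOfSetsType sigma)) => x Hg Hh Sx.
  have SNx : sphere2 (- x) by rewrite /sphere2/= norm3N.
  have [<- <-] := Hg Sx; have [<- <-] := Hh SNx.
  by rewrite /antipodal_conj conjcK ReM ImM.
Qed.

Lemma extension_ess (x : R3 R) : extension g x =
  ((\int[s]_xi (ess_re g xi * cos (phase3 x xi) + ess_im g xi * sin (phase3 x xi))) +i*
   (\int[s]_xi (ess_im g xi * cos (phase3 x xi) - ess_re g xi * sin (phase3 x xi))))%C.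
Proof.
have mc : measurable_fun [set: mR3 R] (fun xi : mR3 R => cos (phase3 x xi) : mR).
  by rewrite /phase3; mfun.
have ms : measurable_fun [set: mR3 R] (fun xi : mR3 R => sin (phase3 x xi) : mR).
  by rewrite /phase3; mfun.
have mcS := measurable_funS measurableT (@subsetT _ (sphere2 : set (mR3 R))) mc.
have msS := measurable_funS measurableT (@subsetT _ (sphere2 : set (mR3 R))) ms.
apply: cintegral_ess; [| |by mfun|by mfun|].
- rewrite (_ : (fun xi : mR3 R => _ : mR) = (fun xi : mR3 R =>
    complex.Re (g xi) * cos (phase3 x xi) +
    complex.Im (g xi) * sin (phase3 x xi))); last first.
    by apply/funext => xi; rewrite ReM /phase3/=; ring.
  by apply: measurable_funD; apply: measurable_funM.
- rewrite (_ : (fun xi : mR3 R => _ : mR) = (fun xi : mR3 R =>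
    complex.Im (g xi) * cos (phase3 x xi) -
    complex.Re (g xi) * sin (phase3 x xi))); last first.
    by apply/funext => xi; rewrite ImM /phase3/=; ring.
  by apply: measurable_funB; apply: measurable_funM.
- have := ess_reP g.
  apply: (@filterS _ _ (ae_filter_ringOfSetsType sigma)) => xi Hg Sx.
  have [<- <-] := Hg Sx.
  by rewrite ReM ImM /phase3/=; split; ring.
Qed.

End pair.

Lemma normc_sqr (u v : R) : Normc.normc (u +i* v)%C ^+ 2 = u ^+ 2 + v ^+ 2.
Proof. by rewrite /= sqr_sqrtr// addr_ge0 ?sqr_ge0. Qed.

End essential_integrals.

(** * Finite subfamilies and conclusion *)

Section finite_sum.
Context {R : realType}.
Local Notation mR := (measurableTypeR R).
Local Notation sigma := (@surface_measure R).
Variables (J : set nat) (g : nat -> R3 R -> R[i]).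
Hypothesis gL2 : forall j, J j -> L2_sphere (g j).
Hypothesis g_orthonormal : forall j k, J j -> J k ->
  inner_sphere (g j) (g k) = (j == k)%:R.
Hypothesis g_antipodal : forall j k, J j -> J k -> j != k ->
  inner_sphere (g j) (antipodal_conj (g k)) = 0.
Variable w : R3 R -> R.
Hypothesis sw : schwartz w.

Let energy j : R := \int[leb3]_x (Normc.normc (extension (g j) x) ^+ 2 * w x).

(** [flip] exchanges the two alternatives, so the set is invariant under it; the second accounts for
    the flipped half of each average. *)
Definition chord_set (l : seq nat) (z : mR3 R * mR3 R) : bool :=
  has (fun j => ((z.1 : R3 R) \in ess_support (g j)) &&
                ((z.2 : R3 R) \in ess_support (g j)) ||
                (- (z.1 : R3 R) \in ess_support (g j)) &&
                (- (z.2 : R3 R) \in ess_support (g j))) l.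

Lemma measurable_chord_set l :
  measurable_fun [set: mR3 R * mR3 R] (chord_set l).
Proof.
rewrite /chord_set; elim: l => [|j l IH] /=; first exact: measurable_cst.
apply: measurable_or => //; apply: measurable_or; apply: measurable_and.
- exact: (measurableT_comp (measurable_ess_mem (g j)) measurable_fst).
- exact: (measurableT_comp (measurable_ess_mem (g j)) measurable_snd).
- apply: (measurableT_comp (measurable_ess_mem (g j))
    (g := fun z : mR3 R * mR3 R => - (z.1 : R3 R) : mR3 R)); mfun.
- apply: (measurableT_comp (measurable_ess_mem (g j))
    (g := fun z : mR3 R * mR3 R => - (z.2 : R3 R) : mR3 R)); mfun.
Qed.

Lemma chord_set_sphere l xi eta : chord_set l (xi, eta) -> sphere2 xi.
Proof.
move=> /hasP[j _ /orP[]] /andP[/set_mem/ess_support_sphere + _] => //=.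
by rewrite /sphere2/= norm3N.
Qed.

(** R_omega commutes with the antipodal map, so omega is a midpoint of two points of the support in
    the second alternative as well: of - xi and - R_omega xi. *)
Lemma chord_set_diamond l omega xi : sphere2 omega ->
  chord_set l (xi, reflect3 omega xi) ->
  exists2 j, j \in l & diamond (ess_support (g j)) omega.
Proof.
move=> So /hasP[j jl /orP[]] /andP[/set_mem/= h1 /set_mem/= h2]; exists j => //.
  by split => //; exists xi.
split => //; exists (- (xi : R3 R)) => //.
suff -> : reflect3 omega (- (xi : R3 R)) = - reflect3 omega xi by [].
by rewrite /reflect3 dot3Nr mulrN scaleNr opprB opprK addrC.
Qed.

Lemma sum_energy_le (l : seq nat) : uniq l -> (forall j, j \in l -> J j) ->
  ((\sum_(j <- l) energy j ^+ 2)%:E <=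
   \int[sigma]_(omega in \bigcup_(j in J) diamond (ess_support (g j)))
      \int[plane_measure omega]_(v in perp omega)
        (`|xray w omega v| ^+ 2)%:E)%E.
Proof.
move=> ul lJ; have [s sE] := @surface_sigma_finite R.
have I (f : mR3 R -> \bar R) : (\int[sigma]_x f x = \int[s]_x f x)%E.
  exact: eq_measure_integralT.
have s_fin : (s [set: mR3 R] < +oo)%E.
  by rewrite sE; exact: surface_measure_lty.
pose N (x : mR3 R) : mR3 R := - (x : R3 R).
have mN : measurable_fun [set: mR3 R] N by rewrite /N; mfun.
have sN (f : mR3 R -> \bar R) : measurable_fun [set: mR3 R] f ->
    (forall x, 0 <= f x)%E -> (\int[s]_x f (N x) = \int[s]_x f x)%E.
  by move=> mf f0; rewrite -!I; exact: surface_integralN.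
pose a j : mR3 R -> R := ess_re (g j).
pose b j : mR3 R -> R := ess_im (g j).
have sa j : j \in l -> sqint s (a j).
  by move=> /lJ/gL2; exact: sqint_ess_re.
have sb j : j \in l -> sqint s (b j).
  by move=> /lJ/gL2; exact: sqint_ess_im.
pose P (z : mR3 R * mR3 R) := cosine3 w ((z.1 : R3 R) - (z.2 : R3 R)).
pose Q (z : mR3 R * mR3 R) := sine3 w ((z.1 : R3 R) - (z.2 : R3 R)).
have mD : measurable_fun [set: mR3 R * mR3 R]
  (fun z : mR3 R * mR3 R => (z.1 : R3 R) - (z.2 : R3 R) : mR3 R) by mfun.
have mP : measurable_fun [set: mR3 R * mR3 R] (P : _ -> mR).
  exact: (measurableT_comp (measurable_cosine3 sw) mD).
have mQ : measurable_fun [set: mR3 R * mR3 R] (Q : _ -> mR).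
  exact: (measurableT_comp (measurable_sine3 sw) mD).
have energyE j : j \in l -> energy j = ip2 (prodm s s) (P, Q) (pairU a b j).
  move=> jl; rewrite -(extension_energy sw s_fin (sa j jl) (sb j jl)).
  apply: eq_Rintegral => x _.
  by rewrite (extension_ess sE (gL2 (lJ j jl))) normc_sqr.
have flipE (z : mR3 R * mR3 R) : (- (z.2 : R3 R)) - (- (z.1 : R3 R)) =
    (z.1 : R3 R) - (z.2 : R3 R) by rewrite opprK addrC.
pose M : R := \int[leb3]_x `|w x|.
have B : \sum_(j <- l) ip2 (prodm s s) (P, Q) (pairU a b j) ^+ 2 <=
    \int[prodm s s]_z ((chord_set l z)%:R * (P z ^+ 2 + Q z ^+ 2)).
  apply: (@sum_sqr_pairing_le _ _ _ s s_fin N mN sN _ (fun j => j \in l)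
    a b sa sb _ _ P Q (chord_set l) M) => //.
  - move=> j k jl kl; have := g_orthonormal (lJ j jl) (lJ k kl).
    rewrite (inner_sphere_ess sE (gL2 (lJ j jl)) (gL2 (lJ k kl))).
    rewrite /re_ip /im_ip /a /b => /eqP; rewrite eq_complex/= => /andP[/eqP -> /eqP ->].
    by case: (j == k).
  - move=> j k jl kl jk; have := g_antipodal (lJ j jl) (lJ k kl) jk.
    rewrite (inner_sphere_antipodal_ess sE (gL2 (lJ j jl)) (gL2 (lJ k kl))).
    by rewrite /re_ipN /im_ipN /a /b /N => -[-> ->].
  - exact: measurable_chord_set.
  - by move=> z; exact: cosine3_bounded.
  - by move=> z; exact: sine3_bounded.
  - by move=> z; rewrite /P /flip/= /N flipE.
  - by move=> z; rewrite /Q /flip/= /N flipE.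
  - move=> z; apply: eq_has => j; rewrite /flip/= /N !opprK.
    by rewrite orbC andbC [X in _ || X]andbC.
  (* Off the chord set at least one of the two points lies outside the support of [g j], where both
     parts of its representative are 0. *)
  - move=> j z jl /hasPn/(_ j jl); rewrite negb_or => /andP[+ _].
    rewrite /reU /imU /a /b /ess_re /ess_im /ess_part negb_and.
    by move=> /orP[] /negbTE ->; rewrite ?mul0r ?mulr0 ?addr0 ?subr0.
rewrite big_seq (eq_bigr (fun j => ip2 (prodm s s) (P, Q) (pairU a b j) ^+ 2)); last first.
  by move=> j jl; rewrite energyE.
rewrite -big_seq.
have mT := measurable_chord_set l.
pose H (z : mR3 R * mR3 R) : \bar R :=
  ((chord_set l z)%:R * (P z ^+ 2 + Q z ^+ 2))%:E.
have H0 z : (0 <= H z)%E by rewrite lee_fin mulr_ge0 ?addr_ge0 ?sqr_ge0.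
have mH : measurable_fun [set: mR3 R * mR3 R] H by rewrite /H; mfun.
apply: (@le_trans _ _ (\int[prodm s s]_z H z)%E).
  apply: (le_trans (y := (fine (\int[prodm s s]_z H z))%:E)).
    by rewrite lee_fin.
  (* A nonnegative extended real dominates its [fine], even when infinite, since [fine] is then
     0. *)
  have : (0 <= \int[prodm s s]_z H z)%E by exact: integral_ge0.
  by case: (\int[prodm s s]_z H z)%E => //= _; rewrite leey.
rewrite (prodm_tonelli1 s s mH H0).
rewrite (_ : (\int[s]_x _ = \int[sigma]_xi \int[sigma]_eta
     ((chord_set l (xi, eta))%:R%:E *
      (cosine3 w ((xi : R3 R) - (eta : R3 R)) ^+ 2 +
       sine3 w ((xi : R3 R) - (eta : R3 R)) ^+ 2)%:E))%E); last first.
  by rewrite I; apply: eq_integral => xi _; rewrite I.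
apply: (chord_inequality sw mT) => [xi eta|omega xi So].
  exact: chord_set_sphere.
by move=> /(chord_set_diamond So)[j /lJ jJ hj]; exists j.
Qed.

End finite_sum.

Theorem theorem1p2 (R : realType) (J : set nat) (g : nat -> R3 R -> R[i])
    (gL2 : forall j, J j -> L2_sphere (g j))
    (g_orthonormal : forall j k, J j -> J k ->
       inner_sphere (g j) (g k) = (j == k)%:R)
    (g_antipodal : forall j k, J j -> J k -> j != k ->
       inner_sphere (g j) (antipodal_conj (g k)) = 0)
    (w : R3 R -> R) (w_schwartz : schwartz w) :
  let Kstar := \bigcup_(j in J) diamond (ess_support (g j)) in
  (\esum_(j in J)
      ((\int[leb3]_x (Normc.normc (extension (g j) x) ^+ 2 * w x)) ^+ 2)%R%:E <=
   \int[surface_measure]_(omega in Kstar)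
      \int[plane_measure omega]_(v in perp omega)
        (`|xray w omega v| ^+ 2)%:E)%E.
Proof.
(* A sum over [J] of nonnegative terms is the supremum of its finite partial sums, all bounded by
   the same right-hand side. *)
cbv zeta; apply: ge_ereal_sup => _ [A [finA AJ] <-].
rewrite fsbig_finite// sumEFin.
apply: (sum_energy_le gL2 g_orthonormal g_antipodal w_schwartz).
  exact: finmap.fset_uniq.
by move=> j; rewrite in_fset_set// => /set_mem/AJ.
Qed.
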